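(* The functions $I^4(\tau)$ and $J^4(\tau)$ are modular functions on $\Gamma_1(10)$, and the functions $I(4\tau)$ and $J(4\tau)$ are modular functions on $\Gamma_1(40)$.
   Context: $\tau\in\mathbb{H}$, $q=e^{2\pi i\tau}$, $q^r=e^{2\pi i r\tau}$ for rational $r$, $(a;q)_\infty=\prod_{n\ge0}(1-aq^n)$. Define $I(\tau)=q^{3/4}\dfrac{(q;q^{10})_\infty(q^9;q^{10})_\infty}{(q^4;q^{10})_\infty(q^6;q^{10})_\infty}$ and $J(\tau)=q^{1/4}\dfrac{(q^2;q^{10})_\infty(q^8;q^{10})_\infty}{(q^3;q^{10})_\infty(q^7;q^{10})_\infty}$. $\Gamma_1(N)$ is the group of $\begin{bmatrix} a&b\\ c&d\end{bmatrix}\in\mathrm{SL}_2(\mathbb{Z})$ with $a\equiv d\equiv1$, $c\equiv0\pmod N$. A modular function on $\Gamma$ is a function meromorphic on $\mathbb{H}$, invariant under $\Gamma$, and meromorphic at all cusps. *)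

(* Defs.v *)
From Stdlib Require Import Reals ZArith ClassicalEpsilon.
From Coquelicot Require Import Coquelicot.
Open Scope C_scope.

Definition cexp (z : C) : C :=
  (exp (Re z) * cos (Im z), exp (Re z) * sin (Im z))%R.

Definition qpow (r : R) (tau : C) : C :=
  cexp (RtoC (2 * PI * r)%R * Ci * tau).

Fixpoint cpow (z : C) (n : nat) : C :=
  match n with O => 1 | S k => cpow z k * z end.

Fixpoint qpoch_part (a q : C) (n : nat) : C :=
  match n with O => 1 | S k => qpoch_part a q k * (1 - a * cpow q k) end.

(* (a;q)_oo : the limit of the partial products (chosen by epsilon; it is
   the actual limit whenever the partial products converge, e.g. |q| < 1) *)
Definition qpoch_inf (a q : C) : C :=
  epsilon (inhabits (RtoC 0))
    (fun l => filterlim (qpoch_part a q) eventually (locally l)).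

Definition qq (tau : C) : C := qpow 1 tau.

Definition Ifun (tau : C) : C :=
  let q := qq tau in let q10 := cpow q 10 in
  qpow (3/4) tau * qpoch_inf q q10 * qpoch_inf (cpow q 9) q10
    / (qpoch_inf (cpow q 4) q10 * qpoch_inf (cpow q 6) q10).

Definition Jfun (tau : C) : C :=
  let q := qq tau in let q10 := cpow q 10 in
  qpow (1/4) tau * qpoch_inf (cpow q 2) q10 * qpoch_inf (cpow q 8) q10
    / (qpoch_inf (cpow q 3) q10 * qpoch_inf (cpow q 7) q10).

Definition upper (z : C) : Prop := (0 < Im z)%R.

Definition SL2Z (a b c d : Z) : Prop := (a * d - b * c = 1)%Z.
Definition Gamma1 (N : Z) (a b c d : Z) : Prop :=
  SL2Z a b c d /\ (N | a - 1)%Z /\ (N | d - 1)%Z /\ (N | c)%Z.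

Definition mob (a b c d : Z) (tau : C) : C :=
  (RtoC (IZR a) * tau + RtoC (IZR b)) / (RtoC (IZR c) * tau + RtoC (IZR d)).

Definition holo_at (f : C -> C) (z : C) : Prop :=
  exists l : C, @is_derive C_AbsRing C_NormedModule f z l.

(* P is a set of poles of f in H:  P is a discrete subset of H, and at each
   p in P, f has (at most) a pole, i.e. (w-p)^n f(w) is bounded on a
   punctured neighbourhood of p for some n. *)
Definition pole_set (f : C -> C) (P : C -> Prop) : Prop :=
  (forall p, P p -> upper p) /\
  (forall z, upper z -> exists r : R, (0 < r)%R /\
      forall w, P w -> (Cmod (w - z) < r)%R -> w = z) /\
  (forall p, P p -> exists (n : nat) (r M : R), (0 < r)%R /\
      forall w, (0 < Cmod (w - p) < r)%R -> (Cmod (cpow (w - p) n * f w) <= M)%R).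

Definition meromorphic_H_with (f : C -> C) (P : C -> Prop) : Prop :=
  pole_set f P /\ (forall z, upper z -> ~ P z -> holo_at f z).

Definition meromorphic_at_cusps (f : C -> C) : Prop :=
  forall a b c d : Z, SL2Z a b c d ->
    exists (h : nat) (n0 : Z) (coef : nat -> C) (M : R),
      (0 < h)%nat /\
      forall tau, upper tau -> (M < Im tau)%R ->
        @is_series C_AbsRing C_NormedModule
          (fun k => coef k * qpow (IZR (Z.of_nat k + n0) / INR h)%R tau)
          (f (mob a b c d tau)).

Definition modular_function_Gamma1 (N : Z) (f : C -> C) : Prop :=
  (exists P : C -> Prop,
     meromorphic_H_with f P /\
     (forall a b c d : Z, Gamma1 N a b c d -> forall tau, upper tau ->
        ~ P tau -> ~ P (mob a b c d tau) -> f (mob a b c d tau) = f tau)) /\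
  meromorphic_at_cusps f.

(* Main.v *)
(* Write [theta z T = e(-z/2) (e(z); q)_oo (q e(-z); q)_oo] with [e(z) = exp(2 pi i z)], [q = e(T)].
   For a matrix in SL_2(Z) with bottom row (c, d), acting on [T] and dividing [z] by [j = c T + d], the function
   [e(- c z^2 / (2 j)) theta (z / j) (gamma T)] of [z] has the same quasi-periods under [Z + Z T] and the same
   simple zeros as [theta z T], so the quotient is entire and doubly periodic, hence constant in [z]
   by the mean value property and the maximum of its real part on a period parallelogram.
   The unknown constant cancels in quotients of two theta values with the same [T], and both [I] and [J] are
   [e((g^2 - h^2) tau / (2 N)) theta (g tau) (N tau) / theta (h tau) (N tau)] with [N = 10] and
   [(g, h) = (1, 4)], [(2, 3)]; replacing [tau] by [4 tau] gives [N = 40] and [(4, 16)], [(8, 12)].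
   At a cusp, [N gamma] is factored as an element of SL_2(Z) times an upper triangular matrix, which
   reduces the expansion to that of q-products in a root of [e(tau)]. *)
Require Import Defs.
From Stdlib Require Import Reals ZArith Lra Lia Classical ClassicalEpsilon.
From Coquelicot Require Import Coquelicot.
Open Scope C_scope.

(** * Limits and series of complex numbers *)

(** Finding the constant in the transformation law would mean computing the multiplier of the eta
    function; it is avoided by using only quotients at a common [T]. There the factors e(c z^2 / (2
    j)) survive, and the prefactor e((g^2 - h^2) tau / (2 N)) is exactly what removes their
    dependence on [j]. On Gamma_1(N), with a = 1 + k N, what remains is e((g - h) (b + k) / 2 + (g^2
    - h^2) a b / (2 N)), so an r-th power is invariant as soon as 2 divides r (g - h) and 2 N
    divides r (g^2 - h^2). Passing from (N, g, h) to (4 N, 4 g, 4 h) multiplies g - h and (g^2 -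
    h^2) / N by 4, as the fourth power does: both operations cure the same obstruction. Two
    expansions of (x; q)_oo are used: Euler's series in x at fixed q for the dependence on z, and a
    power series in the nome for the dependence on tau and for the cusps. Derivatives are taken in
    the strict sense, so that they are continuous and the mean value property follows by
    differentiating under the integral sign. *)

Lemma cpow_Cpow z n : cpow z n = z ^ n.
Proof. induction n as [|n IH]; simpl; [easy|rewrite IH; ring]. Qed.

Lemma Cmod_minus_sym z w : Cmod (z - w) = Cmod (w - z).
Proof. rewrite <- Cmod_opp. f_equal. ring. Qed.

Lemma Cmod_minus_tri z w : (Cmod (z - w) <= Cmod z + Cmod w)%R.
Proof. rewrite <- (Cmod_opp w). apply Cmod_triangle. Qed.

Lemma Cmod_tri_via (x y z : C) : (Cmod (x - z) <= Cmod (x - y) + Cmod (y - z))%R.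
Proof. replace (x - z) with ((x - y) + (y - z)) by ring. apply Cmod_triangle. Qed.

Lemma Cmod_rev_tri z w : (Cmod z - Cmod w <= Cmod (z - w))%R.
Proof.
  assert (H := Cmod_triangle (z - w) w).
  replace (z - w + w) with z in H by ring. lra.
Qed.

Lemma im_le_Cmod z : (Rabs (Im z) <= Cmod z)%R.
Proof. eapply Rle_trans; [apply Rmax_r|apply (Rmax_Cmod z)]. Qed.

Lemma Cmod_le_re_im z : (Cmod z <= Rabs (Re z) + Rabs (Im z))%R.
Proof.
  replace z with (RtoC (Re z) + Ci * RtoC (Im z)) at 1.
  - eapply Rle_trans; [apply Cmod_triangle|].
    rewrite Cmod_mult, Cmod_Ci, !Cmod_R. lra.
  - destruct z; unfold Re, Im, RtoC, Ci, Cplus, Cmult; simpl; f_equal; ring.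
Qed.

Definition climit (u : nat -> C) (l : C) : Prop :=
  forall eps : R, (0 < eps)%R -> exists N, forall n, (N <= n)%nat -> (Cmod (u n - l) < eps)%R.

Lemma climit_filterlim (u : nat -> C) (l : C) :
  climit u l <-> filterlim u eventually (@locally C_UniformSpace l).
Proof.
  split.
  - intros H P [eps HP]. destruct (H eps (cond_pos eps)) as [N HN].
    exists N. intros n Hn. apply HP. apply C_NormedModule_mixin_compat1, HN, Hn.
  - intros H eps Heps.
    (* Balls of the product structure on [C] are squares, and [Cmod] may exceed their radius by a
       factor sqrt 2 <= 2. *)
    assert (He : (0 < eps / 2)%R) by lra.
    assert (L : @locally C_UniformSpace l (fun y => ball l (mkposreal _ He) y)).
    { exists (mkposreal _ He). intros y Hy. exact Hy. }
    destruct (H _ L) as [N HN]. exists N. intros n Hn.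
    assert (B := HN n Hn). apply C_NormedModule_mixin_compat2 in B.
    change (minus (u n) l) with (u n - l) in B.
    eapply Rlt_le_trans; [exact B|]. cbn [pos].
    assert (sqrt 2 <= 2)%R.
    { rewrite <- (sqrt_square 2) at 2 by lra. apply sqrt_le_1; lra. }
    nra.
Qed.

Lemma climit_unique u l l' : climit u l -> climit u l' -> l = l'.
Proof.
  intros H H'. apply Ceq_minus, Cmod_eq_0.
  destruct (Req_dec (Cmod (l - l')) 0) as [E|E]; [exact E|].
  assert (P := Cmod_ge_0 (l - l')).
  destruct (H (Cmod (l - l') / 2)%R) as [N HN]; [lra|].
  destruct (H' (Cmod (l - l') / 2)%R) as [N' HN']; [lra|].
  specialize (HN (N + N')%nat ltac:(lia)). specialize (HN' (N + N')%nat ltac:(lia)).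
  assert (T := Cmod_tri_via l (u (N + N')%nat) l').
  rewrite Cmod_minus_sym in HN. lra.
Qed.

Lemma climit_ext u v l : (forall n, u n = v n) -> climit u l -> climit v l.
Proof.
  intros E H eps He. destruct (H eps He) as [N HN]. exists N. intros n Hn.
  rewrite <- E. auto.
Qed.

Lemma climit_const l : climit (fun _ => l) l.
Proof.
  intros eps He. exists 0%nat. intros n _. replace (l - l) with (RtoC 0) by ring.
  rewrite Cmod_0. exact He.
Qed.

Lemma climit_shift u l k : climit u l -> climit (fun n => u (n + k)%nat) l.
Proof. intros H eps He. destruct (H eps He) as [N HN]. exists N. intros n Hn. apply HN. lia. Qed.

Lemma climit_plus u v l m : climit u l -> climit v m -> climit (fun n => u n + v n) (l + m).
Proof.
  intros H H' eps He.
  destruct (H (eps / 2)%R) as [N HN]; [lra|]. destruct (H' (eps / 2)%R) as [N' HN']; [lra|].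
  exists (N + N')%nat. intros n Hn.
  replace (u n + v n - (l + m)) with ((u n - l) + (v n - m)) by ring.
  eapply Rle_lt_trans; [apply Cmod_triangle|].
  specialize (HN n ltac:(lia)). specialize (HN' n ltac:(lia)). lra.
Qed.

Lemma climit_scal u l c : climit u l -> climit (fun n => c * u n) (c * l).
Proof.
  intros H eps He. assert (P := Cmod_ge_0 c).
  destruct (H (eps / (Cmod c + 1))%R) as [N HN]; [apply Rdiv_lt_0_compat; lra|].
  exists N. intros n Hn. replace (c * u n - c * l) with (c * (u n - l)) by ring.
  rewrite Cmod_mult. specialize (HN n Hn).
  assert (Q := Cmod_ge_0 (u n - l)).
  apply Rle_lt_trans with ((Cmod c) * (eps / (Cmod c + 1)))%R; [nra|].
  apply Rmult_lt_reg_r with (Cmod c + 1)%R; [lra|]. field_simplify; [nra|lra].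
Qed.

Lemma climit_Cmod_le u l a M :
  climit u l -> (exists N, forall n, (N <= n)%nat -> (Cmod (u n - a) <= M)%R) -> (Cmod (l - a) <= M)%R.
Proof.
  intros H [N HN]. apply Rnot_lt_le. intros Hlt.
  destruct (H (Cmod (l - a) - M)%R) as [N' HN']; [lra|].
  specialize (HN (N + N')%nat ltac:(lia)). specialize (HN' (N + N')%nat ltac:(lia)).
  assert (T := Cmod_tri_via l (u (N + N')%nat) a). rewrite Cmod_minus_sym in HN'. lra.
Qed.

Lemma climit_geom (u : nat -> C) l M t :
  (0 <= t < 1)%R -> (forall n, (Cmod (u n - l) <= M * t ^ n)%R) -> climit u l.
Proof.
  intros Ht H eps He.
  assert (HM : (0 <= M)%R). { assert (A := H 0%nat). assert (B := Cmod_ge_0 (u 0%nat - l)). simpl in A. lra. }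
  destruct (pow_lt_1_zero t ltac:(rewrite Rabs_right; lra) (eps / (M + 1))) as [N HN].
  { apply Rdiv_lt_0_compat; lra. }
  exists N. intros n Hn. specialize (HN n Hn). eapply Rle_lt_trans; [apply H|].
  assert (Q : (0 <= t ^ n)%R) by (apply pow_le; lra).
  rewrite Rabs_right in HN by lra.
  apply Rle_lt_trans with (M * (eps / (M + 1)))%R; [nra|].
  apply Rmult_lt_reg_r with (M + 1)%R; [lra|]. field_simplify; [nra|lra].
Qed.

Fixpoint csum (a : nat -> C) (n : nat) : C :=
  match n with O => 0 | S k => csum a k + a k end.

Definition cseries (a : nat -> C) (l : C) : Prop := climit (csum a) l.

Lemma sum_n_csum (a : nat -> C) n : @sum_n C_AbelianMonoid a n = csum a (S n).
Proof.
  induction n as [|n IH].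
  - rewrite sum_O. simpl. ring.
  - rewrite sum_Sn, IH. reflexivity.
Qed.

Lemma cseries_is_series (a : nat -> C) l :
  cseries a l -> @is_series C_AbsRing C_NormedModule a l.
Proof.
  intros H. unfold is_series.
  assert (K : climit (fun n => csum a (n + 1)) l) by (apply climit_shift, H).
  apply climit_filterlim. eapply climit_ext; [|exact K].
  intros n. simpl. replace (n + 1)%nat with (S n) by lia. symmetry. exact (sum_n_csum a n).
Qed.

Lemma csum_ext a b n : (forall k, (k < n)%nat -> a k = b k) -> csum a n = csum b n.
Proof. induction n as [|n IH]; intros H; simpl; [easy|rewrite IH, H by auto with arith; easy]. Qed.

Lemma csum_plus a b n : csum (fun k => a k + b k) n = csum a n + csum b n.
Proof. induction n as [|n IH]; simpl; [ring|rewrite IH; ring]. Qed.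

Lemma csum_scal c a n : csum (fun k => c * a k) n = c * csum a n.
Proof. induction n as [|n IH]; simpl; [ring|rewrite IH; ring]. Qed.

Lemma csum_first a n : csum a (S n) = a 0%nat + csum (fun k => a (S k)) n.
Proof. induction n as [|n IH]; [simpl; ring|]. change (csum a (S (S n))) with (csum a (S n) + a (S n)). rewrite IH. simpl. ring. Qed.

Lemma cseries_ext a b l : (forall k, a k = b k) -> cseries a l -> cseries b l.
Proof. intros H. apply climit_ext. intros n. apply csum_ext. auto. Qed.

Lemma cseries_plus a b l m : cseries a l -> cseries b m -> cseries (fun k => a k + b k) (l + m).
Proof. intros H H'. eapply climit_ext; [|apply (climit_plus _ _ _ _ H H')]. intros n. symmetry. apply csum_plus. Qed.

Lemma cseries_scal c a l : cseries a l -> cseries (fun k => c * a k) (c * l).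
Proof. intros H. eapply climit_ext; [|apply (climit_scal _ _ c H)]. intros n. symmetry. apply csum_scal. Qed.

Lemma cseries_first a l : cseries (fun k => a (S k)) l -> cseries a (a 0%nat + l).
Proof.
  intros H eps He. destruct (H eps He) as [N HN]. exists (S N). intros [|n] Hn; [lia|].
  rewrite csum_first.
  replace (a 0%nat + csum (fun k => a (S k)) n - (a 0%nat + l)) with (csum (fun k => a (S k)) n - l) by ring.
  apply HN. lia.
Qed.

(** The factor 1 - t^m keeps the geometric estimate exact, so that the induction on [m] closes. *)
Lemma csum_geom_diff a M t n m :
  (0 <= t < 1)%R -> (forall k, (Cmod (a k) <= M * t ^ k)%R) ->
  (Cmod (csum a (n + m) - csum a n) <= M * t ^ n / (1 - t) * (1 - t ^ m))%R.
Proof.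
  intros Ht H. induction m as [|m IH].
  - rewrite Nat.add_0_r. replace (csum a n - csum a n) with (RtoC 0) by ring.
    rewrite Cmod_0. simpl. lra.
  - replace (n + S m)%nat with (S (n + m)) by lia. simpl.
    replace (csum a (n + m) + a (n + m)%nat - csum a n) with ((csum a (n + m) - csum a n) + a (n + m)%nat) by ring.
    eapply Rle_trans; [apply Cmod_triangle|].
    specialize (H (n + m)%nat). rewrite pow_add in H.
    apply Rle_trans with (M * t ^ n / (1 - t) * (1 - t ^ m) + M * (t ^ n * t ^ m))%R; [lra|].
    right. field. lra.
Qed.

Lemma csum_geom_diff_le a M t n m :
  (0 <= t < 1)%R -> (forall k, (Cmod (a k) <= M * t ^ k)%R) -> (n <= m)%nat ->
  (Cmod (csum a m - csum a n) <= M / (1 - t) * t ^ n)%R.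
Proof.
  intros Ht H Hnm. replace m with (n + (m - n))%nat by lia.
  eapply Rle_trans; [apply (csum_geom_diff a M t); auto|].
  assert (HM : (0 <= M)%R). { assert (A := H 0%nat). assert (B := Cmod_ge_0 (a 0%nat)). simpl in A. lra. }
  assert (0 <= t ^ n)%R by (apply pow_le; lra). assert (0 <= t ^ (m - n))%R by (apply pow_le; lra).
  assert (0 <= M / (1 - t))%R by (apply Rdiv_le_0_compat; lra).
  replace (M * t ^ n / (1 - t))%R with (M / (1 - t) * t ^ n)%R by (field; lra).
  assert (0 <= M / (1 - t) * t ^ n)%R by (apply Rmult_le_pos; lra). nra.
Qed.

Lemma ex_climit_cauchy u :
  (forall eps, (0 < eps)%R -> exists N, forall n, (N <= n)%nat -> (Cmod (u n - u N) < eps)%R) ->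
  exists l, climit u l.
Proof.
  intros H.
  assert (K : forall p : C -> R, (forall z w, (Rabs (p z - p w) <= Cmod (z - w))%R) ->
            Cauchy_crit (fun n => p (u n))).
  { intros p Hp eps He. destruct (H (eps / 2)%R) as [N HN]; [lra|]. exists N. intros n m Hn Hm.
    unfold Rdist. eapply Rle_lt_trans; [apply Hp|].
    eapply Rle_lt_trans; [apply (Cmod_tri_via _ (u N))|].
    assert (A := HN n ltac:(lia)). assert (B := HN m ltac:(lia)). rewrite Cmod_minus_sym in B. lra. }
  destruct (Rcomplete.R_complete _ (K Re (fun z w => re_le_Cmod (z - w)))) as [x Hx].
  destruct (Rcomplete.R_complete _ (K Im (fun z w => im_le_Cmod (z - w)))) as [y Hy].
  exists (x, y). intros eps He.
  destruct (Hx (eps / 2)%R) as [N HN]; [lra|]. destruct (Hy (eps / 2)%R) as [N' HN']; [lra|].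
  exists (N + N')%nat. intros n Hn. eapply Rle_lt_trans; [apply Cmod_le_re_im|].
  specialize (HN n ltac:(lia)). specialize (HN' n ltac:(lia)). unfold Rdist in *.
  change (Re (u n - (x, y))) with (Re (u n) - x)%R. change (Im (u n - (x, y))) with (Im (u n) - y)%R. lra.
Qed.

Lemma ex_cseries_geom a M t :
  (0 <= t < 1)%R -> (forall k, (Cmod (a k) <= M * t ^ k)%R) -> exists l, cseries a l.
Proof.
  intros Ht H. apply ex_climit_cauchy. intros eps He.
  assert (HM : (0 <= M)%R). { assert (A := H 0%nat). assert (B := Cmod_ge_0 (a 0%nat)). simpl in A. lra. }
  set (K := (M / (1 - t))%R). assert (HK : (0 <= K)%R) by (apply Rdiv_le_0_compat; lra).
  destruct (pow_lt_1_zero t ltac:(rewrite Rabs_right; lra) (eps / (K + 1))) as [N HN].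
  { apply Rdiv_lt_0_compat; lra. }
  exists N. intros n Hn. eapply Rle_lt_trans; [apply (csum_geom_diff_le a M t); auto|].
  specialize (HN N (le_n N)). assert (Q : (0 <= t ^ N)%R) by (apply pow_le; lra).
  rewrite Rabs_right in HN by lra. fold K.
  apply Rle_lt_trans with (K * (eps / (K + 1)))%R; [nra|].
  apply Rmult_lt_reg_r with (K + 1)%R; [lra|]. field_simplify; [nra|lra].
Qed.

Lemma cseries_geom_tail a M t l n :
  (0 <= t < 1)%R -> (forall k, (Cmod (a k) <= M * t ^ k)%R) -> cseries a l ->
  (Cmod (l - csum a n) <= M / (1 - t) * t ^ n)%R.
Proof.
  intros Ht H Hl. eapply climit_Cmod_le; [exact Hl|]. exists n. intros m Hm.
  apply csum_geom_diff_le; auto.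
Qed.

Lemma cseries_geom_le a M t l :
  (0 <= t < 1)%R -> (forall k, (Cmod (a k) <= M * t ^ k)%R) -> cseries a l -> (Cmod l <= M / (1 - t))%R.
Proof.
  intros Ht H Hl. assert (A := cseries_geom_tail a M t l 0 Ht H Hl). simpl in A.
  replace (l - 0) with l in A by ring. lra.
Qed.

Definition csum_inf (a : nat -> C) : C := epsilon (inhabits (RtoC 0)) (cseries a).

Lemma csum_inf_spec a M t :
  (0 <= t < 1)%R -> (forall k, (Cmod (a k) <= M * t ^ k)%R) -> cseries a (csum_inf a).
Proof. intros Ht H. unfold csum_inf. apply epsilon_spec. eapply ex_cseries_geom; eauto. Qed.

Lemma cseries_unique a l l' : cseries a l -> cseries a l' -> l = l'.
Proof. apply climit_unique. Qed.

(** * Strict complex derivatives and power series *)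

(** Both points [v] and [w] vary near [z], unlike in the usual derivative. This strict form makes
    the derivative function continuous without an integral formula, and gives the local Lipschitz
    bound used for compositions. *)
Definition sderiv (f : C -> C) (z l : C) : Prop :=
  forall eps : R, (0 < eps)%R -> exists d : R, (0 < d)%R /\
    forall v w, (Cmod (v - z) < d)%R -> (Cmod (w - z) < d)%R ->
      (Cmod (f w - f v - l * (w - v)) <= eps * Cmod (w - v))%R.

Definition ccont (f : C -> C) (z : C) : Prop :=
  forall eps : R, (0 < eps)%R -> exists d : R, (0 < d)%R /\
    forall w, (Cmod (w - z) < d)%R -> (Cmod (f w - f z) < eps)%R.

Lemma Cmod_self z : Cmod (z - z) = 0%R.
Proof. replace (z - z) with (RtoC 0) by ring. apply Cmod_0. Qed.

Lemma sderiv_ccont f z l : sderiv f z l -> ccont f z.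
Proof.
  intros H eps He. destruct (H 1%R Rlt_0_1) as [d [Hd Hf]].
  assert (P := Cmod_ge_0 l).
  exists (Rmin d (eps / (Cmod l + 2))). split.
  { apply Rmin_glb_lt; [lra|apply Rdiv_lt_0_compat; lra]. }
  intros w Hw.
  assert (H1 : (Cmod (w - z) < d)%R) by (eapply Rlt_le_trans; [exact Hw|apply Rmin_l]).
  assert (H2 : (Cmod (w - z) < eps / (Cmod l + 2))%R) by (eapply Rlt_le_trans; [exact Hw|apply Rmin_r]).
  assert (K := Hf z w ltac:(rewrite Cmod_self; lra) H1).
  assert (T := Cmod_rev_tri (f w - f z) (l * (w - z))). rewrite Cmod_mult in T.
  assert (Q := Cmod_ge_0 (w - z)).
  assert (H3 : (Cmod (w - z) * (Cmod l + 2) < eps)%R).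
  { apply Rmult_lt_reg_r with (/ (Cmod l + 2))%R; [apply Rinv_0_lt_compat; lra|].
    rewrite Rmult_assoc, Rinv_r by lra. rewrite Rmult_1_r. exact H2. }
  nra.
Qed.

Lemma sderiv_lipschitz f z l : sderiv f z l -> exists K d, (0 < K)%R /\ (0 < d)%R /\
   forall v w, (Cmod (v - z) < d)%R -> (Cmod (w - z) < d)%R -> (Cmod (f w - f v) <= K * Cmod (w - v))%R.
Proof.
  intros H. destruct (H 1%R Rlt_0_1) as [d [Hd Hf]]. assert (P := Cmod_ge_0 l).
  exists (Cmod l + 1)%R, d. repeat split; [lra|lra|]. intros v w Hv Hw.
  assert (K := Hf v w Hv Hw).
  assert (T := Cmod_rev_tri (f w - f v) (l * (w - v))). rewrite Cmod_mult in T. lra.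
Qed.

Lemma sderiv_ext_loc f g z l r :
  (0 < r)%R -> (forall w, (Cmod (w - z) < r)%R -> f w = g w) -> sderiv f z l -> sderiv g z l.
Proof.
  intros Hr E H eps He. destruct (H eps He) as [d [Hd Hf]].
  exists (Rmin d r). split; [apply Rmin_glb_lt; lra|]. intros v w Hv Hw.
  assert (A := Rmin_l d r). assert (B := Rmin_r d r).
  rewrite <- !E by lra. apply Hf; lra.
Qed.

Lemma sderiv_ext f g z l : (forall w, f w = g w) -> sderiv f z l -> sderiv g z l.
Proof. intros E. apply (sderiv_ext_loc _ _ _ _ 1); auto; lra. Qed.

Lemma sderiv_const c z : sderiv (fun _ => c) z 0.
Proof.
  intros eps He. exists 1%R. split; [lra|]. intros v w _ _.
  replace (c - c - 0 * (w - v)) with (RtoC 0) by ring. rewrite Cmod_0.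
  assert (P := Cmod_ge_0 (w - v)). nra.
Qed.

Lemma sderiv_id z : sderiv (fun w => w) z 1.
Proof.
  intros eps He. exists 1%R. split; [lra|]. intros v w _ _.
  replace (w - v - 1 * (w - v)) with (RtoC 0) by ring. rewrite Cmod_0.
  assert (P := Cmod_ge_0 (w - v)). nra.
Qed.

Lemma sderiv_affine a b z : sderiv (fun w => a * w + b) z a.
Proof.
  intros eps He. exists 1%R. split; [lra|]. intros v w _ _.
  replace (a * w + b - (a * v + b) - a * (w - v)) with (RtoC 0) by ring. rewrite Cmod_0.
  assert (P := Cmod_ge_0 (w - v)). nra.
Qed.

Lemma sderiv_mult f g z l m :
  sderiv f z l -> sderiv g z m -> sderiv (fun w => f w * g w) z (l * g z + f z * m).
Proof.
  intros H H' eps He.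
  assert (Pl := Cmod_ge_0 l). assert (Pm := Cmod_ge_0 m).
  (* The error will split into four terms, each at most e K |w - v| with [K] and e <= 1 chosen next;
     hence the 4 K in [e]. *)
  assert (Pf := Cmod_ge_0 (f z)). assert (Pg := Cmod_ge_0 (g z)).
  set (K := (Cmod l + Cmod m + Cmod (f z) + Cmod (g z) + 2)%R).
  assert (HK : (0 < K)%R) by (unfold K; lra).
  set (e := Rmin 1 (eps / (4 * K))).
  assert (He0 : (0 < e)%R) by (apply Rmin_glb_lt; [lra|apply Rdiv_lt_0_compat; lra]).
  assert (He1 : (e <= 1)%R) by apply Rmin_l.
  assert (HeK : (e * (4 * K) <= eps)%R).
  { apply Rle_trans with (eps / (4 * K) * (4 * K))%R.
    - apply Rmult_le_compat_r; [lra|apply Rmin_r].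
    - right. field. lra. }
  destruct (H e He0) as [d1 [Hd1 Hf]]. destruct (H' e He0) as [d2 [Hd2 Hg]].
  destruct (sderiv_ccont _ _ _ H e He0) as [d3 [Hd3 Cf]].
  destruct (sderiv_ccont _ _ _ H' e He0) as [d4 [Hd4 Cg]].
  exists (Rmin (Rmin d1 d2) (Rmin d3 d4)).
  split; [repeat apply Rmin_glb_lt; lra|]. intros v w Hv Hw.
  assert (A := Rmin_l (Rmin d1 d2) (Rmin d3 d4)). assert (B := Rmin_r (Rmin d1 d2) (Rmin d3 d4)).
  assert (A1 := Rmin_l d1 d2). assert (A2 := Rmin_r d1 d2).
  assert (B1 := Rmin_l d3 d4). assert (B2 := Rmin_r d3 d4).
  specialize (Hf v w ltac:(lra) ltac:(lra)). specialize (Hg v w ltac:(lra) ltac:(lra)).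
  specialize (Cf v ltac:(lra)). specialize (Cg w ltac:(lra)).
  replace (f w * g w - f v * g v - (l * g z + f z * m) * (w - v)) with
    ((f w - f v - l * (w - v)) * ((g w - g z) + g z) + l * (w - v) * (g w - g z)
     + (((f v - f z) + f z) * (g w - g v - m * (w - v)) + (f v - f z) * (m * (w - v)))) by ring.
  set (F := f w - f v - l * (w - v)) in *. set (G := g w - g v - m * (w - v)) in *.
  set (a := f v - f z) in *. set (b := g w - g z) in *. set (h := w - v) in *.
  eapply Rle_trans; [apply Cmod_triangle|].
  eapply Rle_trans; [apply Rplus_le_compat; apply Cmod_triangle|].
  rewrite !Cmod_mult.
  assert (T1 := Cmod_triangle b (g z)). assert (T2 := Cmod_triangle a (f z)).
  assert (Ph := Cmod_ge_0 h). assert (Pa := Cmod_ge_0 a). assert (Pb := Cmod_ge_0 b).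
  assert (PF := Cmod_ge_0 F). assert (PG := Cmod_ge_0 G).
  assert (Pbg := Cmod_ge_0 (b + g z)). assert (Paf := Cmod_ge_0 (a + f z)).
  assert (S1 : (Cmod F * Cmod (b + g z) <= e * Cmod h * K)%R) by (apply Rmult_le_compat; unfold K; lra).
  assert (S2 : (Cmod (a + f z) * Cmod G <= K * (e * Cmod h))%R) by (apply Rmult_le_compat; unfold K; lra).
  assert (S3 : (Cmod l * Cmod h * Cmod b <= K * Cmod h * e)%R).
  { apply Rmult_le_compat; try lra; [apply Rmult_le_pos; lra|]. apply Rmult_le_compat_r; unfold K; lra. }
  assert (S4 : (Cmod a * (Cmod m * Cmod h) <= e * (K * Cmod h))%R).
  { apply Rmult_le_compat; try lra; [apply Rmult_le_pos; lra|]. apply Rmult_le_compat_r; unfold K; lra. }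
  apply Rle_trans with (e * (4 * K) * Cmod h)%R; [lra|]. apply Rmult_le_compat_r; lra.
Qed.

Lemma sderiv_comp f g z l m : sderiv g z m -> sderiv f (g z) l -> sderiv (fun w => f (g w)) z (l * m).
Proof.
  intros Hg Hf eps He.
  destruct (sderiv_lipschitz _ _ _ Hg) as [K [d1 [HK [Hd1 Lg]]]].
  assert (Pl := Cmod_ge_0 l).
  destruct (Hf (eps / (2 * K))%R) as [d2 [Hd2 Ff]]; [apply Rdiv_lt_0_compat; lra|].
  destruct (Hg (eps / (2 * (Cmod l + 1)))%R) as [d3 [Hd3 Gg]]; [apply Rdiv_lt_0_compat; lra|].
  destruct (sderiv_ccont _ _ _ Hg d2 Hd2) as [d4 [Hd4 Cg]].
  exists (Rmin (Rmin d1 d3) d4).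
  split; [repeat apply Rmin_glb_lt; lra|]. intros v w Hv Hw.
  assert (A := Rmin_l (Rmin d1 d3) d4). assert (B := Rmin_r (Rmin d1 d3) d4).
  assert (A1 := Rmin_l d1 d3). assert (A2 := Rmin_r d1 d3).
  specialize (Lg v w ltac:(lra) ltac:(lra)). specialize (Gg v w ltac:(lra) ltac:(lra)).
  assert (C1 := Cg v ltac:(lra)). assert (C2 := Cg w ltac:(lra)).
  specialize (Ff (g v) (g w) C1 C2).
  replace (f (g w) - f (g v) - l * m * (w - v)) with
    ((f (g w) - f (g v) - l * (g w - g v)) + l * (g w - g v - m * (w - v))) by ring.
  eapply Rle_trans; [apply Cmod_triangle|]. rewrite Cmod_mult.
  set (X := Cmod (g w - g v)) in *. set (h := Cmod (w - v)) in *.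
  set (G := Cmod (g w - g v - m * (w - v))) in *.
  assert (Ph : (0 <= h)%R) by apply Cmod_ge_0.
  assert (S1 : (eps / (2 * K) * X <= eps / 2 * h)%R).
  { apply Rle_trans with (eps / (2 * K) * (K * h))%R.
    - apply Rmult_le_compat_l; [apply Rlt_le, Rdiv_lt_0_compat; lra|exact Lg].
    - right. field. lra. }
  assert (S2 : (Cmod l * G <= eps / 2 * h)%R).
  { apply Rle_trans with ((Cmod l + 1) * (eps / (2 * (Cmod l + 1)) * h))%R.
    - apply Rmult_le_compat; try lra. apply Cmod_ge_0.
    - right. field. lra. }
  lra.
Qed.

Lemma sderiv_inv (z : C) : z <> 0 -> sderiv Cinv z (- / (z * z)).
Proof.
  intros Hz eps He. assert (Pz := proj1 (Cmod_gt_0 z) Hz).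
  set (r := Cmod z) in *.
  (* Within r / 2 of [z] one has r / 2 <= |v|, |w| <= 2 r, so at distance below d the error factor
     is at most 3 r d times 4 / r^4, that is 12 d / r^3. *)
  exists (Rmin (r / 2) (eps * (r * r * r) / 12)).
  assert (Hr3 : (0 < r * r * r)%R) by (repeat apply Rmult_lt_0_compat; lra).
  split. { apply Rmin_glb_lt; [lra|]. apply Rdiv_lt_0_compat; [apply Rmult_lt_0_compat; lra|lra]. }
  intros v w Hv Hw.
  assert (A := Rmin_l (r / 2) (eps * (r * r * r) / 12)). assert (B := Rmin_r (r / 2) (eps * (r * r * r) / 12)).
  set (d := Rmin (r / 2) (eps * (r * r * r) / 12)) in *.
  assert (Low : forall y, (Cmod (y - z) < d)%R -> (r / 2 <= Cmod y)%R).
  { intros y Hy. assert (T := Cmod_rev_tri z (z - y)). rewrite (Cmod_minus_sym z y) in T.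
    replace (z - (z - y)) with y in T by ring. fold r in T. lra. }
  assert (Lv := Low v Hv). assert (Lw := Low w Hw).
  assert (Nv : v <> 0). { intros ->. rewrite Cmod_0 in Lv. lra. }
  assert (Nw : w <> 0). { intros ->. rewrite Cmod_0 in Lw. lra. }
  replace (/ w - / v - - / (z * z) * (w - v)) with
    ((w - v) * ((w * (v - z) + z * (w - z)) * (/ (z * z) * / (v * w)))) by (field; auto).
  rewrite !Cmod_mult, !Cmod_inv by (try apply Cmult_neq_0; auto). rewrite !Cmod_mult. fold r.
  rewrite Rmult_comm. apply Rmult_le_compat_r; [apply Cmod_ge_0|].
  assert (Up : (Cmod w <= 2 * r)%R).
  { assert (T := Cmod_triangle (w - z) z). replace (w - z + z) with w in T by ring. fold r in T. lra. }
  assert (S1 : (Cmod (w * (v - z) + z * (w - z)) <= 3 * r * d)%R).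
  { eapply Rle_trans; [apply Cmod_triangle|]. rewrite !Cmod_mult. fold r.
    assert (Cmod w * Cmod (v - z) <= 2 * r * d)%R by (apply Rmult_le_compat; try apply Cmod_ge_0; lra).
    assert (r * Cmod (w - z) <= r * d)%R by (apply Rmult_le_compat_l; lra). lra. }
  assert (S2 : (/ (r * r) * / (Cmod v * Cmod w) <= / (r * r) * (4 / (r * r)))%R).
  { apply Rmult_le_compat_l; [apply Rlt_le, Rinv_0_lt_compat; nra|].
    replace (4 / (r * r))%R with (/ ((r / 2) * (r / 2)))%R by (field; lra).
    apply Rinv_le_contravar; [nra|]. apply Rmult_le_compat; lra. }
  apply Rle_trans with ((3 * r * d) * (/ (r * r) * (4 / (r * r))))%R.
  - apply Rmult_le_compat; auto; [apply Cmod_ge_0|].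
    apply Rmult_le_pos; apply Rlt_le, Rinv_0_lt_compat; [nra|]. apply Rmult_lt_0_compat; lra.
  - replace ((3 * r * d) * (/ (r * r) * (4 / (r * r))))%R with (d * (12 / (r * r * r)))%R by (field; lra).
    apply Rle_trans with (eps * (r * r * r) / 12 * (12 / (r * r * r)))%R.
    + apply Rmult_le_compat_r; [apply Rlt_le, Rdiv_lt_0_compat; lra|exact B].
    + right. field. lra.
Qed.

(** One difference quotient over a short real step at [w] is within eps / 3 of f'(z0), by strictness
    at [z0], and within eps / 3 of f'(w), by differentiability at [w]. *)
Lemma sderiv_derivative_ccont f f' z0 :
  (forall z, sderiv f z (f' z)) -> ccont f' z0.
Proof.
  intros H eps He. destruct (H z0 (eps / 3)%R) as [d [Hd Hf]]; [lra|].
  exists d. split; [exact Hd|]. intros w Hw.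
  destruct (H w (eps / 3)%R) as [d' [Hd' Hf']]; [lra|].
  set (t := (Rmin (d - Cmod (w - z0)) d' / 2)%R).
  assert (Ht : (0 < t)%R). { unfold t. assert (0 < Rmin (d - Cmod (w - z0)) d')%R by (apply Rmin_glb_lt; lra). lra. }
  assert (A := Rmin_l (d - Cmod (w - z0)) d'). assert (B := Rmin_r (d - Cmod (w - z0)) d').
  assert (E : Cmod (w + RtoC t - w) = t).
  { replace (w + RtoC t - w) with (RtoC t) by ring. rewrite Cmod_R, Rabs_right; lra. }
  assert (V : (Cmod (w + RtoC t - z0) < d)%R).
  { eapply Rle_lt_trans; [apply (Cmod_tri_via _ w)|]. rewrite E. unfold t in *. lra. }
  specialize (Hf w (w + RtoC t) Hw V).
  specialize (Hf' w (w + RtoC t) ltac:(rewrite Cmod_self; lra) ltac:(rewrite E; unfold t in *; lra)).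
  rewrite E in Hf, Hf'. replace (w + RtoC t - w) with (RtoC t) in Hf, Hf' by ring.
  assert (K : (Cmod ((f' w - f' z0) * RtoC t) <= 2 * eps / 3 * t)%R).
  { replace ((f' w - f' z0) * RtoC t) with
      ((f (w + RtoC t) - f w - f' z0 * RtoC t) - (f (w + RtoC t) - f w - f' w * RtoC t)) by ring.
    eapply Rle_trans; [apply Cmod_minus_tri|]. lra. }
  rewrite Cmod_mult, Cmod_R, (Rabs_right t) in K by lra.
  apply Rle_lt_trans with (2 * eps / 3)%R; [|lra]. apply Rmult_le_reg_r with t; [exact Ht|exact K].
Qed.

Lemma sderiv_is_derive f z l : sderiv f z l -> @is_derive C_AbsRing C_NormedModule f z l.
Proof.
  intros H. split.
  - apply @is_linear_scal_l.
  - intros y Hy.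
    assert (E : y = z). { symmetry. apply (is_filter_lim_locally_unique (K:=C_AbsRing) (V:=AbsRing_NormedModule C_AbsRing)). exact Hy. }
    subst y. intros eps. destruct (H eps (cond_pos eps)) as [d [Hd Hf]].
    exists (mkposreal d Hd). intros w Hw.
    change (Cmod (w - z) < d)%R in Hw.
    specialize (Hf z w ltac:(rewrite Cmod_self; exact Hd) Hw).
    rewrite (Cmult_comm l) in Hf. exact Hf.
Qed.

(** * Power series with explicit coefficient bounds *)

Definition pwr_bound (c : nat -> C) (M rho : R) : Prop := forall k, (Cmod (c k) <= M * rho ^ k)%R.

Definition psum (c : nat -> C) (z : C) : C := csum_inf (fun k => c k * z ^ k).

Lemma pwr_bound_term c M rho z k :
  pwr_bound c M rho -> (0 < rho)%R -> (Cmod (c k * z ^ k) <= M * (rho * Cmod z) ^ k)%R.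
Proof.
  intros H Hr. rewrite Cmod_mult, Cmod_pow, Rpow_mult_distr.
  rewrite <- Rmult_assoc. apply Rmult_le_compat_r; [apply pow_le, Cmod_ge_0|apply H].
Qed.

Lemma psum_spec c M rho z :
  pwr_bound c M rho -> (0 < rho)%R -> (rho * Cmod z < 1)%R -> cseries (fun k => c k * z ^ k) (psum c z).
Proof.
  intros H Hr Hz. apply (csum_inf_spec _ M (rho * Cmod z)).
  - split; [|exact Hz]. apply Rmult_le_pos; [lra|apply Cmod_ge_0].
  - intros k. apply pwr_bound_term; auto.
Qed.

Lemma psum_0 c M rho : pwr_bound c M rho -> (0 < rho)%R -> psum c 0 = c 0%nat.
Proof.
  intros H Hr. apply (cseries_unique (fun k => c k * (RtoC 0) ^ k)).
  - apply (psum_spec c M rho); auto. rewrite Cmod_0. lra.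
  - replace (c 0%nat) with (c 0%nat * (RtoC 0) ^ 0 + 0) at 1 by (simpl; ring).
    apply (cseries_first (fun k => c k * (RtoC 0) ^ k)).
    eapply climit_ext; [|apply climit_const]. intros n. induction n as [|n IH]; cbn [csum]; [easy|].
    rewrite <- IH. simpl. ring.
Qed.

(** The divided difference of x^k, that is the sum of the w^i v^(k-1-i); on the diagonal it is k
    z^(k-1). *)
Fixpoint hpow (k : nat) (w v : C) : C :=
  match k with O => 0 | S k => w * hpow k w v + v ^ k end.

Lemma hpow_spec k w v : w ^ k - v ^ k = (w - v) * hpow k w v.
Proof.
  induction k as [|k IH]; simpl; [ring|].
  replace (w * w ^ k - v * v ^ k) with (w * (w ^ k - v ^ k) + (w - v) * v ^ k) by ring.
  rewrite IH. ring.
Qed.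

Lemma Cpow_le z r k : (Cmod z <= r)%R -> (Cmod (z ^ k) <= r ^ k)%R.
Proof. intros H. rewrite Cmod_pow. apply pow_incr. split; [apply Cmod_ge_0|exact H]. Qed.

(** Multiplying by [r] avoids the exponent k - 1, just as [r * r] avoids k - 2 in the estimate of
    differences. *)
Lemma hpow_le k w v r : (0 < r)%R -> (Cmod w <= r)%R -> (Cmod v <= r)%R ->
  (Cmod (hpow k w v) * r <= INR k * r ^ k)%R.
Proof.
  intros Hr Hw Hv. induction k as [|k IH].
  - simpl. rewrite Cmod_0. lra.
  - change (hpow (S k) w v) with (w * hpow k w v + v ^ k). rewrite S_INR.
    apply Rle_trans with ((Cmod (w * hpow k w v) + Cmod (v ^ k)) * r)%R.
    { apply Rmult_le_compat_r; [lra|apply Cmod_triangle]. }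
    rewrite Cmod_mult. assert (P := Cpow_le v r k Hv).
    assert (Q := Cmod_ge_0 (hpow k w v)).
    assert (S1 : (Cmod w * (Cmod (hpow k w v) * r) <= r * (INR k * r ^ k))%R).
    { apply Rmult_le_compat; try lra; [apply Cmod_ge_0|apply Rmult_le_pos; lra]. }
    assert (S2 : (Cmod (v ^ k) * r <= r ^ k * r)%R) by (apply Rmult_le_compat_r; lra).
    simpl. lra.
Qed.

Lemma hpow_diff_le k w v z r d : (0 < r)%R -> (Cmod w <= r)%R -> (Cmod v <= r)%R -> (Cmod z <= r)%R ->
  (Cmod (w - z) <= d)%R -> (Cmod (v - z) <= d)%R ->
  (Cmod (hpow k w v - hpow k z z) * (r * r) <= INR k * INR k * r ^ k * d)%R.
Proof.
  intros Hr Hw Hv Hz Hwz Hvz.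
  assert (Hd : (0 <= d)%R) by (eapply Rle_trans; [apply Cmod_ge_0|exact Hwz]).
  induction k as [|k IH].
  - simpl. rewrite Cmod_self. lra.
  - change (hpow (S k) w v) with (w * hpow k w v + v ^ k).
    change (hpow (S k) z z) with (z * hpow k z z + z ^ k). rewrite S_INR.
    replace (w * hpow k w v + v ^ k - (z * hpow k z z + z ^ k)) with
      ((w - z) * hpow k w v + (z * (hpow k w v - hpow k z z) + (v ^ k - z ^ k))) by ring.
    rewrite (hpow_spec k v z).
    assert (L1 := hpow_le k w v r Hr Hw Hv). assert (L2 := hpow_le k v z r Hr Hv Hz).
    set (b := hpow k w v - hpow k z z) in *. set (a := hpow k w v) in *. set (c := hpow k v z) in *.
    apply Rle_trans with ((Cmod ((w - z) * a) + (Cmod (z * b) + Cmod ((v - z) * c))) * (r * r))%R.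
    { apply Rmult_le_compat_r; [nra|]. eapply Rle_trans; [apply Cmod_triangle|].
      apply Rplus_le_compat_l, Cmod_triangle. }
    rewrite !Cmod_mult.
    assert (Pa := Cmod_ge_0 a). assert (Pb := Cmod_ge_0 b). assert (Pc := Cmod_ge_0 c).
    assert (Pk := pos_INR k). assert (Pr : (0 <= r ^ k)%R) by (apply pow_le; lra).
    assert (S1 : (Cmod (w - z) * (Cmod a * r) <= d * (INR k * r ^ k))%R).
    { apply Rmult_le_compat; try lra; [apply Cmod_ge_0|apply Rmult_le_pos; lra]. }
    assert (S2 : (Cmod (v - z) * (Cmod c * r) <= d * (INR k * r ^ k))%R).
    { apply Rmult_le_compat; try lra; [apply Cmod_ge_0|apply Rmult_le_pos; lra]. }
    assert (S3 : (Cmod z * (Cmod b * (r * r)) <= r * (INR k * INR k * r ^ k * d))%R).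
    { assert (0 <= r * r)%R by nra. apply Rmult_le_compat;
        [apply Cmod_ge_0|apply Rmult_le_pos; lra|exact Hz|lra]. }
    simpl.
    assert (S1' := Rmult_le_compat_r r _ _ (Rlt_le _ _ Hr) S1).
    assert (S2' := Rmult_le_compat_r r _ _ (Rlt_le _ _ Hr) S2).
    assert (0 <= r * r ^ k * d)%R by (repeat apply Rmult_le_pos; lra).
    lra.
Qed.

Lemma sqr_pow_bound t : (0 <= t < 1)%R -> exists K, forall k, (INR k * INR k * t ^ k <= K)%R.
Proof.
  intros Ht.
  destruct (Req_dec t 0) as [->|Ht0].
  { exists 1%R. intros [|k]; [simpl; lra|]. rewrite pow_i by lia. lra. }
  set (s := ((1 - t) / t)%R).
  assert (Hs : (0 < s)%R) by (apply Rdiv_lt_0_compat; lra).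
  assert (Et : (t * (1 + s) = 1)%R) by (unfold s; field; lra).
  clearbody s.
  (* binomial expansion of (1+s)^k, truncated after the quadratic term *)
  assert (B : forall k, (1 + INR k * s + INR k * (INR k - 1) / 2 * (s * s) <= (1 + s) ^ k)%R).
  { induction k as [|k IH]; [simpl; lra|]. rewrite S_INR. simpl pow.
    assert (Pk := pos_INR k).
    assert (0 <= INR k * (INR k - 1))%R.
    { destruct k as [|k]; [simpl; lra|]. rewrite S_INR. assert (Q := pos_INR k). nra. }
    apply Rle_trans with ((1 + s) * (1 + INR k * s + INR k * (INR k - 1) / 2 * (s * s)))%R;
      [|apply Rmult_le_compat_l; lra].
    assert (0 <= s * s * s)%R by (repeat apply Rmult_le_pos; lra).
    assert (0 <= (INR k * (INR k - 1)) * (s * s * s))%R by (apply Rmult_le_pos; lra).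
    lra. }
  exists (2 / (s * s) + / s)%R. intros k.
  assert (P : (t ^ k * (1 + s) ^ k = 1)%R) by (rewrite <- Rpow_mult_distr, Et, pow1; easy).
  assert (Pt : (0 <= t ^ k)%R) by (apply pow_le; lra).
  assert (Pk := pos_INR k).
  assert (Q : (t ^ k * (1 + INR k * s + INR k * (INR k - 1) / 2 * (s * s)) <= 1)%R).
  { apply Rle_trans with (t ^ k * (1 + s) ^ k)%R; [|lra]. apply Rmult_le_compat_l; [exact Pt|apply B]. }
  assert (Hk : (0 <= INR k * (INR k - 1))%R).
  { destruct k as [|k]; [simpl; lra|]. rewrite S_INR. assert (Q' := pos_INR k). nra. }
  assert (Q1 : (t ^ k * INR k * s <= 1)%R).
  { assert (0 <= t ^ k * (INR k * (INR k - 1) / 2 * (s * s)))%R by (apply Rmult_le_pos; [lra|apply Rmult_le_pos; nra]). lra. }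
  assert (Q2 : (t ^ k * (INR k * (INR k - 1)) * (s * s) <= 2)%R).
  { assert (0 <= t ^ k * (INR k * s))%R by (repeat apply Rmult_le_pos; lra). lra. }
  assert (Q1' : (t ^ k * INR k <= / s)%R).
  { apply Rmult_le_reg_r with s; [lra|]. rewrite Rinv_l by lra. exact Q1. }
  assert (Q2' : (t ^ k * (INR k * (INR k - 1)) <= 2 / (s * s))%R).
  { apply Rmult_le_reg_r with (s * s)%R; [nra|]. replace (2 / (s * s) * (s * s))%R with 2%R by (field; lra). lra. }
  lra.
Qed.

(** The error f(w) - f(v) - l (w - v) is w - v times the series of the c_k (hpow k w v - hpow k z
    z). Since the |c_k| k^2 r^k are summable, that series is of the order of the larger of |w - z|
    and |v - z|. *)
Lemma psum_sderiv c M rho z :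
  pwr_bound c M rho -> (0 < rho)%R -> (rho * Cmod z < 1)%R ->
  exists l, cseries (fun k => c k * hpow k z z) l /\ sderiv (psum c) z l.
Proof.
  intros Hc Hrho Hz. assert (Pz := Cmod_ge_0 z).
  set (r := ((Cmod z + / rho) / 2)%R).
  assert (Hzi : (Cmod z < / rho)%R).
  { apply Rmult_lt_reg_l with rho; [lra|]. rewrite Rinv_r by lra. exact Hz. }
  assert (Hr0 : (0 < r)%R) by (unfold r; assert (0 < / rho)%R by (apply Rinv_0_lt_compat; lra); lra).
  assert (Hzr : (Cmod z < r)%R) by (unfold r; lra).
  assert (Hr1 : (rho * r < 1)%R).
  { apply Rlt_le_trans with (rho * / rho)%R; [apply Rmult_lt_compat_l; unfold r; lra|right; apply Rinv_r; lra]. }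
  assert (HM : (0 <= M)%R). { assert (A := Hc 0%nat). assert (B := Cmod_ge_0 (c 0%nat)). simpl in A. lra. }
  set (t := (rho * r)%R) in *. assert (Ht0 : (0 < t)%R) by (apply Rmult_lt_0_compat; lra).
  (* Writing t^k = s^k s^k lets one factor absorb k^2 and keeps the other as a summable majorant. *)
  set (s := sqrt t).
  assert (Hs0 : (0 < s)%R) by (apply sqrt_lt_R0; lra).
  assert (Hss : (s * s = t)%R) by (apply sqrt_sqrt; lra).
  assert (Hs1 : (s < 1)%R) by nra.
  destruct (sqr_pow_bound s) as [K HK]; [lra|].
  assert (HK0 : (0 <= K)%R) by (specialize (HK 0%nat); simpl in HK; lra).
  (* |c_k| k^2 r^k <= M K s^k, a summable majorant *)
  assert (Maj : forall k, (Cmod (c k) * (INR k * INR k * r ^ k) <= M * K * s ^ k)%R).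
  { intros k. assert (Pk := pos_INR k). assert (Pr : (0 <= r ^ k)%R) by (apply pow_le; lra).
    apply Rle_trans with (M * rho ^ k * (INR k * INR k * r ^ k))%R.
    { apply Rmult_le_compat_r; [repeat apply Rmult_le_pos; lra|apply Hc]. }
    replace (M * rho ^ k * (INR k * INR k * r ^ k))%R with (M * (INR k * INR k * s ^ k) * s ^ k)%R.
    2:{ replace (rho ^ k)%R with (s ^ k * s ^ k / r ^ k)%R.
        - field. apply pow_nonzero. lra.
        - rewrite <- Rpow_mult_distr, Hss. unfold t. rewrite Rpow_mult_distr. field. apply pow_nonzero. lra. }
    assert (0 <= s ^ k)%R by (apply pow_le; lra).
    apply Rmult_le_compat_r; [lra|]. apply Rmult_le_compat_l; [lra|apply HK]. }
  set (a := fun k => c k * hpow k z z).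
  assert (Ha : forall k, (Cmod (a k) <= (M * K / r) * s ^ k)%R).
  { intros k. unfold a. rewrite Cmod_mult.
    assert (L := hpow_le k z z r Hr0 ltac:(lra) ltac:(lra)).
    assert (N1 : (INR k * r ^ k <= INR k * INR k * r ^ k)%R).
    { apply Rmult_le_compat_r; [apply pow_le; lra|]. destruct k as [|k]; [simpl; lra|].
      rewrite S_INR. assert (Q := pos_INR k). nra. }
    apply Rmult_le_reg_r with r; [lra|].
    replace (M * K / r * s ^ k * r)%R with (M * K * s ^ k)%R by (field; lra).
    eapply Rle_trans; [|apply Maj]. rewrite Rmult_assoc.
    apply Rmult_le_compat_l; [apply Cmod_ge_0|lra]. }
  assert (Sa : cseries a (csum_inf a)) by (apply (csum_inf_spec _ _ s ltac:(lra) Ha)).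
  exists (csum_inf a). split; [exact Sa|].
  set (B := (M * K / (r * r) / (1 - s))%R).
  assert (HB : (0 <= B)%R).
  { unfold B. apply Rdiv_le_0_compat; [|lra]. apply Rdiv_le_0_compat; [|nra]. apply Rmult_le_pos; lra. }
  intros eps He.
  exists (Rmin (r - Cmod z) (eps / (B + 1))).
  split; [apply Rmin_glb_lt; [lra|apply Rdiv_lt_0_compat; lra]|].
  intros v w Hv Hw.
  assert (A1 := Rmin_l (r - Cmod z) (eps / (B + 1))). assert (A2 := Rmin_r (r - Cmod z) (eps / (B + 1))).
  set (d := Rmin (r - Cmod z) (eps / (B + 1))) in *.
  assert (In : forall y, (Cmod (y - z) < d)%R -> (Cmod y <= r)%R).
  { intros y Hy. assert (T := Cmod_triangle (y - z) z). replace (y - z + z) with y in T by ring. lra. }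
  assert (Iv := In v Hv). assert (Iw := In w Hw).
  assert (Conv : forall y, (Cmod y <= r)%R -> cseries (fun k => c k * y ^ k) (psum c y)).
  { intros y Hy. apply (psum_spec c M rho); auto. eapply Rle_lt_trans; [|exact Hr1].
    apply Rmult_le_compat_l; lra. }
  assert (Sd : cseries (fun k => (w - v) * (c k * (hpow k w v - hpow k z z)))
     (psum c w - psum c v - csum_inf a * (w - v))).
  { replace (psum c w - psum c v - csum_inf a * (w - v)) with
      ((psum c w + (-1) * psum c v) + (- (w - v)) * csum_inf a) by ring.
    eapply cseries_ext; [|apply cseries_plus; [apply cseries_plus;
      [apply (Conv w Iw)|apply (cseries_scal (-1) _ _ (Conv v Iv))]|apply (cseries_scal (- (w - v)) _ _ Sa)]].
    intros k. cbv beta. unfold a.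
    replace (c k * w ^ k + -1 * (c k * v ^ k)) with (c k * (w ^ k - v ^ k)) by ring.
    rewrite hpow_spec. ring. }
  assert (Tm : forall k, (Cmod ((w - v) * (c k * (hpow k w v - hpow k z z)))
       <= (Cmod (w - v) * (M * K / (r * r)) * d) * s ^ k)%R).
  { intros k. rewrite !Cmod_mult.
    assert (L := hpow_diff_le k w v z r d Hr0 Iw Iv ltac:(lra) ltac:(lra) ltac:(lra)).
    rewrite !Rmult_assoc. apply Rmult_le_compat_l; [apply Cmod_ge_0|].
    apply Rmult_le_reg_r with (r * r)%R; [nra|].
    replace (M * K / (r * r) * (d * s ^ k) * (r * r))%R with (M * K * s ^ k * d)%R by (field; lra).
    rewrite Rmult_assoc.
    apply Rle_trans with (Cmod (c k) * (INR k * INR k * r ^ k * d))%R.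
    { apply Rmult_le_compat_l; [apply Cmod_ge_0|exact L]. }
    rewrite <- Rmult_assoc. apply Rmult_le_compat_r; [|apply Maj].
    eapply Rle_trans; [apply (Cmod_ge_0 (v - z))|lra]. }
  assert (Fin := cseries_geom_le _ _ s _ ltac:(lra) Tm Sd).
  eapply Rle_trans; [exact Fin|].
  replace (Cmod (w - v) * (M * K / (r * r)) * d / (1 - s))%R with (B * d * Cmod (w - v))%R
    by (unfold B; field; lra).
  apply Rmult_le_compat_r; [apply Cmod_ge_0|].
  apply Rle_trans with (B * (eps / (B + 1)))%R; [apply Rmult_le_compat_l; lra|].
  apply Rmult_le_reg_r with (B + 1)%R; [lra|]. field_simplify; [nra|lra].
Qed.

(** Ratios tending to 0 give an infinite radius of convergence: past some index the bound propagates
    by induction, and the constant is enlarged for the finitely many earlier terms. *)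
Lemma ratio_pwr_bound (c : nat -> C) :
  (forall eta, (0 < eta)%R -> exists N, forall k, (N <= k)%nat -> (Cmod (c (S k)) <= eta * Cmod (c k))%R) ->
  forall rho, (0 < rho)%R -> exists M, pwr_bound c M rho.
Proof.
  intros H rho Hr. destruct (H rho Hr) as [N HN].
  assert (G : forall n, exists M, forall k, (k <= n)%nat -> (Cmod (c k) <= M * rho ^ k)%R).
  { induction n as [|n [M HM]].
    - exists (Cmod (c 0%nat)). intros k Hk. replace k with 0%nat by lia. simpl. lra.
    - exists (Rmax M (Cmod (c (S n)) / rho ^ (S n))). intros k Hk.
      assert (P : (0 < rho ^ k)%R) by (apply pow_lt; lra).
      destruct (Nat.eq_dec k (S n)) as [->|Hne].
      + apply Rle_trans with (Cmod (c (S n)) / rho ^ (S n) * rho ^ (S n))%R.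
        * right. field. apply pow_nonzero. lra.
        * apply Rmult_le_compat_r; [lra|apply Rmax_r].
      + eapply Rle_trans; [apply HM; lia|]. apply Rmult_le_compat_r; [lra|apply Rmax_l]. }
  destruct (G N) as [M HM]. exists M. intros k.
  induction k as [|k IH]; [apply HM; lia|].
  destruct (le_dec (S k) N) as [Hle|Hgt]; [apply HM, Hle|].
  eapply Rle_trans; [apply HN; lia|]. simpl.
  apply Rle_trans with (rho * (M * rho ^ k))%R; [apply Rmult_le_compat_l; lra|right; ring].
Qed.

(** * The complex exponential *)

(** Stated by components so that real derivative lemmas and [auto_derive] apply; [pderiv_eps] gives
    the complex form. *)
Definition pderiv (p : R -> C) (t : R) (v : C) : Prop :=
  is_derive (fun s => Re (p s)) t (Re v) /\ is_derive (fun s => Im (p s)) t (Im v).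

Lemma is_derive_eps (F : R -> R) t L :
  is_derive F t L <->
  forall eps, (0 < eps)%R -> exists d, (0 < d)%R /\
    forall s, (Rabs (s - t) < d)%R -> (Rabs (F s - F t - L * (s - t)) <= eps * Rabs (s - t))%R.
Proof.
  split.
  - intros [_ H] eps He.
    destruct (H t (fun P HP => HP) (mkposreal eps He)) as [d Hd].
    exists d. split; [apply cond_pos|]. intros s Hs. specialize (Hd s Hs).
    change (Rabs (F s - F t - (s - t) * L) <= eps * Rabs (s - t))%R in Hd.
    rewrite (Rmult_comm L). exact Hd.
  - intros H. split; [apply @is_linear_scal_l|]. intros y Hy.
    assert (E : y = t). { symmetry. apply (is_filter_lim_locally_unique (K:=R_AbsRing) (V:=R_NormedModule)). exact Hy. }
    subst y. intros eps. destruct (H eps (cond_pos eps)) as [d [Hd Hf]].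
    exists (mkposreal d Hd). intros s Hs. specialize (Hf s Hs).
    rewrite (Rmult_comm L) in Hf. exact Hf.
Qed.

Lemma pderiv_eps (p : R -> C) t v :
  pderiv p t v <->
  forall eps, (0 < eps)%R -> exists d, (0 < d)%R /\
    forall s, (Rabs (s - t) < d)%R -> (Cmod (p s - p t - v * RtoC (s - t)) <= eps * Rabs (s - t))%R.
Proof.
  assert (ER : forall s, (Re (p s - p t - v * RtoC (s - t)) = Re (p s) - Re (p t) - Re v * (s - t))%R).
  { intros s. destruct (p s), (p t), v. unfold Re, RtoC, Cminus, Cplus, Copp, Cmult. simpl. ring. }
  assert (EI : forall s, (Im (p s - p t - v * RtoC (s - t)) = Im (p s) - Im (p t) - Im v * (s - t))%R).
  { intros s. destruct (p s), (p t), v. unfold Im, RtoC, Cminus, Cplus, Copp, Cmult. simpl. ring. }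
  split.
  - intros [HR HI] eps He.
    destruct (proj1 (is_derive_eps _ _ _) HR (eps / 2)%R) as [d [Hd H]]; [lra|].
    destruct (proj1 (is_derive_eps _ _ _) HI (eps / 2)%R) as [d' [Hd' H']]; [lra|].
    exists (Rmin d d'). split; [apply Rmin_glb_lt; lra|]. intros s Hs.
    assert (A := Rmin_l d d'). assert (B := Rmin_r d d').
    specialize (H s ltac:(lra)). specialize (H' s ltac:(lra)).
    eapply Rle_trans; [apply Cmod_le_re_im|]. rewrite ER, EI. lra.
  - intros H. split; apply is_derive_eps; intros eps He; destruct (H eps He) as [d [Hd Hf]];
      exists d; (split; [exact Hd|]); intros s Hs; specialize (Hf s Hs).
    + rewrite <- ER. eapply Rle_trans; [apply re_le_Cmod|exact Hf].
    + rewrite <- EI. eapply Rle_trans; [apply im_le_Cmod|exact Hf].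
Qed.

Lemma pderiv_cont (p : R -> C) t v : pderiv p t v ->
  forall eps, (0 < eps)%R -> exists d, (0 < d)%R /\ forall s, (Rabs (s - t) < d)%R -> (Cmod (p s - p t) < eps)%R.
Proof.
  intros H eps He. destruct (proj1 (pderiv_eps _ _ _) H 1%R Rlt_0_1) as [d [Hd Hf]].
  assert (P := Cmod_ge_0 v).
  exists (Rmin d (eps / (Cmod v + 2))). split.
  { apply Rmin_glb_lt; [lra|apply Rdiv_lt_0_compat; lra]. }
  intros s Hs. assert (A := Rmin_l d (eps / (Cmod v + 2))). assert (B := Rmin_r d (eps / (Cmod v + 2))).
  specialize (Hf s ltac:(lra)).
  assert (T := Cmod_rev_tri (p s - p t) (v * RtoC (s - t))). rewrite Cmod_mult, Cmod_R in T.
  assert (Q := Rabs_pos (s - t)).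
  assert (H3 : (Rabs (s - t) * (Cmod v + 2) < eps)%R).
  { apply Rmult_lt_reg_r with (/ (Cmod v + 2))%R; [apply Rinv_0_lt_compat; lra|].
    rewrite Rmult_assoc, Rinv_r by lra. unfold Rdiv in *. lra. }
  nra.
Qed.

Lemma pderiv_comp f (p : R -> C) t v l :
  pderiv p t v -> sderiv f (p t) l -> pderiv (fun s => f (p s)) t (l * v).
Proof.
  intros Hp Hf. apply pderiv_eps. intros eps He.
  assert (Pl := Cmod_ge_0 l). assert (Pv := Cmod_ge_0 v).
  destruct (Hf (eps / (2 * (Cmod v + 1)))%R) as [d1 [Hd1 F1]]; [apply Rdiv_lt_0_compat; lra|].
  destruct (pderiv_cont _ _ _ Hp d1 Hd1) as [d2 [Hd2 F2]].
  destruct (proj1 (pderiv_eps _ _ _) Hp (Rmin 1 (eps / (2 * (Cmod l + 1))))) as [d3 [Hd3 F3]].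
  { apply Rmin_glb_lt; [lra|apply Rdiv_lt_0_compat; lra]. }
  assert (M1 := Rmin_l 1 (eps / (2 * (Cmod l + 1)))). assert (M2 := Rmin_r 1 (eps / (2 * (Cmod l + 1)))).
  set (e := Rmin 1 (eps / (2 * (Cmod l + 1)))) in *.
  exists (Rmin d2 d3). split; [apply Rmin_glb_lt; lra|]. intros s Hs.
  assert (A := Rmin_l d2 d3). assert (B := Rmin_r d2 d3).
  specialize (F2 s ltac:(lra)). specialize (F3 s ltac:(lra)).
  specialize (F1 (p t) (p s) ltac:(rewrite Cmod_self; lra) F2).
  set (h := Rabs (s - t)) in *. assert (Ph : (0 <= h)%R) by apply Rabs_pos.
  assert (L : (Cmod (p s - p t) <= (Cmod v + 1) * h)%R).
  { assert (T := Cmod_rev_tri (p s - p t) (v * RtoC (s - t))). rewrite Cmod_mult, Cmod_R in T. fold h in T. nra. }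
  replace (f (p s) - f (p t) - l * v * RtoC (s - t)) with
    ((f (p s) - f (p t) - l * (p s - p t)) + l * (p s - p t - v * RtoC (s - t))) by ring.
  eapply Rle_trans; [apply Cmod_triangle|]. rewrite Cmod_mult.
  assert (S1 : (eps / (2 * (Cmod v + 1)) * Cmod (p s - p t) <= eps / 2 * h)%R).
  { apply Rle_trans with (eps / (2 * (Cmod v + 1)) * ((Cmod v + 1) * h))%R.
    - apply Rmult_le_compat_l; [apply Rlt_le, Rdiv_lt_0_compat; lra|exact L].
    - right. field. lra. }
  assert (S2 : (Cmod l * Cmod (p s - p t - v * RtoC (s - t)) <= eps / 2 * h)%R).
  { apply Rle_trans with ((Cmod l + 1) * (eps / (2 * (Cmod l + 1)) * h))%R.
    - apply Rmult_le_compat; try lra. { apply Cmod_ge_0. }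
      eapply Rle_trans; [exact F3|]. apply Rmult_le_compat_r; lra.
    - right. field. lra. }
  lra.
Qed.

Lemma pderiv_mult p q t v w :
  pderiv p t v -> pderiv q t w -> pderiv (fun s => p s * q s) t (v * q t + p t * w).
Proof.
  intros [A B] [A' B']. split.
  - replace (Re (v * q t + p t * w)) with
      ((Re v * Re (q t) + Re (p t) * Re w) - (Im v * Im (q t) + Im (p t) * Im w))%R
      by (unfold Re, Im, Cplus, Cmult; simpl; ring).
    apply (is_derive_minus (fun s => Re (p s) * Re (q s))%R (fun s => Im (p s) * Im (q s))%R).
    + apply (is_derive_mult (fun s => Re (p s)) (fun s => Re (q s))); auto. exact Rmult_comm.
    + apply (is_derive_mult (fun s => Im (p s)) (fun s => Im (q s))); auto. exact Rmult_comm.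
  - replace (Im (v * q t + p t * w)) with
      ((Re v * Im (q t) + Re (p t) * Im w) + (Im v * Re (q t) + Im (p t) * Re w))%R
      by (unfold Re, Im, Cplus, Cmult; simpl; ring).
    apply (is_derive_plus (fun s => Re (p s) * Im (q s))%R (fun s => Im (p s) * Re (q s))%R).
    + apply (is_derive_mult (fun s => Re (p s)) (fun s => Im (q s))); auto. exact Rmult_comm.
    + apply (is_derive_mult (fun s => Im (p s)) (fun s => Re (q s))); auto. exact Rmult_comm.
Qed.

Lemma pderiv_linear a w t : pderiv (fun s => a + RtoC s * w) t w.
Proof.
  destruct a as [a1 a2]. destruct w as [w1 w2]. split; unfold Re, Im, RtoC, Cplus, Cmult; simpl;
    auto_derive; auto; ring.
Qed.

Lemma pderiv_0_const p a b : (a < b)%R -> (forall t, pderiv p t 0) -> p a = p b.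
Proof.
  intros Hab H. apply injective_projections.
  - apply (eq_is_derive (fun s => Re (p s)) a b); auto. intros t _. apply H.
  - apply (eq_is_derive (fun s => Im (p s)) a b); auto. intros t _. apply H.
Qed.

Lemma cexp_plus z w : cexp (z + w) = cexp z * cexp w.
Proof.
  destruct z as [a b], w as [c d]. unfold cexp, Cplus, Cmult, Re, Im; simpl.
  rewrite exp_plus, cos_plus, sin_plus. f_equal; ring.
Qed.

Lemma cexp_0 : cexp 0 = 1.
Proof. unfold cexp, RtoC, Re, Im; simpl. rewrite exp_0, cos_0, sin_0. f_equal; ring. Qed.

Lemma cexp_opp z : cexp z * cexp (- z) = 1.
Proof. rewrite <- cexp_plus. replace (z + - z) with (RtoC 0) by ring. apply cexp_0. Qed.

Lemma cexp_nz z : cexp z <> 0.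
Proof. intros E. assert (H := cexp_opp z). rewrite E, Cmult_0_l in H. apply C1_nz. auto. Qed.

Lemma pderiv_cexp_line w t : pderiv (fun s => cexp (RtoC s * w)) t (w * cexp (RtoC t * w)).
Proof.
  destruct w as [x y].
  assert (E : forall s, cexp (RtoC s * (x, y)) = (exp (s * x) * cos (s * y), exp (s * x) * sin (s * y))%R).
  { intros s. unfold cexp, Re, Im, RtoC, Cmult; simpl. f_equal; f_equal; f_equal; ring. }
  rewrite E. split.
  - eapply is_derive_ext; [intros s; rewrite E; reflexivity|]. unfold Re, Cmult; simpl.
    auto_derive; auto. ring.
  - eapply is_derive_ext; [intros s; rewrite E; reflexivity|]. unfold Im, Cmult; simpl.
    auto_derive; auto. ring.
Qed.

(** For n = 0 these are the coefficients of exp z, for n = 1 those of (exp z - 1) / z. *)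
Definition inv_fact (n k : nat) : C := RtoC (/ INR (fact (k + n))).

Lemma inv_fact_bound n rho : (0 < rho)%R -> exists M, pwr_bound (inv_fact n) M rho.
Proof.
  intros Hr. apply ratio_pwr_bound; [|exact Hr]. intros eta He.
  destruct (archimed_cor1 eta He) as [N [HN HN0]]. exists N. intros k Hk.
  unfold inv_fact. rewrite !Cmod_R.
  assert (F : forall m, (0 < INR (fact m))%R) by (intros m; apply lt_0_INR, lt_O_fact).
  rewrite !Rabs_right by (apply Rle_ge, Rlt_le, Rinv_0_lt_compat, F).
  replace (S k + n)%nat with (S (k + n)) by lia. rewrite fact_simpl, mult_INR.
  assert (P : (0 < INR (S (k + n)))%R) by (apply lt_0_INR; lia).
  rewrite Rinv_mult. apply Rmult_le_compat_r; [apply Rlt_le, Rinv_0_lt_compat, F|].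
  apply Rle_trans with (/ INR N)%R; [|lra]. apply Rinv_le_contravar; [apply lt_0_INR, HN0|].
  apply le_INR. lia.
Qed.

Lemma entire_rho z : exists rho, (0 < rho)%R /\ (rho * Cmod z < 1)%R.
Proof.
  assert (P := Cmod_ge_0 z). exists (/ (Cmod z + 1))%R. split; [apply Rinv_0_lt_compat; lra|].
  apply Rmult_lt_reg_l with (Cmod z + 1)%R; [lra|]. rewrite <- Rmult_assoc, Rinv_r; lra.
Qed.

Lemma inv_fact_psum n z : cseries (fun k => inv_fact n k * z ^ k) (psum (inv_fact n) z).
Proof.
  destruct (entire_rho z) as [rho [Hr Hz]]. destruct (inv_fact_bound n rho Hr) as [M HM].
  apply (psum_spec _ M rho); auto.
Qed.

Lemma hpow_diag k z : hpow (S k) z z = RtoC (INR (S k)) * z ^ k.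
Proof.
  induction k as [|k IH]; [simpl; ring|].
  change (hpow (S (S k)) z z) with (z * hpow (S k) z z + z ^ S k). rewrite IH.
  rewrite (S_INR (S k)), RtoC_plus. simpl. ring.
Qed.

Lemma psum_exp_sderiv z : sderiv (psum (inv_fact 0)) z (psum (inv_fact 0) z).
Proof.
  destruct (entire_rho z) as [rho [Hr Hz]]. destruct (inv_fact_bound 0 rho Hr) as [M HM].
  destruct (psum_sderiv _ M rho z HM Hr Hz) as [l [Hl Hd]].
  replace (psum (inv_fact 0) z) with l; [exact Hd|].
  apply (cseries_unique _ _ _ Hl).
  replace (psum (inv_fact 0) z) with (inv_fact 0 0 * hpow 0 z z + psum (inv_fact 0) z) by (simpl; ring).
  apply (cseries_first (fun k => inv_fact 0 k * hpow k z z)).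
  eapply cseries_ext; [|apply inv_fact_psum]. intros k. cbv beta.
  rewrite hpow_diag, Cmult_assoc. f_equal. unfold inv_fact. rewrite <- RtoC_mult. f_equal.
  rewrite !Nat.add_0_r, fact_simpl, mult_INR. field.
  split; [apply not_0_INR, fact_neq_0|apply not_0_INR; lia].
Qed.

(** Along the segment from 0 to [z] the product of the series at t z and [cexp] at - t z has
    derivative 0, hence equals 1 throughout. This transfers complex differentiability from the
    series to the definition by real functions. *)
Lemma cexp_psum z : cexp z = psum (inv_fact 0) z.
Proof.
  set (X := psum (inv_fact 0)).
  set (G := fun t : R => X (0 + RtoC t * z) * cexp (RtoC t * (- z))).
  assert (HG : forall t, pderiv G t 0).
  { intros t.
    replace (RtoC 0) with ((X (0 + RtoC t * z) * z) * cexp (RtoC t * (- z)) +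
       X (0 + RtoC t * z) * (- z * cexp (RtoC t * (- z)))) by ring.
    apply (pderiv_mult (fun s => X (0 + RtoC s * z)) (fun s => cexp (RtoC s * - z))).
    - apply (pderiv_comp X (fun s => 0 + RtoC s * z)); [apply pderiv_linear|apply psum_exp_sderiv].
    - apply pderiv_cexp_line. }
  assert (E := pderiv_0_const G 0 1 Rlt_0_1 HG). unfold G in E.
  replace (RtoC 0 * - z) with (RtoC 0) in E by ring. replace (0 + RtoC 0 * z) with (RtoC 0) in E by ring.
  replace (RtoC 1 * - z) with (- z) in E by ring. replace (0 + RtoC 1 * z) with z in E by ring.
  rewrite cexp_0 in E.
  assert (E0 : X 0 = 1).
  { destruct (inv_fact_bound 0 1 Rlt_0_1) as [M HM]. unfold X. rewrite (psum_0 _ M 1 HM Rlt_0_1).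
    unfold inv_fact. simpl. f_equal. apply Rinv_1. }
  rewrite E0 in E.
  replace (cexp z) with (1 * 1 * cexp z) by ring. rewrite E.
  replace (X z * cexp (- z) * cexp z) with (X z * (cexp z * cexp (- z))) by ring.
  rewrite cexp_opp. ring.
Qed.

Lemma cexp_sderiv z : sderiv cexp z (cexp z).
Proof.
  rewrite cexp_psum. apply (sderiv_ext (psum (inv_fact 0))); [|apply psum_exp_sderiv].
  intros w. symmetry. apply cexp_psum.
Qed.

Definition cexp1 (z : C) : C := psum (inv_fact 1) z.

Lemma cexp1_spec z : cexp z - 1 = z * cexp1 z.
Proof.
  assert (H : cseries (fun k => inv_fact 0 k * z ^ k) (1 + z * cexp1 z)).
  { replace (1 + z * cexp1 z) with (inv_fact 0 0 * z ^ 0 + z * cexp1 z).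
    - apply (cseries_first (fun k => inv_fact 0 k * z ^ k)).
      eapply cseries_ext; [|apply (cseries_scal z), inv_fact_psum]. intros k. cbv beta.
      unfold inv_fact. replace (S k + 0)%nat with (k + 1)%nat by lia. simpl. ring.
    - unfold inv_fact. simpl. rewrite Rinv_1. ring. }
  rewrite cexp_psum. rewrite (cseries_unique _ _ _ (inv_fact_psum 0 z) H). ring.
Qed.

Lemma cexp1_0 : cexp1 0 = 1.
Proof.
  destruct (inv_fact_bound 1 1 Rlt_0_1) as [M HM]. unfold cexp1. rewrite (psum_0 _ M 1 HM Rlt_0_1).
  unfold inv_fact. simpl. f_equal. apply Rinv_1.
Qed.

Lemma cexp1_sderiv z : exists l, sderiv cexp1 z l.
Proof.
  destruct (entire_rho z) as [rho [Hr Hz]]. destruct (inv_fact_bound 1 rho Hr) as [M HM].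
  destruct (psum_sderiv _ M rho z HM Hr Hz) as [l [_ Hd]]. exists l. exact Hd.
Qed.

(** * The normalised exponential e(z) = exp(2 pi i z) *)

Definition ee (z : C) : C := cexp (RtoC (2 * PI) * Ci * z).

Lemma ee_plus z w : ee (z + w) = ee z * ee w.
Proof. unfold ee. rewrite <- cexp_plus. f_equal. ring. Qed.

Lemma ee_0 : ee 0 = 1.
Proof. unfold ee. rewrite Cmult_0_r. apply cexp_0. Qed.

Lemma ee_nz z : ee z <> 0.
Proof. apply cexp_nz. Qed.

Lemma ee_opp z : ee (- z) = / ee z.
Proof.
  assert (H : ee z * ee (- z) = 1) by (rewrite <- ee_plus, Cplus_opp_r; apply ee_0).
  replace (ee (- z)) with (/ ee z * (ee z * ee (- z))) by (field; apply ee_nz). rewrite H. ring.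
Qed.

Lemma ee_minus z w : ee (z - w) = ee z / ee w.
Proof. unfold Cminus. rewrite ee_plus, ee_opp. reflexivity. Qed.

Lemma ee_pow z n : ee z ^ n = ee (RtoC (INR n) * z).
Proof.
  induction n as [|n IH].
  - simpl. rewrite Cmult_0_l. symmetry. apply ee_0.
  - rewrite S_INR, RtoC_plus. simpl. rewrite IH, <- ee_plus. f_equal. ring.
Qed.

Lemma ee_parts z :
  ee z = (exp (- (2 * PI * Im z)) * cos (2 * PI * Re z), exp (- (2 * PI * Im z)) * sin (2 * PI * Re z))%R.
Proof.
  destruct z as [x y]. unfold ee, cexp, RtoC, Ci, Cmult, Re, Im. simpl.
  f_equal; f_equal; f_equal; ring.
Qed.

Lemma Cmod_ee z : Cmod (ee z) = exp (- (2 * PI * Im z)).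
Proof.
  rewrite ee_parts. set (a := exp _). assert (P : (0 < a)%R) by apply exp_pos.
  unfold Cmod. simpl fst. simpl snd.
  set (x := (2 * PI * Re z)%R).
  replace ((a * cos x) ^ 2 + (a * sin x) ^ 2)%R with (a * a)%R.
  - apply sqrt_square. lra.
  - assert (H := sin2_cos2 x). unfold Rsqr in H. nra.
Qed.

Lemma Cmod_ee_lt z : upper z -> (Cmod (ee z) < 1)%R.
Proof.
  intros H. unfold upper in H. rewrite Cmod_ee, <- exp_0. apply exp_increasing.
  assert (0 < PI * Im z)%R by (apply Rmult_lt_0_compat; [apply PI_RGT_0|exact H]). lra.
Qed.

Lemma ee_half : ee (RtoC (1 / 2)) = - (1).
Proof.
  rewrite ee_parts. simpl.
  replace (2 * PI * 0)%R with 0%R by ring. replace (2 * PI * (1 / 2))%R with PI by field.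
  rewrite Ropp_0, exp_0, cos_PI, sin_PI. unfold Copp, RtoC. simpl. f_equal; ring.
Qed.

Lemma ee_1 : ee 1 = 1.
Proof.
  replace (RtoC 1) with (RtoC (1 / 2) + RtoC (1 / 2)) at 1 by (rewrite <- RtoC_plus; f_equal; field).
  rewrite ee_plus, ee_half. ring.
Qed.

Lemma ee_Z (n : Z) : ee (RtoC (IZR n)) = 1.
Proof.
  induction n as [|n IH|n IH] using Z.peano_ind.
  - apply ee_0.
  - rewrite succ_IZR, RtoC_plus, ee_plus, IH, ee_1. ring.
  - unfold Z.pred. rewrite plus_IZR, RtoC_plus, ee_plus, IH.
    replace (IZR (-1)) with (- (1))%R by reflexivity. rewrite RtoC_opp, ee_opp, ee_1. field.
Qed.

(** The modulus forces Im z = 0, and cos(2 pi x) = 1 - 2 sin^2(pi x) reduces the rest to the zeros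
    of the sine. *)
Lemma ee_eq_1 z : ee z = 1 -> exists n : Z, z = RtoC (IZR n).
Proof.
  intros H.
  assert (Hi : Im z = 0%R).
  { assert (K := Cmod_ee z). rewrite H, Cmod_1, <- exp_0 in K. apply exp_inv in K.
    assert (P := PI_RGT_0). nra. }
  rewrite ee_parts, Hi in H. replace (2 * PI * 0)%R with 0%R in H by ring.
  rewrite Ropp_0, exp_0, !Rmult_1_l in H. injection H as Hc Hs.
  replace (2 * PI * Re z)%R with (2 * (PI * Re z))%R in Hc by ring. rewrite cos_2a_sin in Hc.
  assert (S : sin (PI * Re z) = 0%R) by nra.
  destruct (sin_eq_0_0 _ S) as [n Hn]. exists n.
  assert (E : Re z = IZR n). { assert (P := PI_RGT_0). apply Rmult_eq_reg_l with PI; lra. }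
  apply injective_projections; [exact E|exact Hi].
Qed.

Lemma ee_sderiv z : sderiv ee z (ee z * (RtoC (2 * PI) * Ci)).
Proof.
  apply (sderiv_comp cexp (fun w => RtoC (2 * PI) * Ci * w)); [|apply cexp_sderiv].
  apply (sderiv_ext (fun w => RtoC (2 * PI) * Ci * w + 0)); [intros w; ring|apply sderiv_affine].
Qed.

Lemma qpow_ee r tau : qpow r tau = ee (RtoC r * tau).
Proof. unfold qpow, ee. f_equal. rewrite !RtoC_mult. ring. Qed.

(** * q-Pochhammer symbols and the theta function *)

Lemma climit_comp f u l : climit u l -> ccont f l -> climit (fun n => f (u n)) (f l).
Proof.
  intros H Hf eps He. destruct (Hf eps He) as [d [Hd K]]. destruct (H d Hd) as [N HN].
  exists N. intros n Hn. apply K, HN, Hn.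
Qed.

Lemma climit_pow q : (Cmod q < 1)%R -> climit (fun n => q ^ n) 0.
Proof.
  intros H. apply (climit_geom _ _ 1 (Cmod q)); [split; [apply Cmod_ge_0|exact H]|].
  intros n. replace (q ^ n - 0) with (q ^ n) by ring. rewrite Cmod_pow. lra.
Qed.

Lemma qpoch_inf_unique a q l : climit (qpoch_part a q) l -> qpoch_inf a q = l.
Proof.
  intros H. apply (climit_unique (qpoch_part a q)); [|exact H].
  apply climit_filterlim. unfold qpoch_inf. apply epsilon_spec. exists l.
  apply climit_filterlim, H.
Qed.

(** Euler's expansion of (x; q)_oo in powers of x: the k-th coefficient is (-1)^k q^(k (k - 1) / 2)
    / ((1 - q) ... (1 - q^k)). *)
Fixpoint euler_coef (q : C) (k : nat) : C :=
  match k with O => 1 | S j => - (q ^ j / (1 - q ^ S j)) * euler_coef q j end.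

Lemma Cmod_lt_1_neq q : (Cmod q < 1)%R -> 1 - q <> 0.
Proof.
  intros H E. assert (q = 1) by (symmetry; apply Ceq_minus, E). subst q. rewrite Cmod_1 in H. lra.
Qed.

Lemma Cmod_pow_S_lt_1 q k : (Cmod q < 1)%R -> (Cmod (q ^ S k) <= Cmod q)%R.
Proof.
  intros H. rewrite Cmod_pow. simpl. assert (P := Cmod_ge_0 q).
  assert (Cmod q ^ k <= 1)%R by (rewrite <- (pow1 k); apply pow_incr; lra).
  assert (Cmod q * Cmod q ^ k <= Cmod q * 1)%R by (apply Rmult_le_compat_l; lra). lra.
Qed.

Lemma euler_coef_bound q rho : (Cmod q < 1)%R -> (0 < rho)%R -> exists M, pwr_bound (euler_coef q) M rho.
Proof.
  intros Hq Hr. apply ratio_pwr_bound; [|exact Hr]. intros eta He.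
  assert (P := Cmod_ge_0 q).
  destruct (pow_lt_1_zero (Cmod q) ltac:(rewrite Rabs_right; lra) (eta * (1 - Cmod q))) as [N HN].
  { apply Rmult_lt_0_compat; lra. }
  exists N. intros k Hk. specialize (HN k Hk). rewrite Rabs_right in HN by (apply Rle_ge, pow_le, P).
  assert (L := Cmod_pow_S_lt_1 q k Hq).
  cbn [euler_coef]. rewrite Cmod_mult. apply Rmult_le_compat_r; [apply Cmod_ge_0|].
  rewrite Cmod_opp, Cmod_div by (apply Cmod_lt_1_neq; lra). rewrite Cmod_pow.
  assert (T := Cmod_rev_tri 1 (q ^ S k)). rewrite Cmod_1 in T.
  apply Rmult_le_reg_r with (Cmod (1 - q ^ S k)); [lra|].
  unfold Rdiv. rewrite Rmult_assoc, Rinv_l by lra.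
  assert (eta * (1 - Cmod q) <= eta * Cmod (1 - q ^ S k))%R by (apply Rmult_le_compat_l; lra). lra.
Qed.

Lemma euler_psum q z : (Cmod q < 1)%R ->
  cseries (fun k => euler_coef q k * z ^ k) (psum (euler_coef q) z).
Proof.
  intros Hq. destruct (entire_rho z) as [rho [Hr Hz]]. destruct (euler_coef_bound q rho Hq Hr) as [M HM].
  apply (psum_spec _ M rho); auto.
Qed.

Lemma euler_sderiv q z : (Cmod q < 1)%R -> exists l, sderiv (psum (euler_coef q)) z l.
Proof.
  intros Hq. destruct (entire_rho z) as [rho [Hr Hz]]. destruct (euler_coef_bound q rho Hq Hr) as [M HM].
  destruct (psum_sderiv _ M rho z HM Hr Hz) as [l [_ Hd]]. exists l. exact Hd.
Qed.

Lemma euler_0 q : (Cmod q < 1)%R -> psum (euler_coef q) 0 = 1.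
Proof.
  intros Hq. destruct (euler_coef_bound q 1 Hq Rlt_0_1) as [M HM].
  rewrite (psum_0 _ M 1 HM Rlt_0_1). reflexivity.
Qed.

(** In the coefficient of x^(k+1) the equation reads c_(k+1) (1 - q^(k+1)) = - q^k c_k, which is the
    recursion of [euler_coef]. *)
Lemma euler_step q x : (Cmod q < 1)%R ->
  psum (euler_coef q) x = (1 - x) * psum (euler_coef q) (q * x).
Proof.
  intros Hq. set (E := psum (euler_coef q)).
  assert (H1 := euler_psum q (q * x) Hq). fold E in H1.
  apply (cseries_unique _ _ _ (euler_psum q x Hq)).
  replace ((1 - x) * E (q * x)) with (E (q * x) + (0 + (- x) * E (q * x))) by ring.
  set (b := fun k => match k return C with O => 0 | S j => - x * (euler_coef q j * (q * x) ^ j) end).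
  eapply cseries_ext; [|apply cseries_plus; [exact H1|]].
  2:{ apply (cseries_first b). unfold b. apply cseries_scal, H1. }
  intros [|k].
  - unfold b. simpl. ring.
  - unfold b. cbn [euler_coef]. rewrite !Cpow_mult_l.
    replace (x ^ S k) with (x * x ^ k) by reflexivity.
    assert (N : 1 - q ^ S k <> 0).
    { apply Cmod_lt_1_neq. eapply Rle_lt_trans; [apply Cmod_pow_S_lt_1|]; auto. }
    field. exact N.
Qed.

Lemma euler_iter q x n : (Cmod q < 1)%R ->
  psum (euler_coef q) x = qpoch_part x q n * psum (euler_coef q) (x * q ^ n).
Proof.
  intros Hq. induction n as [|n IH]; [simpl; rewrite Cmult_1_r; ring|].
  rewrite IH, (euler_step q (x * q ^ n) Hq). cbn [qpoch_part]. rewrite cpow_Cpow.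
  replace (x * q ^ S n) with (q * (x * q ^ n)) by (simpl; ring). ring.
Qed.

Lemma euler_tail q x : (Cmod q < 1)%R -> climit (fun n => psum (euler_coef q) (x * q ^ n)) 1.
Proof.
  intros Hq. rewrite <- (euler_0 q Hq). apply climit_comp.
  - replace (RtoC 0) with (x * 0) by ring. apply climit_scal, climit_pow, Hq.
  - destruct (euler_sderiv q 0 Hq) as [l Hl]. eapply sderiv_ccont, Hl.
Qed.

Lemma climit_1_nz u : climit u 1 -> exists N, forall n, (N <= n)%nat -> u n <> 0.
Proof.
  intros H. destruct (H 1%R Rlt_0_1) as [N HN]. exists N. intros n Hn E. specialize (HN n Hn).
  rewrite E in HN. replace (0 - 1) with (- (1)) in HN by ring. rewrite Cmod_m1 in HN. lra.
Qed.

(** With E the Euler series, the n-th partial product is E(x) / E(x q^n) for large n, and E(x q^n)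
    tends to E(0) = 1. *)
Lemma qpoch_part_limit q x : (Cmod q < 1)%R -> climit (qpoch_part x q) (psum (euler_coef q) x).
Proof.
  intros Hq. assert (T := euler_tail q x Hq).
  destruct (climit_1_nz _ T) as [N HN].
  assert (I := climit_scal _ _ (psum (euler_coef q) x)
    (climit_comp Cinv _ _ T (sderiv_ccont _ _ _ (sderiv_inv 1 C1_nz)))).
  replace (psum (euler_coef q) x * / 1) with (psum (euler_coef q) x) in I by field.
  intros eps He. destruct (I eps He) as [N' HN']. exists (N + N')%nat. intros n Hn.
  specialize (HN n ltac:(lia)). specialize (HN' n ltac:(lia)).
  replace (qpoch_part x q n) with (psum (euler_coef q) x * / psum (euler_coef q) (x * q ^ n)); [exact HN'|].
  rewrite (euler_iter q x n Hq). field. exact HN.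
Qed.

Lemma qpoch_inf_euler q x : (Cmod q < 1)%R -> qpoch_inf x q = psum (euler_coef q) x.
Proof. intros Hq. apply qpoch_inf_unique, qpoch_part_limit, Hq. Qed.

Lemma qpoch_inf_step q x : (Cmod q < 1)%R -> qpoch_inf x q = (1 - x) * qpoch_inf (q * x) q.
Proof. intros Hq. rewrite !qpoch_inf_euler by exact Hq. apply euler_step, Hq. Qed.

Lemma qpoch_inf_sderiv q x : (Cmod q < 1)%R -> exists l, sderiv (fun y => qpoch_inf y q) x l.
Proof.
  intros Hq. destruct (euler_sderiv q x Hq) as [l Hl]. exists l.
  apply (sderiv_ext (psum (euler_coef q))); [|exact Hl]. intros w. symmetry. apply qpoch_inf_euler, Hq.
Qed.

Lemma qpoch_part_0 q x n : qpoch_part x q n = 0 -> exists k, x * q ^ k = 1.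
Proof.
  induction n as [|n IH]; cbn [qpoch_part]; intros H; [destruct (C1_nz H)|].
  destruct (classic (qpoch_part x q n = 0)) as [E|E]; [exact (IH E)|].
  exists n. rewrite cpow_Cpow in H.
  destruct (classic (1 - x * q ^ n = 0)) as [K|K].
  - symmetry. apply Ceq_minus, K.
  - destruct (Cmult_neq_0 _ _ E K H).
Qed.

(** The tail E(x q^n) is close to 1 for large n, so a zero of the infinite product is a zero of one
    of its factors. *)
Lemma qpoch_inf_0 q x : (Cmod q < 1)%R -> qpoch_inf x q = 0 -> exists k, x * q ^ k = 1.
Proof.
  intros Hq H. rewrite qpoch_inf_euler in H by exact Hq.
  destruct (climit_1_nz _ (euler_tail q x Hq)) as [N HN]. specialize (HN N (le_n N)).
  apply (qpoch_part_0 q x N).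
  destruct (classic (qpoch_part x q N = 0)) as [K|K]; [exact K|].
  rewrite (euler_iter q x N Hq) in H. destruct (Cmult_neq_0 _ _ K HN H).
Qed.

(* Up to a factor depending on [T] only, the Jacobi theta function vanishing on [Z + Z T]. *)
Definition theta (z T : C) : C :=
  ee (- z / 2) * qpoch_inf (ee z) (ee T) * qpoch_inf (ee (T - z)) (ee T).

(* [theta z T / z], extended to [z = 0]. *)
Definition theta_red (z T : C) : C :=
  - (RtoC (2 * PI) * Ci) * cexp1 (RtoC (2 * PI) * Ci * z) *
  (ee (- z / 2) * qpoch_inf (ee (z + T)) (ee T) * qpoch_inf (ee (T - z)) (ee T)).

(** The zero at the origin sits in the factor 1 - e(z) of the first product, which is z times a
    multiple of [cexp1]. *)
Lemma theta_red_spec z T : upper T -> theta z T = z * theta_red z T.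
Proof.
  intros HT. unfold theta, theta_red. rewrite (qpoch_inf_step _ (ee z)) by (apply Cmod_ee_lt, HT).
  assert (H := cexp1_spec (RtoC (2 * PI) * Ci * z)). fold (ee z) in H.
  replace (1 - ee z) with (- (RtoC (2 * PI) * Ci * z * cexp1 (RtoC (2 * PI) * Ci * z))) by (rewrite <- H; ring).
  rewrite <- ee_plus. replace (T + z) with (z + T) by ring. ring.
Qed.

Lemma theta_shift_1 z T : theta (z + 1) T = - theta z T.
Proof.
  unfold theta.
  replace (- (z + 1) / 2) with (- z / 2 - RtoC (1 / 2)) by (rewrite RtoC_div by lra; field).
  replace (T - (z + 1)) with ((T - z) - 1) by ring.
  replace (ee (z + 1)) with (ee z) by (rewrite ee_plus, ee_1; ring).
  replace (ee (T - z - 1)) with (ee (T - z)) by (rewrite (ee_minus (T - z)), ee_1; field).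
  rewrite ee_minus, ee_half. field.
Qed.

(** The shift trades the factor 1 - e(z) of the first product for a factor 1 - e(-z) in the second,
    and (1 - e(-z)) / (1 - e(z)) = - e(-z). *)
Lemma theta_shift_T z T : upper T -> theta (z + T) T = ee (RtoC (1 / 2) - T / 2 - z) * theta z T.
Proof.
  intros HT. assert (Hq := Cmod_ee_lt T HT). unfold theta.
  rewrite (qpoch_inf_step _ (ee z) Hq).
  replace (T - (z + T)) with (- z) by ring. rewrite (qpoch_inf_step _ (ee (- z)) Hq).
  rewrite <- !ee_plus. replace (T + - z) with (T - z) by ring. replace (T + z) with (z + T) by ring.
  replace (- (z + T) / 2) with (- z / 2 - T / 2) by (field).
  rewrite !ee_minus, ee_half, ee_opp. field. repeat split; apply ee_nz.
Qed.

Lemma theta_shift_Z z T (m : Z) : theta (z + RtoC (IZR m)) T = ee (RtoC (IZR m) / 2) * theta z T.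
Proof.
  induction m as [|m IH|m IH] using Z.peano_ind.
  - replace (RtoC 0 / 2) with (RtoC 0) by field. rewrite ee_0, Cplus_0_r. ring.
  - rewrite succ_IZR, RtoC_plus, Cplus_assoc, theta_shift_1, IH.
    replace ((RtoC (IZR m) + 1) / 2) with (RtoC (IZR m) / 2 + RtoC (1 / 2)) by (rewrite RtoC_div by lra; field).
    rewrite ee_plus, ee_half. ring.
  - unfold Z.pred. rewrite plus_IZR, RtoC_plus. change (IZR (-1)) with (- (1))%R. rewrite RtoC_opp.
    assert (H := theta_shift_1 (z + (RtoC (IZR m) + - (1))) T).
    replace (z + (RtoC (IZR m) + - (1)) + 1) with (z + RtoC (IZR m)) in H by ring. rewrite IH in H.
    replace ((RtoC (IZR m) + - (1)) / 2) with (RtoC (IZR m) / 2 - RtoC (1 / 2)) by (rewrite RtoC_div by lra; field).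
    rewrite ee_minus, ee_half.
    replace (theta (z + (RtoC (IZR m) + - (1))) T) with (- - theta (z + (RtoC (IZR m) + - (1))) T) by ring.
    rewrite <- H. field.
Qed.

Lemma theta_shift_ZT z T (n : Z) : upper T ->
  theta (z + RtoC (IZR n) * T) T =
  ee (RtoC (IZR n) / 2 - RtoC (IZR n) * RtoC (IZR n) * T / 2 - RtoC (IZR n) * z) * theta z T.
Proof.
  intros HT. induction n as [|n IH|n IH] using Z.peano_ind.
  - replace (RtoC 0 / 2 - 0 * 0 * T / 2 - 0 * z) with (RtoC 0) by field.
    rewrite ee_0. replace (z + 0 * T) with z by ring. ring.
  - rewrite succ_IZR, RtoC_plus. set (N := RtoC (IZR n)) in *.
    replace (z + (N + 1) * T) with ((z + N * T) + T) by ring.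
    rewrite theta_shift_T, IH, Cmult_assoc, <- ee_plus by exact HT. f_equal. f_equal.
    rewrite RtoC_div by lra. field.
  - unfold Z.pred. rewrite plus_IZR, RtoC_plus. change (IZR (-1)) with (- (1))%R. rewrite RtoC_opp.
    set (N := RtoC (IZR n)) in *.
    assert (H := theta_shift_T (z + (N + - (1)) * T) T HT).
    replace (z + (N + - (1)) * T + T) with (z + N * T) in H by ring. rewrite IH in H.
    set (X := theta (z + (N + - (1)) * T) T) in *.
    set (u := RtoC (1 / 2) - T / 2 - (z + (N + - (1)) * T)) in *.
    replace X with (ee (- u) * (ee u * X)) by (rewrite ee_opp; field; apply ee_nz).
    rewrite <- H, Cmult_assoc, <- ee_plus. f_equal. f_equal. unfold u.
    rewrite RtoC_div by lra. field.
Qed.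

Lemma theta_lattice z T (m n : Z) : upper T ->
  theta (z + RtoC (IZR m) + RtoC (IZR n) * T) T =
  ee ((RtoC (IZR m) + RtoC (IZR n)) / 2 - RtoC (IZR n) * RtoC (IZR n) * T / 2 - RtoC (IZR n) * z) * theta z T.
Proof.
  intros HT. rewrite theta_shift_ZT, theta_shift_Z, Cmult_assoc, <- ee_plus by exact HT. f_equal.
  set (N := RtoC (IZR n)). set (M := RtoC (IZR m)).
  replace (N / 2 - N * N * T / 2 - N * (z + M) + M / 2) with
    ((M + N) / 2 - N * N * T / 2 - N * z - N * M) by field.
  rewrite (ee_minus _ (N * M)).
  replace (ee (N * M)) with (RtoC 1) by (unfold N, M; rewrite <- RtoC_mult, <- mult_IZR, ee_Z; reflexivity).
  field.
Qed.

Definition lattice (T z : C) : Prop := exists m n : Z, z = RtoC (IZR m) + RtoC (IZR n) * T.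

Lemma theta_eq_0 z T : upper T -> (theta z T = 0 <-> lattice T z).
Proof.
  intros HT. assert (Hq := Cmod_ee_lt T HT). split.
  - intros H. unfold theta in H.
    destruct (classic (qpoch_inf (ee z) (ee T) = 0)) as [E|E].
    + destruct (qpoch_inf_0 _ _ Hq E) as [k Hk]. rewrite ee_pow, <- ee_plus in Hk.
      destruct (ee_eq_1 _ Hk) as [m Hm]. exists m, (- Z.of_nat k)%Z.
      rewrite <- Hm, opp_IZR, <- INR_IZR_INZ, RtoC_opp. ring.
    + destruct (classic (qpoch_inf (ee (T - z)) (ee T) = 0)) as [E'|E'].
      * destruct (qpoch_inf_0 _ _ Hq E') as [k Hk]. rewrite ee_pow, <- ee_plus in Hk.
        destruct (ee_eq_1 _ Hk) as [m Hm]. exists (- m)%Z, (1 + Z.of_nat k)%Z.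
        rewrite opp_IZR, RtoC_opp, <- Hm, plus_IZR, <- INR_IZR_INZ, RtoC_plus. ring.
      * destruct (Cmult_neq_0 _ _ (Cmult_neq_0 _ _ (ee_nz (- z / 2)) E) E' H).
  - intros [m [n ->]].
    replace (RtoC (IZR m) + RtoC (IZR n) * T) with (0 + RtoC (IZR m) + RtoC (IZR n) * T) by ring.
    rewrite theta_lattice by exact HT.
    replace (theta 0 T) with (RtoC 0); [ring|].
    rewrite theta_red_spec by exact HT. ring.
Qed.

(** At the origin the value is a nonzero multiple of (q; q)_oo^2; this is the simplicity of the zero
    of theta there. *)
Lemma theta_red_eq_0 z T : upper T -> (theta_red z T = 0 <-> lattice T z /\ z <> 0).
Proof.
  intros HT. assert (Hq := Cmod_ee_lt T HT). split.
  - intros H. split.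
    + apply theta_eq_0; [exact HT|]. rewrite theta_red_spec, H by exact HT. ring.
    + intros ->. unfold theta_red in H. rewrite Cmult_0_r, cexp1_0 in H.
      replace (0 + T) with T in H by ring. replace (T - 0) with T in H by ring.
      assert (E : qpoch_inf (ee T) (ee T) <> 0).
      { intros E. destruct (qpoch_inf_0 _ _ Hq E) as [k Hk].
        assert (L := Cmod_pow_S_lt_1 (ee T) k Hq). simpl in L. rewrite Hk, Cmod_1 in L. lra. }
      revert H. repeat apply Cmult_neq_0; auto using ee_nz, C1_nz.
      intros K. assert (P := PI_RGT_0). injection K. lra.
  - intros [H Hz]. apply theta_eq_0 in H; [|exact HT]. rewrite theta_red_spec in H by exact HT.
    destruct (classic (theta_red z T = 0)) as [K|K]; [exact K|]. destruct (Cmult_neq_0 _ _ Hz K H).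
Qed.

Lemma theta_red_sderiv z T : upper T -> exists l, sderiv (fun w => theta_red w T) z l.
Proof.
  intros HT. assert (Hq := Cmod_ee_lt T HT). unfold theta_red.
  destruct (cexp1_sderiv (RtoC (2 * PI) * Ci * z)) as [l1 H1].
  destruct (qpoch_inf_sderiv (ee T) (ee (z + T)) Hq) as [l2 H2].
  destruct (qpoch_inf_sderiv (ee T) (ee (T - z)) Hq) as [l3 H3].
  eexists. apply (sderiv_mult (fun w => - (RtoC (2 * PI) * Ci) * cexp1 (RtoC (2 * PI) * Ci * w))
    (fun w => ee (- w / 2) * qpoch_inf (ee (w + T)) (ee T) * qpoch_inf (ee (T - w)) (ee T))).
  - apply (sderiv_mult (fun _ => - (RtoC (2 * PI) * Ci)) (fun w => cexp1 (RtoC (2 * PI) * Ci * w))).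
    + apply sderiv_const.
    + apply (sderiv_comp cexp1 (fun w => RtoC (2 * PI) * Ci * w)); [|exact H1].
      apply (sderiv_ext (fun w => RtoC (2 * PI) * Ci * w + 0)); [intros w; ring|apply sderiv_affine].
  - apply (sderiv_mult (fun w => ee (- w / 2) * qpoch_inf (ee (w + T)) (ee T))
      (fun w => qpoch_inf (ee (T - w)) (ee T))).
    + apply (sderiv_mult (fun w => ee (- w / 2)) (fun w => qpoch_inf (ee (w + T)) (ee T))).
      * apply (sderiv_comp ee (fun w => - w / 2)); [|apply ee_sderiv].
        apply (sderiv_ext (fun w => (- / 2) * w + 0)); [intros w; field|apply sderiv_affine].
      * apply (sderiv_comp (fun y => qpoch_inf y (ee T)) (fun w => ee (w + T))); [|exact H2].
        apply (sderiv_comp ee (fun w => w + T)); [|apply ee_sderiv].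
        apply (sderiv_ext (fun w => 1 * w + T)); [intros w; ring|apply sderiv_affine].
    + apply (sderiv_comp (fun y => qpoch_inf y (ee T)) (fun w => ee (T - w))); [|exact H3].
      apply (sderiv_comp ee (fun w => T - w)); [|apply ee_sderiv].
      apply (sderiv_ext (fun w => (- (1)) * w + T)); [intros w; ring|apply sderiv_affine].
Qed.

(** * Doubly periodic functions *)

Lemma box_max (G : R -> R -> R) :
  (forall s t, continuity_2d_pt G s t) ->
  exists s0 t0, forall s t, (0 <= s <= 1)%R -> (0 <= t <= 1)%R -> (G s t <= G s0 t0)%R.
Proof.
  intros HG.
  (* composing with [atan] makes the supremum finite without a separate boundedness argument *)
  set (E := fun x => exists s t, (0 <= s <= 1)%R /\ (0 <= t <= 1)%R /\ x = atan (G s t)).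
  assert (Eb : bound E).
  { exists (PI / 2)%R. intros x [s [t [_ [_ ->]]]]. apply Rlt_le, atan_bound. }
  assert (En : exists x, E x).
  { exists (atan (G 0%R 0%R)). exists 0%R, 0%R. repeat split; lra. }
  destruct (completeness E Eb En) as [S [Sub Slub]].
  destruct (classic (exists s t, (0 <= s <= 1)%R /\ (0 <= t <= 1)%R /\ atan (G s t) = S)) as [[s0 [t0 [_ [_ H]]]]|H].
  - exists s0, t0. intros s t Hs Ht. apply Rnot_lt_le. intros L.
    assert (K := Sub (atan (G s t)) ltac:(exists s, t; auto)).
    apply atan_increasing in L. lra.
  - exfalso.
    (* If the supremum [S] is not attained, each point of the square has a [d] such that the
       function is at most S - d within distance [d]. A positive lower bound on the [d] needed to
       cover the square then contradicts the choice of [S]. *)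
    assert (D : forall s t, exists d : posreal, (0 <= s <= 1)%R -> (0 <= t <= 1)%R -> forall x y,
        (Rabs (x - s) < d)%R -> (Rabs (y - t) < d)%R -> (atan (G x y) <= S - d)%R).
    { intros s t. destruct (classic ((0 <= s <= 1)%R /\ (0 <= t <= 1)%R)) as [[Hs Ht]|N].
      2:{ exists (mkposreal 1 Rlt_0_1). intros. tauto. }
      assert (L : (atan (G s t) < S)%R).
      { destruct (Sub (atan (G s t)) ltac:(exists s, t; auto)) as [L|L]; [exact L|].
        destruct H. exists s, t. auto. }
      assert (e0 : (0 < (S - atan (G s t)) / 2)%R) by lra.
      assert (Cn : continuity_2d_pt (fun x y => atan (G x y)) s t).
      { apply continuity_1d_2d_pt_comp; [|apply HG]. apply derivable_continuous_pt, derivable_pt_atan. }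
      destruct (Cn (mkposreal _ e0)) as [d Hd]. simpl in Hd.
      exists (mkposreal (Rmin d ((S - atan (G s t)) / 2)) (Rmin_glb_lt _ _ _ (cond_pos d) e0)).
      simpl. intros _ _ x y Hx Hy.
      assert (A := Rmin_l d ((S - atan (G s t)) / 2)). assert (B := Rmin_r d ((S - atan (G s t)) / 2)).
      specialize (Hd x y ltac:(lra) ltac:(lra)). apply Rabs_def2 in Hd. lra. }
    set (delta := fun s t => proj1_sig (constructive_indefinite_description _ (D s t))).
    destruct (compactness_value_2d 0 1 0 1 delta) as [d Hd].
    assert (U : is_upper_bound E (S - d)).
    { intros x [s [t [Hs [Ht ->]]]]. specialize (Hd s t Hs Ht). apply NNPP in Hd.
      destruct Hd as [u [v [Hu [Hv [H1 [H2 H3]]]]]].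
      assert (K := proj2_sig (constructive_indefinite_description _ (D u v)) Hu Hv s t H1 H2).
      change (atan (G s t) <= S - delta u v)%R in K. lra. }
    apply Slub in U. assert (P := cond_pos d). lra.
Qed.

(** The integrals over [a, y] and [y, b] are nonnegative with sum 0, so the integral up to [y]
    vanishes identically, and its derivative at [x] is h(x). *)
Lemma RInt_0_nonneg_eq_0 h a b x :
  (forall t, continuous h t) -> (forall t, (0 <= h t)%R) -> is_RInt h a b 0 -> (a < x < b)%R -> h x = 0%R.
Proof.
  intros Hc Hp HI Hx.
  assert (Ex : forall u v, ex_RInt h u v).
  { intros u v. apply (@ex_RInt_continuous R_CompleteNormedModule). intros; apply Hc. }
  assert (Z : forall y, (a < y < b)%R -> RInt h a y = 0%R).
  { intros y Hy.
    assert (C := RInt_Chasles h a y b (Ex a y) (Ex y b)). change plus with Rplus in C.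
    rewrite (is_RInt_unique _ _ _ _ HI) in C.
    assert (A := RInt_ge_0 h a y ltac:(lra) (Ex a y) (fun t _ => Hp t)).
    assert (B := RInt_ge_0 h y b ltac:(lra) (Ex y b) (fun t _ => Hp t)). lra. }
  assert (D1 : is_derive (fun y => RInt h a y) x (h x)).
  { apply (is_derive_RInt h _ a); [|apply Hc]. exists (mkposreal 1 Rlt_0_1). intros y _.
    apply (@RInt_correct R_CompleteNormedModule), Ex. }
  assert (D2 : is_derive (fun y => RInt h a y) x 0%R).
  { apply (is_derive_ext_loc (fun _ => 0%R)); [|apply (@is_derive_const R_AbsRing R_NormedModule)].
    assert (P : (0 < Rmin (x - a) (b - x))%R) by (apply Rmin_glb_lt; lra).
    exists (mkposreal _ P). intros y Hy. symmetry. apply Z.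
    change (Rabs (y - x) < Rmin (x - a) (b - x))%R in Hy.
    assert (A := Rmin_l (x - a) (b - x)). assert (B := Rmin_r (x - a) (b - x)).
    apply Rabs_def2 in Hy. lra. }
  rewrite <- (is_derive_unique _ _ _ D1). apply is_derive_unique, D2.
Qed.

Lemma is_RInt_derive_R (P p : R -> R) a b :
  (forall t, is_derive P t (p t)) -> (forall t, continuous p t) -> is_RInt p a b (P b - P a)%R.
Proof.
  intros H K. exact (@is_RInt_derive R_CompleteNormedModule P p a b (fun t _ => H t) (fun t _ => K t)).
Qed.

Definition cis (t : R) : C := (cos t, sin t).

Lemma pderiv_cis c t : pderiv (fun s => c * cis s) t (c * (Ci * cis t)).
Proof.
  destruct c as [x y]. split; unfold cis, Re, Im, Ci, Cmult; simpl; auto_derive; auto; ring.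
Qed.

Lemma pderiv_plus_const a p t v : pderiv p t v -> pderiv (fun s => a + p s) t v.
Proof.
  intros H. apply pderiv_eps. intros eps He.
  destruct (proj1 (pderiv_eps _ _ _) H eps He) as [d [Hd K]]. exists d. split; [exact Hd|].
  intros s Hs. replace (a + p s - (a + p t)) with (p s - p t) by ring. apply K, Hs.
Qed.

Lemma pderiv_ext p q t v : (forall s, p s = q s) -> pderiv p t v -> pderiv q t v.
Proof.
  intros E [A B]. split; (eapply is_derive_ext; [|eassumption]); intros s; simpl; rewrite E; reflexivity.
Qed.

Lemma continuity_2d_pt_of_ccont g (p : R -> R -> C) s t :
  continuity_2d_pt (fun x y => Re (p x y)) s t -> continuity_2d_pt (fun x y => Im (p x y)) s t ->
  ccont g (p s t) ->
  continuity_2d_pt (fun x y => Re (g (p x y))) s t /\ continuity_2d_pt (fun x y => Im (g (p x y))) s t.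
Proof.
  intros HR HI Hg.
  assert (K : forall eps : posreal, locally_2d (fun x y => (Cmod (g (p x y) - g (p s t)) < eps)%R) s t).
  { intros eps. destruct (Hg eps (cond_pos eps)) as [d [Hd H]].
    assert (d2 : (0 < d / 2)%R) by lra.
    destruct (HR (mkposreal _ d2)) as [d1 H1]. destruct (HI (mkposreal _ d2)) as [d3 H3].
    exists (mkposreal _ (Rmin_glb_lt _ _ _ (cond_pos d1) (cond_pos d3))). simpl. intros x y Hx Hy.
    assert (A := Rmin_l d1 d3). assert (B := Rmin_r d1 d3).
    specialize (H1 x y ltac:(lra) ltac:(lra)). specialize (H3 x y ltac:(lra) ltac:(lra)). simpl in H1, H3.
    apply H. eapply Rle_lt_trans; [apply Cmod_le_re_im|].
    change (Re (p x y - p s t)) with (Re (p x y) - Re (p s t))%R.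
    change (Im (p x y - p s t)) with (Im (p x y) - Im (p s t))%R. lra. }
  split; intros eps; destruct (K eps) as [d H]; exists d; intros x y Hx Hy; specialize (H x y Hx Hy);
    (eapply Rle_lt_trans; [|exact H]).
  - apply (re_le_Cmod (g (p x y) - g (p s t))).
  - apply (im_le_Cmod (g (p x y) - g (p s t))).
Qed.

(** The complex radius [w] lets the circle pass through a prescribed point: r = 1, t = 0 gives z0 +
    w. The real [r] contracts it to the centre. *)
Definition circ (z0 w : C) (r t : R) : C := z0 + RtoC r * (w * cis t).

Lemma circ_continuous z0 w s t :
  continuity_2d_pt (fun x y => Re (circ z0 w x y)) s t /\ continuity_2d_pt (fun x y => Im (circ z0 w x y)) s t.
Proof.
  destruct z0 as [a b], w as [c d].
  assert (Cs : forall x y, continuity_2d_pt (fun _ v : R => cos v) x y).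
  { intros x y. apply (continuity_1d_2d_pt_comp cos (fun _ v => v)); [apply continuity_cos|apply continuity_2d_pt_id2]. }
  assert (Sn : forall x y, continuity_2d_pt (fun _ v : R => sin v) x y).
  { intros x y. apply (continuity_1d_2d_pt_comp sin (fun _ v => v)); [apply continuity_sin|apply continuity_2d_pt_id2]. }
  split.
  - apply (continuity_2d_pt_ext (fun x y => a + x * (c * cos y + (- d) * sin y))%R).
    { intros x y. unfold circ, cis, Re, RtoC, Cplus, Cmult. simpl. ring. }
    repeat first [apply continuity_2d_pt_plus | apply continuity_2d_pt_mult | apply continuity_2d_pt_const
      | apply continuity_2d_pt_id1 | apply Cs | apply Sn].
  - apply (continuity_2d_pt_ext (fun x y => b + x * (c * sin y + d * cos y))%R).
    { intros x y. unfold circ, cis, Im, RtoC, Cplus, Cmult. simpl. ring. }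
    repeat first [apply continuity_2d_pt_plus | apply continuity_2d_pt_mult | apply continuity_2d_pt_const
      | apply continuity_2d_pt_id1 | apply Cs | apply Sn].
Qed.

Lemma continuity_2d_pt_continuous_2 (G : R -> R -> R) s t :
  continuity_2d_pt G s t -> continuous (fun y => G s y) t.
Proof.
  intros H. apply continuity_pt_filterlim. intros eps He.
  destruct (H (mkposreal _ He)) as [d Hd]. exists d. split; [apply cond_pos|].
  intros y [_ Hy]. apply (Hd s y); [|exact Hy]. rewrite Rminus_diag, Rabs_R0. apply cond_pos.
Qed.

(* By the Cauchy-Riemann equations [r d/dr Re f = d/dt Im f] on circles about [z0], so the mean of [Re f]
   over such a circle does not depend on [r]. *)
Lemma mean_value f f' z0 w :
  (forall z, sderiv f z (f' z)) ->
  is_RInt (fun t => Re (f (circ z0 w 1 t))) (- PI) PI (2 * PI * Re (f z0))%R.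
Proof.
  intros Hf.
  set (U := fun r t => Re (f (circ z0 w r t))).
  set (D := fun r t => Re (f' (circ z0 w r t) * (w * cis t))).
  assert (Ppi := PI_RGT_0).
  assert (HU : forall r t, is_derive (fun s => U s t) r (D r t)).
  { intros r t. apply (pderiv_comp f (fun s => circ z0 w s t)); [|apply Hf]. apply pderiv_linear. }
  assert (HV : forall r t, pderiv (fun s => f (circ z0 w r s)) t (f' (circ z0 w r t) * (RtoC r * w * (Ci * cis t)))).
  { intros r t. apply (pderiv_comp f (fun s => circ z0 w r s)); [|apply Hf].
    apply pderiv_plus_const. apply (pderiv_ext (fun s => RtoC r * w * cis s)); [intros; ring|apply pderiv_cis]. }
  assert (CD : forall r t, continuity_2d_pt D r t).
  { intros r t.
    destruct (circ_continuous z0 w r t) as [C1 C2].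
    destruct (continuity_2d_pt_of_ccont f' (circ z0 w) r t C1 C2 (sderiv_derivative_ccont f f' _ Hf)) as [F1 F2].
    destruct (circ_continuous 0 w 1 t) as [C3 C4].
    assert (C5 : continuity_2d_pt (fun x y => Re (w * cis y)) r t).
    { intros eps. destruct (C3 eps) as [d Hd]. exists d. intros x y Hx Hy.
      specialize (Hd 1%R y ltac:(rewrite Rminus_diag, Rabs_R0; apply cond_pos) Hy).
      unfold circ in Hd. replace (0 + RtoC 1 * (w * cis y)) with (w * cis y) in Hd by ring.
      replace (0 + RtoC 1 * (w * cis t)) with (w * cis t) in Hd by ring. exact Hd. }
    assert (C6 : continuity_2d_pt (fun x y => Im (w * cis y)) r t).
    { intros eps. destruct (C4 eps) as [d Hd]. exists d. intros x y Hx Hy.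
      specialize (Hd 1%R y ltac:(rewrite Rminus_diag, Rabs_R0; apply cond_pos) Hy).
      unfold circ in Hd. replace (0 + RtoC 1 * (w * cis y)) with (w * cis y) in Hd by ring.
      replace (0 + RtoC 1 * (w * cis t)) with (w * cis t) in Hd by ring. exact Hd. }
    apply (continuity_2d_pt_minus
      (fun x y => Re (f' (circ z0 w x y)) * Re (w * cis y))%R (fun x y => Im (f' (circ z0 w x y)) * Im (w * cis y))%R);
      apply continuity_2d_pt_mult; assumption. }
  assert (DI : forall r, is_RInt (D r) (- PI) PI 0%R).
  { intros r.
    assert (Ec : cis PI = cis (- PI)).
    { unfold cis. rewrite cos_neg, sin_neg, sin_PI. f_equal. ring. }
    assert (Cr : forall t, continuous (D r) t).
    { intros t. apply continuity_2d_pt_continuous_2, CD. }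
    (* The relation between radial and angular derivatives is empty at r = 0; there the integrand is
       Re(f'(z0) w exp(i t)), with antiderivative Im(f'(z0) w exp(i t)). *)
    destruct (Req_dec r 0) as [->|Hr].
    - set (P := fun t => Im (f' z0 * w * cis t)).
      assert (EP : (P PI - P (- PI) = 0)%R) by (unfold P; rewrite Ec; apply Rminus_diag).
      enough (J : is_RInt (D 0%R) (- PI) PI (P PI - P (- PI))%R) by (rewrite EP in J; exact J).
      apply is_RInt_derive_R; [|apply Cr]. intros t. unfold P, D.
      destruct (pderiv_cis (f' z0 * w) t) as [_ H].
      replace (circ z0 w 0 t) with z0 by (unfold circ; ring).
      replace (Re (f' z0 * (w * cis t))) with (Im (f' z0 * w * (Ci * cis t))); [exact H|].
      replace (f' z0 * w * (Ci * cis t)) with (Ci * (f' z0 * (w * cis t))) by ring.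
      unfold Re, Im, Ci, Cmult. simpl. ring.
    - set (P := fun t => Im (f (circ z0 w r t))).
      assert (J : is_RInt (fun t => scal r (D r t)) (- PI) PI (P PI - P (- PI))%R).
      { apply is_RInt_derive_R.
        - intros t. destruct (HV r t) as [_ H].
          replace (scal r (D r t)) with (Im (f' (circ z0 w r t) * (RtoC r * w * (Ci * cis t)))); [exact H|].
          replace (f' (circ z0 w r t) * (RtoC r * w * (Ci * cis t))) with
            (Ci * (RtoC r * (f' (circ z0 w r t) * (w * cis t)))) by ring.
          unfold D. set (X := f' (circ z0 w r t) * (w * cis t)). change (scal r (Re X)) with (r * Re X)%R.
          unfold Re, Im, Ci, RtoC, Cmult. simpl. ring.
        - intros t. apply (continuous_scal_r r (D r)), Cr. }
      replace (P PI - P (- PI))%R with 0%R in J.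
      2:{ unfold P, circ. rewrite Ec. symmetry. apply Rminus_diag. }
      apply (is_RInt_scal _ _ _ (/ r)%R) in J.
      match type of J with is_RInt _ _ _ ?v => assert (Ev : v = 0%R) by apply Rmult_0_r; rewrite Ev in J end.
      eapply is_RInt_ext; [|exact J]. intros t _. change (/ r * (r * D r t) = D r t)%R. field. exact Hr. }
  assert (CU : forall r t, continuous (U r) t).
  { intros r t. apply (ex_derive_continuous (K:=R_AbsRing) (V:=R_NormedModule)).
    exists (Re (f' (circ z0 w r t) * (RtoC r * w * (Ci * cis t)))). apply (HV r t). }
  assert (EU : forall r, ex_RInt (U r) (- PI) PI).
  { intros r. apply (@ex_RInt_continuous R_CompleteNormedModule). intros; apply CU. }
  assert (Dv : forall t r, Derive (fun u => U u t) r = D r t).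
  { intros t r. apply is_derive_unique, HU. }
  assert (HM : forall r, is_derive (fun x => RInt (fun t => U x t) (- PI) PI) r 0%R).
  { intros r. replace 0%R with (RInt (fun t => Derive (fun u => U u t) r) (- PI) PI).
    - apply is_derive_RInt_param.
      + exists (mkposreal 1 Rlt_0_1). intros x _ t _. exists (D x t). apply HU.
      + intros t _. apply (continuity_2d_pt_ext D); [|apply CD]. intros x y. symmetry. apply Dv.
      + exists (mkposreal 1 Rlt_0_1). intros y _. apply EU.
    - apply is_RInt_unique. eapply is_RInt_ext; [|apply (DI r)]. intros t _. symmetry. apply Dv. }
  (* The integral is compared at r = 1 and at r = 0, where the integrand is the constant Re
     f(z0). *)
  assert (E := eq_is_derive (fun x => RInt (fun t => U x t) (- PI) PI) 0 1 (fun t _ => HM t) Rlt_0_1).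
  cbv beta in E.
  replace (2 * PI * Re (f z0))%R with (RInt (fun t => U 1%R t) (- PI) PI).
  - apply (@RInt_correct R_CompleteNormedModule), EU.
  - rewrite <- E. rewrite (RInt_ext _ (fun _ => Re (f z0))).
    + rewrite RInt_const.
      assert (Q : ((PI - - PI) * Re (f z0) = 2 * PI * Re (f z0))%R) by ring. exact Q.
    + intros t _. unfold U, circ. replace (z0 + RtoC 0 * (w * cis t)) with z0 by ring. reflexivity.
Qed.

Lemma periodic_Z f p : (forall z, f (z + p) = f z) -> forall (n : Z) z, f (z + RtoC (IZR n) * p) = f z :> C.
Proof.
  intros H n. induction n as [|n IH|n IH] using Z.peano_ind; intros z.
  - f_equal. ring.
  - rewrite succ_IZR, RtoC_plus. replace (z + (RtoC (IZR n) + 1) * p) with (z + RtoC (IZR n) * p + p) by ring.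
    rewrite H. apply IH.
  - rewrite <- (H (z + _)). rewrite <- (IH z). f_equal. unfold Z.pred.
    rewrite plus_IZR, RtoC_plus. change (IZR (-1)) with (- (1))%R. rewrite RtoC_opp. ring.
Qed.

Lemma reduce_lattice T z : upper T -> exists (m n : Z) (s t : R), (0 <= s <= 1)%R /\ (0 <= t <= 1)%R /\
  z = RtoC s + RtoC t * T + RtoC (IZR m) * 1 + RtoC (IZR n) * T.
Proof.
  intros HT. unfold upper in HT.
  set (y := (Im z / Im T)%R). set (x := (Re z - y * Re T)%R).
  destruct (base_Int_part y) as [Y1 Y2]. destruct (base_Int_part x) as [X1 X2].
  exists (Int_part x), (Int_part y), (x - IZR (Int_part x))%R, (y - IZR (Int_part y))%R.
  repeat split; try lra.
  rewrite !RtoC_minus.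
  replace (RtoC x - RtoC (IZR (Int_part x)) + (RtoC y - RtoC (IZR (Int_part y))) * T +
    RtoC (IZR (Int_part x)) * 1 + RtoC (IZR (Int_part y)) * T) with (RtoC x + RtoC y * T) by ring.
  apply injective_projections.
  - unfold RtoC, Cplus, Cmult. simpl. unfold x, Re. ring.
  - unfold RtoC, Cplus, Cmult. simpl. unfold y, Im in *. field. lra.
Qed.

(** By periodicity the maximum over one parallelogram is global. As [f] is entire, the circle about
    the maximum point through any given [z] is available, and equality of mean and maximum forces
    the value at [z]: a single circle replaces a connectedness argument. *)
Lemma doubly_periodic_Re_const f f' T :
  upper T -> (forall z, sderiv f z (f' z)) -> (forall z, f (z + 1) = f z) -> (forall z, f (z + T) = f z) ->
  forall z w, Re (f z) = Re (f w).
Proof.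
  intros HT Hf H1 H2.
  set (p := fun s t : R => RtoC s + RtoC t * T).
  destruct (box_max (fun s t => Re (f (p s t)))) as [s0 [t0 Hmax]].
  { intros s t. refine (proj1 (continuity_2d_pt_of_ccont f p s t _ _ (sderiv_ccont _ _ _ (Hf _)))).
    - apply (continuity_2d_pt_ext (fun x y => x + y * Re T)%R).
      { intros x y. unfold p, RtoC, Cplus, Cmult, Re. simpl. ring. }
      repeat first [apply continuity_2d_pt_plus | apply continuity_2d_pt_mult | apply continuity_2d_pt_const
      | apply continuity_2d_pt_id1 | apply continuity_2d_pt_id2].
    - apply (continuity_2d_pt_ext (fun x y => y * Im T)%R).
      { intros x y. unfold p, RtoC, Cplus, Cmult, Im. simpl. ring. }
      repeat first [apply continuity_2d_pt_plus | apply continuity_2d_pt_mult | apply continuity_2d_pt_const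
      | apply continuity_2d_pt_id1 | apply continuity_2d_pt_id2]. }
  set (z0 := p s0 t0) in *.
  assert (Max : forall z, (Re (f z) <= Re (f z0))%R).
  { intros z. destruct (reduce_lattice T z HT) as [m [n [s [t [Hs [Ht ->]]]]]].
    rewrite (periodic_Z f T H2), (periodic_Z f 1 H1). apply Hmax; assumption. }
  assert (K : forall z, Re (f z) = Re (f z0)).
  { intros z. assert (P := PI_RGT_0).
    assert (J := mean_value f f' z0 (z - z0) Hf).
    set (U := fun t => Re (f (circ z0 (z - z0) 1 t))) in *.
    assert (E : (Re (f z0) - U 0 = 0)%R).
    { apply (RInt_0_nonneg_eq_0 (fun t => Re (f z0) - U t)%R (- PI) PI 0); [| | |lra].
      - intros t. apply (continuous_minus (fun _ => Re (f z0)) U); [apply continuous_const|].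
        apply (ex_derive_continuous (K:=R_AbsRing) (V:=R_NormedModule)).
        assert (Q : pderiv (fun s => circ z0 (z - z0) 1 s) t ((RtoC 1 * (z - z0)) * (Ci * cis t))).
        { apply pderiv_plus_const.
          apply (pderiv_ext (fun s => RtoC 1 * (z - z0) * cis s)); [intros; ring|apply pderiv_cis]. }
        destruct (pderiv_comp f _ t _ _ Q (Hf _)) as [Q1 _]. eexists. exact Q1.
      - intros t. assert (M := Max (circ z0 (z - z0) 1 t)). fold (U t) in M. lra.
      - assert (Q := @is_RInt_minus R_NormedModule (fun _ => Re (f z0)) U _ _ _ _
          (@is_RInt_const R_NormedModule (- PI)%R PI (Re (f z0))) J).
        match type of Q with is_RInt _ _ _ ?v => assert (Ev : v = ((PI - - PI) * Re (f z0) - 2 * PI * Re (f z0))%R)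
          by reflexivity; rewrite Ev in Q end.
        replace ((PI - - PI) * Re (f z0) - 2 * PI * Re (f z0))%R with 0%R in Q by ring. exact Q. }
    replace z with (circ z0 (z - z0) 1 0); [fold (U 0%R); lra|].
    unfold circ. replace (cis 0) with (RtoC 1) by (unfold cis; rewrite cos_0, sin_0; reflexivity). ring. }
  intros z w. rewrite (K z), (K w). reflexivity.
Qed.

(** The imaginary part of [f] is the real part of - i f. *)
Lemma doubly_periodic_const f f' T :
  upper T -> (forall z, sderiv f z (f' z)) -> (forall z, f (z + 1) = f z) -> (forall z, f (z + T) = f z) ->
  forall z w, f z = f w.
Proof.
  intros HT Hf H1 H2 z w. apply injective_projections.
  - apply (doubly_periodic_Re_const f f' T HT Hf H1 H2).
  - assert (K := doubly_periodic_Re_const (fun z => - Ci * f z) (fun z => 0 * f z + - Ci * f' z) T HT).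
    assert (E : forall x, Re (- Ci * f x) = Im (f x)).
    { intros x. unfold Re, Im, Ci, Copp, Cmult. simpl. ring. }
    assert (K' : Re (- Ci * f z) = Re (- Ci * f w)).
    { apply K.
      - intros x. apply (sderiv_mult (fun _ => - Ci) f); [apply sderiv_const|apply Hf].
      - intros x. rewrite H1. reflexivity.
      - intros x. rewrite H2. reflexivity. }
    rewrite !E in K'. exact K'.
Qed.

(** * Modular transformation of theta *)

Lemma Cinv_neq_0 (z : C) : z <> 0 -> / z <> 0.
Proof. intros Hz E. apply C1_nz. rewrite <- (Cinv_r _ Hz), E. ring. Qed.

Definition autj (c d : Z) (T : C) : C := RtoC (IZR c) * T + RtoC (IZR d).

Lemma autj_nz a b c d T : SL2Z a b c d -> upper T -> autj c d T <> 0.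
Proof.
  intros H HT E. unfold upper, SL2Z, autj in *.
  assert (E1 := f_equal Im E). assert (E2 := f_equal Re E).
  unfold Re, Im, RtoC, Cplus, Cmult in *. simpl in *.
  assert (C0 : IZR c = 0%R) by nra. rewrite C0 in E2. assert (D0 : IZR d = 0%R) by lra.
  apply eq_IZR in C0. apply eq_IZR in D0. subst. lia.
Qed.

Lemma mob_upper a b c d T : SL2Z a b c d -> upper T -> upper (mob a b c d T).
Proof.
  intros H HT. assert (N := autj_nz a b c d T H HT). unfold autj in N.
  unfold upper, mob, SL2Z in *.
  assert (D : (IZR a * IZR d - IZR b * IZR c = 1)%R) by (rewrite <- !mult_IZR, <- minus_IZR, H; reflexivity).
  destruct T as [x y]. unfold Im in HT. simpl in HT.
  set (n := ((IZR c * x + IZR d) * (IZR c * x + IZR d) + (IZR c * y) * (IZR c * y))%R).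
  assert (Hn : (0 < n)%R).
  { assert (P : (0 <= n)%R) by (unfold n; apply Rplus_le_le_0_compat; apply Rle_0_sqr).
    destruct P as [P|E]; [exact P|]. exfalso. apply N. symmetry in E.
    apply (Rplus_sqr_eq_0 (IZR c * x + IZR d) (IZR c * y)) in E. destruct E as [E1 E2].
    unfold RtoC, Cplus, Cmult. simpl. f_equal; lra. }
  replace (Im _) with (y / n)%R; [apply Rdiv_lt_0_compat; assumption|].
  unfold Cdiv, Cinv, Cplus, Cmult, RtoC, Im. simpl.
  replace (y / n)%R with ((IZR a * IZR d - IZR b * IZR c) * y / n)%R by (rewrite D; field; lra).
  unfold n in *. field. nra.
Qed.

Lemma SL2Z_RtoC a b c d : SL2Z a b c d ->
  RtoC (IZR a) * RtoC (IZR d) - RtoC (IZR b) * RtoC (IZR c) = 1.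
Proof. intros H. rewrite <- !RtoC_mult, <- RtoC_minus, <- !mult_IZR, <- minus_IZR, H. reflexivity. Qed.

(** Modulo 2 the integer m - n - n m is (m + 1) (n + 1) - 1, odd unless [m] and [n] are both even.
    It is applied to the two entries of a column of a matrix of determinant 1, which are never both
    even. *)
Lemma ee_half_parity (m n : Z) : (Z.odd m || Z.odd n)%bool = true ->
  ee (RtoC (IZR (m - n - n * m)) / 2) = - (1).
Proof.
  intros H.
  assert (E : exists k : Z, (m - n - n * m = 2 * k + 1)%Z).
  { apply Bool.orb_true_iff in H. destruct H as [H|H]; apply Z.odd_spec in H; destruct H as [k ->].
    - exists (k - n - n * k)%Z. ring.
    - exists (-1 - k - k * m)%Z. ring. }
  destruct E as [k ->]. rewrite plus_IZR, mult_IZR, RtoC_plus, RtoC_mult.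
  replace ((2 * RtoC (IZR k) + 1) / 2) with (RtoC (IZR k) + RtoC (1 / 2)) by (rewrite RtoC_div by lra; field).
  rewrite ee_plus, ee_Z, ee_half. ring.
Qed.

Section Modular.

Variables (a b c d : Z) (T : C).
Hypotheses (HS : SL2Z a b c d) (HT : upper T).

Let j := autj c d T.
Let S := mob a b c d T.
Let A (z : C) := theta (z / j) S * ee (- (RtoC (IZR c) * (z * z) / (2 * j))).

Let j_nz : j <> 0 := autj_nz a b c d T HS HT.
Let S_upper : upper S := mob_upper a b c d T HS HT.

(** Together with [modular_T_div_j] this gives the coordinates of 1 / j and T / j in the basis 1, S:
    division by [j] maps Z + Z T into Z + Z S. *)
Lemma modular_inv_j : / j = RtoC (IZR a) - RtoC (IZR c) * S.
Proof.
  assert (D := SL2Z_RtoC _ _ _ _ HS). unfold S, mob. fold (autj c d T). fold j.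
  replace (/ j) with ((RtoC (IZR a) * RtoC (IZR d) - RtoC (IZR b) * RtoC (IZR c)) / j) by (rewrite D; field; apply j_nz).
  unfold j at 2, autj. assert (N := j_nz). unfold j, autj in N |- *. field. exact N.
Qed.

Lemma modular_T_div_j : T / j = RtoC (IZR d) * S - RtoC (IZR b).
Proof.
  assert (D := SL2Z_RtoC _ _ _ _ HS). unfold S, mob. fold (autj c d T). fold j.
  replace (T / j) with (T * (RtoC (IZR a) * RtoC (IZR d) - RtoC (IZR b) * RtoC (IZR c)) / j) by (rewrite D; field; apply j_nz).
  assert (N := j_nz). unfold j, autj in N |- *. field. exact N.
Qed.

Lemma modular_shift_1 z : A (z + 1) = - A z.
Proof.
  unfold A.
  replace ((z + 1) / j) with (z / j + RtoC (IZR a) + RtoC (IZR (- c)) * S).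
  2:{ replace ((z + 1) / j) with (z / j + / j) by (field; apply j_nz).
      rewrite modular_inv_j, opp_IZR, RtoC_opp. ring. }
  rewrite theta_lattice by exact S_upper.
  assert (P : ee (RtoC (IZR (a - c - c * a)) / 2) = - (1)).
  { apply ee_half_parity. unfold SL2Z in HS.
    destruct (Z.Even_or_Odd a) as [Ha|Ha]; [|apply Z.odd_spec in Ha; rewrite Ha; reflexivity].
    destruct (Z.Even_or_Odd c) as [Hc|Hc]; [|apply Z.odd_spec in Hc; rewrite Hc; apply Bool.orb_true_r].
    destruct Ha as [x ->], Hc as [y ->]. lia. }
  replace (- (theta (z / j) S * ee (- (RtoC (IZR c) * (z * z) / (2 * j))))) with
    (ee (RtoC (IZR (a - c - c * a)) / 2) * (theta (z / j) S * ee (- (RtoC (IZR c) * (z * z) / (2 * j))))) by (rewrite P; ring).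
  match goal with |- ee ?x * ?t * ee ?y = ee ?u * (?t * ee ?v) =>
    replace (ee x * t * ee y) with (t * ee (x + y)) by (rewrite ee_plus; ring);
    replace (ee u * (t * ee v)) with (t * ee (u + v)) by (rewrite ee_plus; ring) end.
  f_equal. f_equal.
  (* Eliminating [S] through c S = a - 1 / j leaves an identity of rational expressions in [j]. *)
  assert (CS : RtoC (IZR c) * S = RtoC (IZR a) - / j) by (rewrite modular_inv_j; ring).
  rewrite opp_IZR, RtoC_opp, !minus_IZR, mult_IZR, !RtoC_minus, RtoC_mult.
  replace (- RtoC (IZR c) * - RtoC (IZR c) * S / 2) with (RtoC (IZR c) * (RtoC (IZR c) * S) / 2) by field.
  rewrite CS. field. apply j_nz.
Qed.

Lemma modular_shift_T z : A (z + T) = ee (RtoC (1 / 2) - T / 2 - z) * A z.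
Proof.
  unfold A.
  replace ((z + T) / j) with (z / j + RtoC (IZR (- b)) + RtoC (IZR d) * S).
  2:{ replace ((z + T) / j) with (z / j + T / j) by (field; apply j_nz).
      rewrite modular_T_div_j, opp_IZR, RtoC_opp. ring. }
  rewrite theta_lattice by exact S_upper.
  assert (P : ee (RtoC (IZR (d - b - b * d)) / 2) = ee (RtoC (1 / 2))).
  { rewrite ee_half. apply ee_half_parity. unfold SL2Z in HS.
    destruct (Z.Even_or_Odd d) as [Ha|Ha]; [|apply Z.odd_spec in Ha; rewrite Ha; reflexivity].
    destruct (Z.Even_or_Odd b) as [Hc|Hc]; [|apply Z.odd_spec in Hc; rewrite Hc; apply Bool.orb_true_r].
    destruct Ha as [x ->], Hc as [y ->]. lia. }
  replace (ee (RtoC (1 / 2) - T / 2 - z)) with (ee (RtoC (IZR (d - b - b * d)) / 2 - T / 2 - z)) by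
    (rewrite !(ee_minus _ z), !(ee_minus _ (T / 2)), P; reflexivity).
  match goal with |- ee ?x * ?t * ee ?y = ee ?u * (?t * ee ?v) =>
    replace (ee x * t * ee y) with (t * ee (x + y)) by (rewrite ee_plus; ring);
    replace (ee u * (t * ee v)) with (t * ee (u + v)) by (rewrite ee_plus; ring) end.
  f_equal. f_equal.
  assert (DS : RtoC (IZR d) * S = T / j + RtoC (IZR b)) by (rewrite modular_T_div_j; ring).
  rewrite opp_IZR, RtoC_opp, !minus_IZR, mult_IZR, !RtoC_minus, RtoC_mult.
  replace (RtoC (IZR d) * RtoC (IZR d) * S / 2) with (RtoC (IZR d) * (RtoC (IZR d) * S) / 2) by field.
  rewrite DS. assert (N := j_nz). unfold j, autj in N |- *. field. exact N.
Qed.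

(** The quotient of [A z] by [theta z T] with the common factor [z] cancelled, hence regular at the
    origin. *)
Let ratio_reg (z : C) : C :=
  theta_red (z / j) S * / j * ee (- (RtoC (IZR c) * (z * z) / (2 * j))) * / theta_red z T.

(* At the common zeros of [A] and [theta], the lattice points, the value is forced by periodicity. *)
Let ratio (z : C) : C := if excluded_middle_informative (lattice T z) then ratio_reg 0 else ratio_reg z.

Lemma lattice_shift z m n : lattice T (z + RtoC (IZR m) + RtoC (IZR n) * T) <-> lattice T z.
Proof.
  split.
  - intros [m' [n' H]]. exists (m' - m)%Z, (n' - n)%Z.
    replace z with (z + RtoC (IZR m) + RtoC (IZR n) * T - RtoC (IZR m) - RtoC (IZR n) * T) by ring.
    rewrite H, !minus_IZR, !RtoC_minus. ring.
  - intros [m' [n' ->]]. exists (m' + m)%Z, (n' + n)%Z. rewrite !plus_IZR, !RtoC_plus. ring.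
Qed.

Lemma ratio_quotient z : ~ lattice T z -> ratio z = A z / theta z T.
Proof.
  intros H. unfold ratio. destruct (excluded_middle_informative (lattice T z)) as [K|_]; [contradiction|].
  assert (Hz : z <> 0). { intros ->. apply H. exists 0%Z, 0%Z. ring. }
  assert (HR : theta_red z T <> 0). { intros E. apply theta_red_eq_0 in E; tauto. }
  unfold ratio_reg, A. rewrite !theta_red_spec by assumption. field. repeat split; auto.
Qed.

(** Off the lattice the common multiplier [u] cancels; on the lattice both values are [ratio_reg 0]
    by definition. *)
Lemma ratio_periodic_aux p : (forall z, lattice T (z + p) <-> lattice T z) ->
  (forall z, exists u : C, u <> 0 /\ A (z + p) = u * A z /\ theta (z + p) T = u * theta z T) ->
  forall z, ratio (z + p) = ratio z.
Proof.
  intros HL HA z. destruct (classic (lattice T z)) as [K|K].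
  - unfold ratio. destruct (excluded_middle_informative (lattice T z)) as [_|N]; [|contradiction].
    destruct (excluded_middle_informative (lattice T (z + p))) as [_|N]; [reflexivity|].
    destruct N. apply HL, K.
  - rewrite !ratio_quotient by (rewrite ?HL; exact K).
    destruct (HA z) as [u [Hu [-> ->]]]. field. split; [|exact Hu].
    intros E. apply K. apply theta_eq_0; assumption.
Qed.

Lemma ratio_periodic_1 z : ratio (z + 1) = ratio z.
Proof.
  apply ratio_periodic_aux.
  - intros w. replace (w + 1) with (w + RtoC 1 + RtoC 0 * T) by ring. apply (lattice_shift w 1 0).
  - intros w. exists (- (1)). split; [|rewrite modular_shift_1, theta_shift_1; split; ring].
    intros E. apply C1_nz. replace (RtoC 1) with (- - (1)) by ring. rewrite E. ring.
Qed.

Lemma ratio_periodic_T z : ratio (z + T) = ratio z.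
Proof.
  apply ratio_periodic_aux.
  - intros w. replace (w + T) with (w + RtoC 0 + RtoC 1 * T) by ring. apply (lattice_shift w 0 1).
  - intros w. exists (ee (RtoC (1 / 2) - T / 2 - w)). split; [apply ee_nz|].
    rewrite modular_shift_T, theta_shift_T by exact HT. split; reflexivity.
Qed.

Lemma ratio_reg_sderiv z : theta_red z T <> 0 -> exists l, sderiv ratio_reg z l.
Proof.
  intros H. destruct (theta_red_sderiv (z / j) S S_upper) as [l1 H1].
  destruct (theta_red_sderiv z T HT) as [l2 H2].
  eexists. unfold ratio_reg.
  apply (sderiv_mult (fun z => theta_red (z / j) S * / j * ee (- (RtoC (IZR c) * (z * z) / (2 * j))))
    (fun z => / theta_red z T)).
  - apply (sderiv_mult (fun z => theta_red (z / j) S * / j) (fun z => ee (- (RtoC (IZR c) * (z * z) / (2 * j))))).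
    + apply (sderiv_mult (fun z => theta_red (z / j) S) (fun _ => / j)); [|apply sderiv_const].
      apply (sderiv_comp (fun w => theta_red w S) (fun w => w / j)); [|exact H1].
      apply (sderiv_ext (fun w => / j * w + 0)); [intros w; field; apply j_nz|apply sderiv_affine].
    + apply (sderiv_comp ee (fun z => - (RtoC (IZR c) * (z * z) / (2 * j)))); [|apply ee_sderiv].
      apply (sderiv_ext (fun w => (- RtoC (IZR c) / (2 * j)) * (w * w))); [intros w; field; apply j_nz|].
      apply (sderiv_mult (fun _ => - RtoC (IZR c) / (2 * j)) (fun w => w * w)); [apply sderiv_const|].
      apply (sderiv_mult (fun w => w) (fun w => w)); apply sderiv_id.
  - apply (sderiv_comp Cinv (fun w => theta_red w T)); [exact H2|apply sderiv_inv, H].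
Qed.

(** Near a point where [theta_red] does not vanish the only possible lattice point is 0, where
    [ratio] and [ratio_reg] agree by definition. *)
Lemma ratio_sderiv_regular z : theta_red z T <> 0 -> exists l, sderiv ratio z l.
Proof.
  intros H. destruct (ratio_reg_sderiv z H) as [l Hl]. exists l.
  destruct (theta_red_sderiv z T HT) as [l2 H2].
  destruct (sderiv_ccont _ _ _ H2 _ (proj1 (Cmod_gt_0 _) H)) as [r [Hr K]].
  apply (sderiv_ext_loc ratio_reg ratio z l r Hr); [|exact Hl]. intros w Hw. specialize (K w Hw).
  unfold ratio. destruct (excluded_middle_informative (lattice T w)) as [L|_]; [|reflexivity].
  destruct (classic (w = 0)) as [->|Nw]; [reflexivity|].
  assert (E : theta_red w T = 0) by (apply theta_red_eq_0; auto). rewrite E in K.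
  replace (0 - theta_red z T) with (- theta_red z T) in K by ring. rewrite Cmod_opp in K. lra.
Qed.

(** The points not covered by [ratio_sderiv_regular] are nonzero lattice points, and periodicity
    moves them to 0. *)
Lemma ratio_sderiv z : exists l, sderiv ratio z l.
Proof.
  destruct (classic (theta_red z T = 0)) as [E|E]; [|apply ratio_sderiv_regular, E].
  apply theta_red_eq_0 in E; [|exact HT]. destruct E as [[m [n E]] _].
  assert (H0 : theta_red 0 T <> 0). { intros K. apply theta_red_eq_0 in K; tauto. }
  destruct (ratio_sderiv_regular 0 H0) as [l Hl]. exists (l * 1).
  apply (sderiv_ext (fun w => ratio (1 * w + - z))).
  - intros w. rewrite E.
    replace w with ((1 * w + - (RtoC (IZR m) + RtoC (IZR n) * T)) + RtoC (IZR m) * 1 + RtoC (IZR n) * T) at 2 by ring.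
    rewrite (periodic_Z ratio T ratio_periodic_T), (periodic_Z ratio 1 ratio_periodic_1). reflexivity.
  - apply (sderiv_comp ratio (fun w => 1 * w + - z)); [apply sderiv_affine|].
    replace (1 * z + - z) with (RtoC 0) by ring. exact Hl.
Qed.

(** The constant is theta_red(0, S) / (j theta_red(0, T)), nonzero because theta has a simple zero
    at the origin. *)
Lemma theta_modular : exists u : C, u <> 0 /\ forall z,
  theta (z / j) S = u * ee (RtoC (IZR c) * (z * z) / (2 * j)) * theta z T.
Proof.
  set (dratio := fun z => proj1_sig (constructive_indefinite_description _ (ratio_sderiv z))).
  assert (HF' : forall z, sderiv ratio z (dratio z)).
  { intros z. exact (proj2_sig (constructive_indefinite_description _ (ratio_sderiv z))). }
  assert (K := doubly_periodic_const ratio dratio T HT HF' ratio_periodic_1 ratio_periodic_T).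
  exists (ratio_reg 0). split.
  - unfold ratio_reg. replace (0 / j) with (RtoC 0) by (field; apply j_nz).
    assert (H0 : theta_red 0 T <> 0). { intros E. apply theta_red_eq_0 in E; tauto. }
    assert (H1 : theta_red 0 S <> 0). { intros E. apply theta_red_eq_0 in E; tauto. }
    apply Cmult_neq_0; [apply Cmult_neq_0; [apply Cmult_neq_0; [exact H1|]|apply ee_nz]|]; apply Cinv_neq_0;
      [apply j_nz|exact H0].
  - intros z.
    assert (Z : A z = ratio_reg 0 * theta z T).
    { destruct (classic (lattice T z)) as [L|L].
      - rewrite (proj2 (theta_eq_0 z T HT) L).
        destruct L as [m [n ->]]. unfold A.
        (* On the lattice both sides vanish, since (m + n T) / j lies in Z + Z S. *)
        replace ((RtoC (IZR m) + RtoC (IZR n) * T) / j) with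
          (RtoC (IZR (m * a - n * b)) + RtoC (IZR (n * d - m * c)) * S).
        + rewrite (proj2 (theta_eq_0 _ S S_upper)); [ring|]. eexists _, _. reflexivity.
        + replace ((RtoC (IZR m) + RtoC (IZR n) * T) / j) with (RtoC (IZR m) * / j + RtoC (IZR n) * (T / j))
            by (field; apply j_nz).
          rewrite modular_inv_j, modular_T_div_j, !minus_IZR, !mult_IZR, !RtoC_minus, !RtoC_mult. ring.
      - assert (E := K z 0). rewrite (ratio_quotient z L) in E.
        assert (E0 : ratio 0 = ratio_reg 0) by (unfold ratio; destruct (excluded_middle_informative (lattice T 0)); reflexivity).
        rewrite <- E0, <- E. field. intros Z. apply L, theta_eq_0; assumption. }
    unfold A in Z.
    replace (ratio_reg 0 * ee (RtoC (IZR c) * (z * z) / (2 * j)) * theta z T) with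
      ((ratio_reg 0 * theta z T) * ee (RtoC (IZR c) * (z * z) / (2 * j))) by ring.
    rewrite <- Z, <- Cmult_assoc, <- ee_plus.
    replace (- (RtoC (IZR c) * (z * z) / (2 * j)) + RtoC (IZR c) * (z * z) / (2 * j)) with (RtoC 0) by ring.
    rewrite ee_0. ring.
Qed.

End Modular.

(** * Expansions of infinite products and their quotients *)

(** Analyticity at 0, recorded through a coefficient bound that products and reciprocals transform
    explicitly. *)
Definition analytic0 (F : C -> C) : Prop :=
  exists c M rho, (0 < rho)%R /\ pwr_bound c M rho /\
    forall y, (rho * Cmod y < 1)%R -> F y = psum c y.

Lemma pwr_bound_pos c M rho : pwr_bound c M rho -> (0 <= M)%R.
Proof. intros H. assert (A := H 0%nat). assert (B := Cmod_ge_0 (c 0%nat)). simpl in A. lra. Qed.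

Lemma pwr_bound_mono c M rho M' rho' :
  pwr_bound c M rho -> (M <= M')%R -> (0 < rho <= rho')%R -> pwr_bound c M' rho'.
Proof.
  intros H HM Hr k. assert (P := pwr_bound_pos _ _ _ H). eapply Rle_trans; [apply H|].
  apply Rmult_le_compat; [exact P|apply pow_le; lra|exact HM|apply pow_incr; lra].
Qed.

Definition conv (a b : nat -> C) (n : nat) : C := csum (fun i => a i * b (n - i)%nat) (S n).

(** The triangle of index pairs i + j < n is summed row by row. *)
Lemma csum_conv a b n : csum (conv a b) n = csum (fun i => a i * csum b (n - i)) n.
Proof.
  induction n as [|n IH]; [reflexivity|].
  change (csum (conv a b) (S n)) with (csum (conv a b) n + conv a b n). rewrite IH. unfold conv.
  cbn [csum]. rewrite Nat.sub_diag.
  replace (S n - n)%nat with 1%nat by lia. cbn [csum].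
  rewrite (csum_ext (fun i => a i * csum b (S n - i)) (fun i => a i * csum b (n - i) + a i * b (n - i)%nat)).
  - rewrite csum_plus. ring.
  - intros i Hi. replace (S n - i)%nat with (S (n - i)) by lia. cbn [csum]. ring.
Qed.

Lemma Cmod_csum_const a n B : (forall k, (k < n)%nat -> (Cmod (a k) <= B)%R) -> (Cmod (csum a n) <= INR n * B)%R.
Proof.
  induction n as [|n IH]; intros H; [simpl; rewrite Cmod_0; lra|].
  cbn [csum]. eapply Rle_trans; [apply Cmod_triangle|]. rewrite S_INR.
  assert (A := IH (fun k Hk => H k ltac:(lia))). assert (B' := H n ltac:(lia)). lra.
Qed.

Lemma csum_mult_r a x n : csum a n * x = csum (fun k => a k * x) n.
Proof. induction n as [|n IH]; cbn [csum]; [ring|rewrite <- IH; ring]. Qed.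

Lemma INR_S_le_pow2 n : (INR (S n) <= 2 ^ n)%R.
Proof.
  induction n as [|n IH]; [simpl; lra|]. rewrite S_INR. simpl pow.
  assert (P : (1 <= 2 ^ n)%R) by (apply pow_R1_Rle; lra). lra.
Qed.

(** Mertens' argument: the partial sums of the Cauchy product differ from [y] times those of [a] by
    a defect of order n t^n, and with t = s^2 one factor s^n absorbs n. *)
Lemma conv_cseries a b M t x y :
  (0 <= t < 1)%R -> (forall k, (Cmod (a k) <= M * t ^ k)%R) -> (forall k, (Cmod (b k) <= M * t ^ k)%R) ->
  cseries a x -> cseries b y -> cseries (conv a b) (x * y).
Proof.
  intros Ht Ha Hb Hx Hy.
  assert (HM : (0 <= M)%R). { assert (A := Ha 0%nat). assert (B := Cmod_ge_0 (a 0%nat)). simpl in A. lra. }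
  set (K := (M / (1 - t))%R). assert (HK : (0 <= K)%R) by (apply Rdiv_le_0_compat; lra).
  (* the defect sum_i a_i (y - b_0 - ... - b_{n-i-1}) tends to 0 *)
  assert (Dfc : climit (fun n => csum (fun i => a i * (csum b (n - i) - y)) n) 0).
  { set (s := sqrt t).
    assert (Hs0 : (0 <= s)%R) by apply sqrt_pos.
    assert (Hss : (s * s = t)%R) by (apply sqrt_sqrt; lra).
    assert (Hs1 : (s < 1)%R) by nra.
    destruct (sqr_pow_bound s ltac:(lra)) as [L HL].
    apply (climit_geom _ _ (M * K * L) s ltac:(lra)). intros n.
    replace (csum (fun i => a i * (csum b (n - i) - y)) n - 0) with
      (csum (fun i => a i * (csum b (n - i) - y)) n) by ring.
    eapply Rle_trans; [apply (Cmod_csum_const _ _ (M * K * t ^ n))|].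
    - intros i Hi. rewrite Cmod_mult.
      assert (T := cseries_geom_tail b M t y (n - i) Ht Hb Hy). rewrite Cmod_minus_sym in T. fold K in T.
      apply Rle_trans with ((M * t ^ i) * (K * t ^ (n - i)))%R.
      + apply Rmult_le_compat; auto using Cmod_ge_0.
      + replace (t ^ n)%R with (t ^ i * t ^ (n - i))%R; [right; ring|].
        rewrite <- pow_add. f_equal. lia.
    - replace (t ^ n)%R with (s ^ n * s ^ n)%R by (rewrite <- Rpow_mult_distr, Hss; reflexivity).
      assert (P : (0 <= s ^ n)%R) by (apply pow_le; lra).
      assert (N : (INR n * s ^ n <= L)%R).
      { eapply Rle_trans; [|apply (HL n)]. apply Rmult_le_compat_r; [exact P|].
        destruct n as [|n]; [simpl; lra|]. rewrite S_INR. assert (Q := pos_INR n). nra. }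
      replace (INR n * (M * K * (s ^ n * s ^ n)))%R with ((M * K * s ^ n) * (INR n * s ^ n))%R by ring.
      replace (M * K * L * s ^ n)%R with ((M * K * s ^ n) * L)%R by ring.
      apply Rmult_le_compat_l; [|exact N]. apply Rmult_le_pos; [apply Rmult_le_pos; assumption|exact P]. }
  replace (x * y) with (0 + y * x) by ring.
  eapply climit_ext; [|apply (climit_plus _ _ _ _ Dfc (climit_scal _ _ y Hx))].
  intros n. cbv beta. rewrite csum_conv, Cmult_comm, csum_mult_r, <- csum_plus.
  apply csum_ext. intros k _. ring.
Qed.

(** There are k + 1 <= 2^k terms, which costs a factor 2 in [rho]. *)
Lemma conv_pwr_bound a b M rho :
  pwr_bound a M rho -> pwr_bound b M rho -> (0 < rho)%R -> pwr_bound (conv a b) (M * M) (2 * rho).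
Proof.
  intros Ha Hb Hr k. assert (P := pwr_bound_pos _ _ _ Ha). unfold conv.
  eapply Rle_trans; [apply (Cmod_csum_const _ _ (M * M * rho ^ k))|].
  - intros i Hi. rewrite Cmod_mult. apply Rle_trans with ((M * rho ^ i) * (M * rho ^ (k - i)))%R.
    + apply Rmult_le_compat; auto using Cmod_ge_0.
    + replace (rho ^ k)%R with (rho ^ i * rho ^ (k - i))%R; [right; ring|].
      rewrite <- pow_add. f_equal. lia.
  - rewrite Rpow_mult_distr.
    replace (M * M * (2 ^ k * rho ^ k))%R with (2 ^ k * (M * M * rho ^ k))%R by ring.
    apply Rmult_le_compat_r; [|apply INR_S_le_pow2].
    apply Rmult_le_pos; [nra|apply pow_le; lra].
Qed.

Lemma conv_pow a b y n : conv a b n * y ^ n = conv (fun k => a k * y ^ k) (fun k => b k * y ^ k) n.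
Proof.
  unfold conv. rewrite csum_mult_r. apply csum_ext. intros k Hk.
  replace (y ^ n) with (y ^ k * y ^ (n - k)); [ring|].
  rewrite <- Cpow_add_r. f_equal. lia.
Qed.

Lemma psum_conv a b M rho y : pwr_bound a M rho -> pwr_bound b M rho -> (0 < rho)%R ->
  (2 * rho * Cmod y < 1)%R -> psum (conv a b) y = psum a y * psum b y.
Proof.
  intros Ha Hb Hr Hy. assert (Py := Cmod_ge_0 y).
  assert (H0 : (0 <= rho * Cmod y)%R) by (apply Rmult_le_pos; lra).
  apply (cseries_unique (fun k => conv a b k * y ^ k)).
  - apply (psum_spec _ (M * M) (2 * rho)); [apply conv_pwr_bound; auto|lra|exact Hy].
  - eapply cseries_ext; [intros k; symmetry; apply conv_pow|].
    apply (conv_cseries _ _ M (rho * Cmod y)); [lra| | | |].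
    + intros k. apply pwr_bound_term; auto.
    + intros k. apply pwr_bound_term; auto.
    + apply (psum_spec a M rho); [auto|lra|lra].
    + apply (psum_spec b M rho); [auto|lra|lra].
Qed.

Lemma analytic0_mult F G : analytic0 F -> analytic0 G -> analytic0 (fun y => F y * G y).
Proof.
  intros [a [M [rho [Hr [Ha EF]]]]] [b [M' [rho' [Hr' [Hb EG]]]]].
  set (s := Rmax rho rho'). set (L := Rmax M M').
  assert (A1 := Rmax_l rho rho'). assert (A2 := Rmax_r rho rho'). fold s in A1, A2.
  assert (Ha' : pwr_bound a L s) by (apply (pwr_bound_mono _ M rho); [auto|apply Rmax_l|lra]).
  assert (Hb' : pwr_bound b L s) by (apply (pwr_bound_mono _ M' rho'); [auto|apply Rmax_r|lra]).
  exists (conv a b), (L * L)%R, (2 * s)%R. split; [lra|]. split; [apply conv_pwr_bound; auto; lra|].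
  intros y Hy. assert (Py := Cmod_ge_0 y).
  rewrite (psum_conv a b L s y Ha' Hb' ltac:(lra) Hy), EF, EG; [reflexivity| |].
  - apply Rle_lt_trans with (2 * s * Cmod y)%R; [apply Rmult_le_compat_r; lra|exact Hy].
  - apply Rle_lt_trans with (2 * s * Cmod y)%R; [apply Rmult_le_compat_r; lra|exact Hy].
Qed.

(* [recip_aux c n k] is, for [k <= n], the [k]-th coefficient of the reciprocal power series. *)
Fixpoint recip_aux (c : nat -> C) (n : nat) : nat -> C :=
  match n with
  | O => fun _ => / c 0%nat
  | S m => fun k => if (k <=? m)%nat then recip_aux c m k
                    else - / c 0%nat * csum (fun j => c (S j) * recip_aux c m (m - j)%nat) (S m)
  end.

Definition recip (c : nat -> C) (k : nat) : C := recip_aux c k k.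

Lemma recip_aux_stable c n k : (k <= n)%nat -> recip_aux c n k = recip c k.
Proof.
  intros H. induction n as [|n IH]; [replace k with 0%nat by lia; reflexivity|].
  destruct (Nat.eq_dec k (S n)) as [->|Hne]; [reflexivity|].
  cbn [recip_aux]. rewrite (proj2 (Nat.leb_le k n)) by lia. apply IH. lia.
Qed.

Lemma recip_S c m : recip c (S m) = - / c 0%nat * csum (fun j => c (S j) * recip c (m - j)%nat) (S m).
Proof.
  unfold recip at 1. cbn [recip_aux]. rewrite (proj2 (Nat.leb_gt (S m) m)) by lia.
  f_equal. apply csum_ext. intros j Hj. rewrite recip_aux_stable by lia. reflexivity.
Qed.

Lemma conv_recip (c : nat -> C) n : c 0%nat <> 0 -> conv c (recip c) n = match n with O => 1 | S _ => 0 end.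
Proof.
  intros H. unfold conv. rewrite csum_first. rewrite Nat.sub_0_r. destruct n as [|m].
  - simpl. unfold recip. simpl. field. exact H.
  - rewrite recip_S.
    set (X := csum (fun j => c (S j) * recip c (m - j)%nat) (S m)).
    change (c 0%nat * (- / c 0%nat * X) + X = 0). field. exact H.
Qed.

Lemma Cmod_csum_geom a n B t : (0 <= t < 1)%R ->
  (forall k, (k < n)%nat -> (Cmod (a k) <= B * t ^ k)%R) -> (0 <= B)%R -> (Cmod (csum a n) <= B / (1 - t))%R.
Proof.
  intros Ht H HB.
  set (a' := fun k => if (k <? n)%nat then a k else 0).
  rewrite (csum_ext a a').
  - assert (K := csum_geom_diff_le a' B t 0 n Ht).
    replace (csum a' n) with (csum a' n - csum a' 0) by (simpl; ring).
    eapply Rle_trans; [apply K; [|lia]|simpl; lra].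
    intros k. unfold a'. destruct (Nat.ltb_spec k n) as [L|L]; [apply H, L|].
    rewrite Cmod_0. apply Rmult_le_pos; [exact HB|apply pow_le; lra].
  - intros k Hk. unfold a'. rewrite (proj2 (Nat.ltb_lt k n)) by exact Hk. reflexivity.
Qed.

(** With A = 1 / |c_0|, the bound A s^k reproduces itself under the recursion: the geometric sum of
    ratio rho / s gives A (M rho A s^m) / (1 - rho / s), and s = rho (1 + A M) is the value for
    which this equals A s^(m+1). *)
Lemma recip_pwr_bound (c : nat -> C) M rho : pwr_bound c M rho -> (0 < rho)%R -> (0 < M)%R -> c 0%nat <> 0 ->
  pwr_bound (recip c) (/ Cmod (c 0%nat)) (rho * (1 + / Cmod (c 0%nat) * M)).
Proof.
  intros Hc Hr HM H0. set (A := (/ Cmod (c 0%nat))%R).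
  assert (HA : (0 < A)%R) by (apply Rinv_0_lt_compat, Cmod_gt_0, H0).
  set (s := (rho * (1 + A * M))%R).
  assert (HAM : (0 < A * M)%R) by (apply Rmult_lt_0_compat; lra).
  assert (Hs : (rho < s)%R) by (unfold s; nra).
  intros k. induction k as [k IH] using (well_founded_induction Wf_nat.lt_wf).
  destruct k as [|m].
  - unfold recip. simpl. rewrite Cmod_inv by exact H0. fold A. lra.
  - rewrite recip_S, Cmod_mult, Cmod_opp, Cmod_inv by exact H0. fold A.
    set (B := (M * rho * (A * s ^ m))%R).
    assert (HB : (0 <= B)%R).
    { unfold B. apply Rmult_le_pos; [nra|]. apply Rmult_le_pos; [lra|apply pow_le; lra]. }
    apply Rle_trans with (A * (B / (1 - rho / s)))%R.
    + apply Rmult_le_compat_l; [lra|]. apply Cmod_csum_geom; [|intros j Hj|exact HB].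
      * split; [apply Rdiv_le_0_compat; lra|]. apply Rmult_lt_reg_r with s; [lra|]. field_simplify; lra.
      * rewrite Cmod_mult. specialize (IH (m - j)%nat ltac:(lia)).
        apply Rle_trans with ((M * rho ^ S j) * (A * s ^ (m - j)))%R.
        { apply Rmult_le_compat; auto using Cmod_ge_0. }
        right. unfold B, Rdiv. rewrite Rpow_mult_distr, pow_inv.
        replace (s ^ m)%R with (s ^ j * s ^ (m - j))%R by (rewrite <- pow_add; f_equal; lia).
        simpl. field. apply pow_nonzero. lra.
    + right. unfold B. replace (1 - rho / s)%R with (A * M * rho / s)%R by (unfold s; field; nra).
      simpl. field. lra.
Qed.

Lemma csum_0_from (c : nat -> C) n : (forall k, (0 < k)%nat -> c k = 0) -> csum c (S n) = c 0%nat.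
Proof.
  intros H. induction n as [|n IH]; [simpl; ring|].
  change (csum c (S (S n))) with (csum c (S n) + c (S n)). rewrite IH, (H (S n)) by lia. ring.
Qed.

Lemma analytic0_inv (F : C -> C) : analytic0 F -> F 0 <> 0 -> analytic0 (fun y => / F y).
Proof.
  intros [c [M0 [rho0 [Hr0 [Hc0 EF]]]]] HF.
  assert (P0 := pwr_bound_pos _ _ _ Hc0).
  assert (E0 : c 0%nat <> 0).
  { rewrite <- (psum_0 c M0 rho0 Hc0 Hr0), <- EF; [exact HF|]. rewrite Cmod_0. lra. }
  set (A := (/ Cmod (c 0%nat))%R).
  assert (HA : (0 < A)%R) by (apply Rinv_0_lt_compat, Cmod_gt_0, E0).
  (* [psum_conv] asks for one bound valid for both series, so [M] and [s] dominate [c] and its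
     reciprocal at once. *)
  set (M := (M0 + 1 + A)%R).
  set (s := (rho0 * (1 + A * (M0 + 1)))%R).
  assert (HAM : (0 < A * (M0 + 1))%R) by (apply Rmult_lt_0_compat; lra).
  assert (Hs : (rho0 < s)%R) by (unfold s; nra).
  assert (Hc : pwr_bound c M s) by (apply (pwr_bound_mono _ M0 rho0); [auto|unfold M; lra|lra]).
  assert (Hd : pwr_bound (recip c) M s).
  { apply (pwr_bound_mono _ A s); [|unfold M; lra|lra].
    apply recip_pwr_bound; [|lra|lra|exact E0].
    apply (pwr_bound_mono _ M0 rho0); [auto|lra|lra]. }
  exists (recip c), M, (2 * s)%R. split; [lra|]. split; [apply (pwr_bound_mono _ M s); [auto|lra|lra]|].
  intros y Hy. assert (Py := Cmod_ge_0 y).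
  assert (Pr := psum_conv c (recip c) M s y Hc Hd ltac:(lra) Hy).
  assert (One : psum (conv c (recip c)) y = 1).
  { apply (cseries_unique (fun k => conv c (recip c) k * y ^ k)).
    - apply (psum_spec _ (M * M) (2 * s)); [apply conv_pwr_bound; auto; lra|lra|exact Hy].
    - intros eps He. exists 1%nat. intros [|n] Hn; [lia|].
      rewrite csum_0_from.
      + rewrite conv_recip by exact E0. simpl. replace (1 * 1 - 1) with (RtoC 0) by ring. rewrite Cmod_0. exact He.
      + intros [|k] Hk; [lia|]. rewrite conv_recip by exact E0. ring. }
  rewrite One in Pr. rewrite EF.
  - assert (N : psum c y <> 0). { intros E. apply C1_nz. rewrite Pr, E. ring. }
    replace (psum (recip c) y) with (/ psum c y * (psum c y * psum (recip c) y)) by (field; exact N).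
    rewrite <- Pr. ring.
  - apply Rle_lt_trans with (2 * s * Cmod y)%R; [apply Rmult_le_compat_r; lra|exact Hy].
Qed.

(** * Infinite products as power series *)

Fixpoint prod_coef (U : nat -> C) (e : nat -> nat) (n k : nat) : C :=
  match n with
  | O => match k with O => 1 | S _ => 0 end
  | S m => prod_coef U e m k - (if (e m <=? k)%nat then U m * prod_coef U e m (k - e m)%nat else 0)
  end.

Fixpoint prod_part (U : nat -> C) (e : nat -> nat) (y : C) (n : nat) : C :=
  match n with O => 1 | S m => prod_part U e y m * (1 - U m * y ^ e m) end.

Lemma cseries_delay a l e : cseries a l -> cseries (fun k => if (e <=? k)%nat then a (k - e)%nat else 0) l.
Proof.
  intros H. induction e as [|e IH].
  - eapply cseries_ext; [|exact H]. intros k. rewrite Nat.sub_0_r. reflexivity.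
  - replace l with (0 + l) by ring.
    apply (cseries_first (fun k => if (S e <=? k)%nat then a (k - S e)%nat else 0)).
    eapply cseries_ext; [|exact IH]. intros k. reflexivity.
Qed.

Lemma prod_coef_cseries U e n y : cseries (fun k => prod_coef U e n k * y ^ k) (prod_part U e y n).
Proof.
  induction n as [|n IH].
  - cbn [prod_part]. intros eps He. exists 1%nat. intros [|m] Hm; [lia|].
    rewrite csum_0_from.
    + simpl. replace (1 * 1 - 1) with (RtoC 0) by ring. rewrite Cmod_0. exact He.
    + intros [|k] Hk; [lia|]. simpl. ring.
  - cbn [prod_part].
    replace (prod_part U e y n * (1 - U n * y ^ e n)) with
      (prod_part U e y n + (- U n * y ^ e n) * prod_part U e y n) by ring.
    eapply cseries_ext; [|apply (cseries_plus _ _ _ _ IH (cseries_scal (- U n * y ^ e n) _ _ (cseries_delay _ _ (e n) IH)))].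
    intros k. cbn [prod_coef]. destruct (Nat.leb_spec (e n) k) as [L|L]; [|ring].
    replace (y ^ k) with (y ^ e n * y ^ (k - e n)); [ring|].
    rewrite <- Cpow_add_r. f_equal. lia.
Qed.

(** Since e n >= n, the n-th factor multiplies the weighted bound by at most 1 + t^n <= exp(t^n).
    The exponents add up to (1 - t^n) / (1 - t) <= 1 / (1 - t), hence a bound uniform in the number
    of factors. *)
Lemma prod_coef_bound U e t n k : (forall m, (Cmod (U m) <= 1)%R) -> (forall m, (m <= e m)%nat) -> (0 < t < 1)%R ->
  (Cmod (prod_coef U e n k) * t ^ k <= exp ((1 - t ^ n) / (1 - t)))%R.
Proof.
  intros HU He Ht. revert k. induction n as [|n IH]; intros k.
  - replace ((1 - t ^ 0) / (1 - t))%R with 0%R by (simpl; field; lra). rewrite exp_0.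
    destruct k as [|k]; simpl; [rewrite Cmod_1; lra|]. rewrite Cmod_0. lra.
  - cbn [prod_coef]. set (B := exp ((1 - t ^ n) / (1 - t))) in *.
    assert (PB : (0 < B)%R) by apply exp_pos.
    assert (Pk : (0 <= t ^ k)%R) by (apply pow_le; lra).
    assert (S1 : (Cmod (if (e n <=? k)%nat then U n * prod_coef U e n (k - e n)%nat else 0) * t ^ k <= t ^ n * B)%R).
    { destruct (Nat.leb_spec (e n) k) as [L|L].
      - rewrite Cmod_mult. replace (t ^ k)%R with (t ^ e n * t ^ (k - e n))%R by (rewrite <- pow_add; f_equal; lia).
        assert (T1 : (t ^ e n <= t ^ n)%R).
        { replace (e n) with (n + (e n - n))%nat by (specialize (He n); lia). rewrite pow_add.
          assert (t ^ (e n - n) <= 1)%R by (rewrite <- (pow1 (e n - n)); apply pow_incr; lra).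
          assert (0 <= t ^ n)%R by (apply pow_le; lra). nra. }
        assert (T2 := IH (k - e n)%nat).
        assert (P1 : (0 <= t ^ e n)%R) by (apply pow_le; lra).
        assert (P2 : (0 <= Cmod (prod_coef U e n (k - e n)) * t ^ (k - e n))%R)
          by (apply Rmult_le_pos; [apply Cmod_ge_0|apply pow_le; lra]).
        assert (P3 := Cmod_ge_0 (U n)). specialize (HU n).
        replace (Cmod (U n) * Cmod (prod_coef U e n (k - e n)) * (t ^ e n * t ^ (k - e n)))%R with
          ((Cmod (U n) * t ^ e n) * (Cmod (prod_coef U e n (k - e n)) * t ^ (k - e n)))%R by ring.
        apply Rmult_le_compat; auto.
        + apply Rmult_le_pos; lra.
        + apply Rle_trans with (1 * t ^ e n)%R; [apply Rmult_le_compat_r; lra|lra].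
      - rewrite Cmod_0. assert (0 <= t ^ n * B)%R by (apply Rmult_le_pos; [apply pow_le|]; lra). lra. }
    apply Rle_trans with (B * (1 + t ^ n))%R.
    + assert (T := Cmod_minus_tri (prod_coef U e n k)
        (if (e n <=? k)%nat then U n * prod_coef U e n (k - e n)%nat else 0)).
      assert (T' := Rmult_le_compat_r _ _ _ Pk T). specialize (IH k). lra.
    + replace ((1 - t ^ S n) / (1 - t))%R with ((1 - t ^ n) / (1 - t) + t ^ n)%R by (simpl; field; lra).
      rewrite exp_plus. fold B. apply Rmult_le_compat_l; [lra|].
      apply exp_ineq1_le.
Qed.

Lemma prod_coef_stable U e n k : (forall m, (m <= e m)%nat) -> (k < n)%nat -> prod_coef U e n k = prod_coef U e (S k) k.
Proof.
  intros He Hk. induction n as [|n IH]; [lia|].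
  destruct (Nat.eq_dec n k) as [->|Hne]; [reflexivity|].
  rewrite <- IH by lia. cbn [prod_coef].
  rewrite (proj2 (Nat.leb_gt (e n) k)) by (specialize (He n); lia). ring.
Qed.

(* The coefficient of [y ^ k] in the partial products is constant from the [k + 1]-st factor on,
   which gives the coefficients of the infinite product. *)
Lemma infinite_product_psum U e : (forall m, (Cmod (U m) <= 1)%R) -> (forall m, (m <= e m)%nat) ->
  exists c, (forall t, (0 < t < 1)%R -> exists M, pwr_bound c M (/ t)) /\
    forall y, (Cmod y < 1)%R -> climit (prod_part U e y) (psum c y).
Proof.
  intros HU He. set (c := fun k => prod_coef U e (S k) k).
  assert (Bd : forall t n k, (0 < t < 1)%R -> (Cmod (prod_coef U e n k) <= exp (/ (1 - t)) * (/ t) ^ k)%R).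
  { intros t n k Ht. assert (B := prod_coef_bound U e t n k HU He Ht).
    assert (Pk : (0 < t ^ k)%R) by (apply pow_lt; lra).
    rewrite pow_inv. apply Rmult_le_reg_r with (t ^ k)%R; [exact Pk|].
    rewrite Rmult_assoc, Rinv_l, Rmult_1_r by lra. eapply Rle_trans; [exact B|].
    assert (Hn : (0 <= t ^ n)%R) by (apply pow_le; lra).
    assert (Le : ((1 - t ^ n) / (1 - t) <= / (1 - t))%R).
    { unfold Rdiv. rewrite <- (Rmult_1_l (/ (1 - t))) at 2. apply Rmult_le_compat_r; [|lra].
      apply Rlt_le, Rinv_0_lt_compat. lra. }
    destruct Le as [Le|Le]; [apply Rlt_le, exp_increasing, Le|rewrite Le; lra]. }
  exists c. split.
  - intros t Ht. exists (exp (/ (1 - t))). intros k. apply Bd, Ht.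
  - intros y Hy. assert (Py := Cmod_ge_0 y).
    set (t := ((Cmod y + 1) / 2)%R). assert (Ht : (0 < t < 1)%R) by (unfold t; lra).
    set (B := exp (/ (1 - t))). set (th := (/ t * Cmod y)%R).
    assert (Hth : (0 <= th < 1)%R).
    { unfold th. split; [apply Rmult_le_pos; [apply Rlt_le, Rinv_0_lt_compat; lra|lra]|].
      apply Rmult_lt_reg_l with t; [lra|]. rewrite <- Rmult_assoc, Rinv_r by lra. unfold t. lra. }
    apply (climit_geom _ _ (2 * B / (1 - th))%R th Hth). intros n.
    assert (S1 := prod_coef_cseries U e n y).
    assert (S2 : cseries (fun k => c k * y ^ k) (psum c y)).
    { apply (psum_spec c B (/ t)); [intros k; apply Bd, Ht|apply Rinv_0_lt_compat; lra|apply Hth]. }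
    assert (S3 := cseries_plus _ _ _ _ S1 (cseries_scal (-1) _ _ S2)).
    set (a := fun k => prod_coef U e n k * y ^ k + -1 * (c k * y ^ k)) in S3.
    (* The first [n] coefficients of the n-th partial product are already final, so the difference
       from the limit series is a tail starting at [n]. *)
    assert (Tail := cseries_geom_tail a (2 * B)%R th (prod_part U e y n + -1 * psum c y) n Hth).
    replace (prod_part U e y n - psum c y) with (prod_part U e y n + -1 * psum c y - csum a n).
    + apply Tail; [|exact S3]. intros k. unfold a, th. rewrite Rpow_mult_distr, <- Cmod_pow.
      replace (prod_coef U e n k * y ^ k + -1 * (c k * y ^ k)) with ((prod_coef U e n k - c k) * y ^ k) by ring.
      rewrite Cmod_mult, <- Rmult_assoc. apply Rmult_le_compat_r; [apply Cmod_ge_0|].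
      eapply Rle_trans; [apply Cmod_minus_tri|].
      assert (B1 := Bd t n k Ht). assert (B2 := Bd t (S k) k Ht). fold B in B1, B2. unfold c. lra.
    + assert (Z : csum a n = 0).
      { rewrite (csum_ext a (fun _ => 0 * 0)); [rewrite csum_scal; ring|].
        intros k Hk. unfold a, c. rewrite (prod_coef_stable U e n k He Hk). ring. }
      rewrite Z. ring.
Qed.

(** Both arguments depend on [y], out of reach of Euler's series at fixed base; the k-th factor is 1
    - u v^(r + N k) y^(s (r + N k)). At the cusps [u] and [v] are roots of unity and v y^s is e(T /
    N); u = v = 1 and s = 1 give (q^r; q^N)_oo as a function of q. *)
Lemma qpoch_inf_psum u v s r N : (Cmod u <= 1)%R -> (Cmod v <= 1)%R -> (0 < s)%nat -> (0 < N)%nat ->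
  exists c, (forall t, (0 < t < 1)%R -> exists M, pwr_bound c M (/ t)) /\
    forall y, (Cmod y < 1)%R -> qpoch_inf (u * (v * y ^ s) ^ r) ((v * y ^ s) ^ N) = psum c y.
Proof.
  intros Hu Hv Hs HN.
  destruct (infinite_product_psum (fun k => u * v ^ (r + N * k)) (fun k => (s * (r + N * k))%nat)) as [c [Hc Hl]].
  - intros m. rewrite Cmod_mult, Cmod_pow.
    assert (Cmod v ^ (r + N * m) <= 1)%R.
    { rewrite <- (pow1 (r + N * m)). apply pow_incr. split; [apply Cmod_ge_0|exact Hv]. }
    assert (0 <= Cmod v ^ (r + N * m))%R by (apply pow_le, Cmod_ge_0).
    assert (P := Cmod_ge_0 u). rewrite <- (Rmult_1_l 1). apply Rmult_le_compat; auto.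
  - intros m. assert (m <= r + N * m)%nat by nia. destruct s as [|s]; [lia|]. cbn [Nat.mul]. lia.
  - exists c. split; [exact Hc|]. intros y Hy. apply qpoch_inf_unique.
    eapply climit_ext; [|apply (Hl y Hy)]. intros n. induction n as [|n IH]; [reflexivity|].
    cbn [prod_part qpoch_part]. rewrite IH, cpow_Cpow. set (x := v * y ^ s).
    assert (E : x ^ r * (x ^ N) ^ n = v ^ (r + N * n) * y ^ (s * (r + N * n))).
    { rewrite <- (Cpow_mult_r x), <- (Cpow_add_r x). unfold x. rewrite Cpow_mult_l, <- (Cpow_mult_r y). reflexivity. }
    replace (u * v ^ (r + N * n) * y ^ (s * (r + N * n))) with (u * (x ^ r * (x ^ N) ^ n)) by (rewrite E; ring).
    ring.
Qed.

Lemma qpoch_inf_analytic0 u v s r N : (Cmod u <= 1)%R -> (Cmod v <= 1)%R -> (0 < s)%nat -> (0 < N)%nat ->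
  analytic0 (fun y => qpoch_inf (u * (v * y ^ s) ^ r) ((v * y ^ s) ^ N)).
Proof.
  intros Hu Hv Hs HN. destruct (qpoch_inf_psum u v s r N Hu Hv Hs HN) as [c [Hc E]].
  destruct (Hc (1 / 2)%R ltac:(lra)) as [M HM]. exists c, M, (/ (1 / 2))%R.
  split; [lra|]. split; [exact HM|]. intros y Hy. apply E. assert (P := Cmod_ge_0 y). lra.
Qed.

(** At y = 0 every factor becomes 1, except the one with exponent 0, which occurs only for r = 0. *)
Lemma qpoch_inf_value_0 u v s r N : (0 < s)%nat -> (0 < N)%nat ->
  qpoch_inf (u * (v * 0 ^ s) ^ r) ((v * 0 ^ s) ^ N) = match r with O => 1 - u | S _ => 1 end.
Proof.
  intros Hs HN. destruct s as [|s]; [lia|]. destruct N as [|N]; [lia|].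
  replace (v * 0 ^ S s) with (RtoC 0) by (simpl; ring). replace ((RtoC 0) ^ S N) with (RtoC 0) by (simpl; ring).
  assert (H0 : (Cmod 0 < 1)%R) by (rewrite Cmod_0; lra).
  assert (E : qpoch_inf 0 0 = 1) by (rewrite qpoch_inf_euler by exact H0; apply euler_0, H0).
  destruct r as [|r].
  - rewrite qpoch_inf_step by exact H0. replace (0 * (u * 0 ^ 0)) with (RtoC 0) by ring. rewrite E. simpl. ring.
  - replace (u * 0 ^ S r) with (RtoC 0) by (simpl; ring). exact E.
Qed.

Lemma qpoch_inf_nome_sderiv r N tau : (0 < N)%nat -> upper tau ->
  exists l, sderiv (fun w => qpoch_inf (ee w ^ r) (ee w ^ N)) tau l.
Proof.
  intros HN Ht. assert (Hq := Cmod_ee_lt tau Ht). assert (Pq := Cmod_ge_0 (ee tau)).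
  destruct (qpoch_inf_psum 1 1 1 r N) as [c [Hc E]]; try (rewrite Cmod_1; lra); try lia.
  set (t := ((Cmod (ee tau) + 1) / 2)%R).
  destruct (Hc t ltac:(unfold t; lra)) as [M HM].
  destruct (psum_sderiv c M (/ t) (ee tau) HM) as [l [_ Hl]].
  { apply Rinv_0_lt_compat. unfold t. lra. }
  { apply Rmult_lt_reg_l with t; [unfold t; lra|]. rewrite <- Rmult_assoc, Rinv_r by (unfold t; lra). unfold t. lra. }
  assert (D := sderiv_comp (psum c) ee tau _ _ (ee_sderiv tau) Hl).
  exists (l * (ee tau * (RtoC (2 * PI) * Ci))).
  apply (sderiv_ext_loc (fun w => psum c (ee w)) _ _ _ (Im tau) Ht); [|exact D].
  intros w Hw. rewrite <- E.
  - replace (1 * ee w ^ 1) with (ee w) by (simpl; ring). f_equal. ring.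
  - apply Cmod_ee_lt. unfold upper. assert (K := im_le_Cmod (w - tau)).
    change (Im (w - tau)) with (Im w - Im tau)%R in K.
    assert (K' := Rle_abs (- (Im w - Im tau))). rewrite Rabs_Ropp in K'. lra.
Qed.

(** * Theta quotients at the cusps *)

Definition zc (n : Z) : C := RtoC (IZR n).

Lemma zc_plus m n : zc (m + n) = zc m + zc n.
Proof. unfold zc. rewrite plus_IZR, RtoC_plus. reflexivity. Qed.

Lemma zc_mult m n : zc (m * n) = zc m * zc n.
Proof. unfold zc. rewrite mult_IZR, RtoC_mult. reflexivity. Qed.

Lemma zc_opp n : zc (- n) = - zc n.
Proof. unfold zc. rewrite opp_IZR, RtoC_opp. reflexivity. Qed.

Lemma zc_minus m n : zc (m - n) = zc m - zc n.
Proof. unfold zc. rewrite minus_IZR, RtoC_minus. reflexivity. Qed.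

Lemma zc_inj m n : zc m = zc n -> m = n.
Proof. intros H. injection H. apply eq_IZR. Qed.

Lemma zc_neq_0 n : n <> 0%Z -> zc n <> 0.
Proof. intros H E. apply H, (zc_inj n 0), E. Qed.

Lemma ee_zc n : ee (zc n) = 1.
Proof. apply ee_Z. Qed.

Lemma ee_pow_zc z n : (0 <= n)%Z -> ee z ^ Z.to_nat n = ee (zc n * z).
Proof.
  intros H. rewrite ee_pow. unfold zc. rewrite INR_IZR_INZ, Z2Nat.id by exact H. reflexivity.
Qed.

Lemma Cmod_ee_real z : Im z = 0%R -> Cmod (ee z) = 1%R.
Proof. intros H. rewrite Cmod_ee, H. replace (- (2 * PI * 0))%R with 0%R by ring. apply exp_0. Qed.

Lemma Im_zc_div m n : Im (zc m / zc n) = 0%R.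
Proof.
  unfold zc. destruct (Req_dec (IZR n) 0) as [E|E].
  - rewrite E. unfold Im, Cdiv, Cinv, Cmult, RtoC. simpl. unfold Rdiv. ring.
  - rewrite <- RtoC_div by exact E. reflexivity.
Qed.

(** The action of the upper triangular matrix with rows (A, B) and (0, D). *)
Definition affine (A B D : Z) (tau : C) : C := (zc A * tau + zc B) / zc D.

Lemma affine_upper A B D tau : (0 < A)%Z -> (0 < D)%Z -> upper tau -> upper (affine A B D tau).
Proof.
  intros HA HD H. unfold upper, affine, zc in *. apply IZR_lt in HA. apply IZR_lt in HD.
  unfold Cdiv. rewrite <- RtoC_inv by lra.
  replace (Im _) with (IZR A * Im tau * / IZR D)%R.
  - apply Rmult_lt_0_compat; [apply Rmult_lt_0_compat; lra|apply Rinv_0_lt_compat; lra].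
  - unfold Im, RtoC, Cplus, Cmult. simpl. ring.
Qed.

Lemma upper_zc N tau : (0 < N)%Z -> upper tau -> upper (zc N * tau).
Proof.
  intros HN H. assert (K := affine_upper N 0 1 tau HN ltac:(lia) H). unfold affine in K.
  replace ((zc N * tau + zc 0) / zc 1) with (zc N * tau) in K by (unfold zc; field). exact K.
Qed.

Definition thetaq (N g h : Z) (tau : C) : C :=
  ee ((zc g * zc g - zc h * zc h) * tau / (2 * zc N)) *
  (theta (zc g * tau) (zc N * tau) / theta (zc h * tau) (zc N * tau)).

(** If g (a T + b) / N were a lattice point, N would divide g a and g b, hence g (a d - b c) = g. *)
Lemma not_lattice N g a b c d T : SL2Z a b c d -> (0 < N)%Z -> ~ (N | g)%Z -> upper T ->
  ~ lattice T (zc g * (zc a * T + zc b) / zc N).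
Proof.
  intros HS HN Hg HT [m [n E]]. apply Hg. fold (zc m) (zc n) in E.
  assert (NN : zc N <> 0) by (apply zc_neq_0; lia).
  assert (E' : zc (g * a - n * N) * T + zc (g * b - m * N) = 0).
  { rewrite !zc_minus, !zc_mult.
    replace ((zc g * zc a - zc n * zc N) * T + (zc g * zc b - zc m * zc N)) with
      (zc N * (zc g * (zc a * T + zc b) / zc N) - zc N * (zc m + zc n * T)) by (field; exact NN).
    rewrite E. ring. }
  assert (E1 := f_equal Im E'). assert (E2 := f_equal Re E').
  unfold zc, Re, Im, RtoC, Cplus, Cmult in E1, E2. simpl in E1, E2. unfold upper, Im in HT.
  assert (X : IZR (g * a - n * N) = 0%R) by nra. rewrite X in E2.
  assert (Y : IZR (g * b - m * N) = 0%R) by lra. apply eq_IZR in X. apply eq_IZR in Y.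
  exists (n * d - m * c)%Z. unfold SL2Z in HS.
  replace g with (g * (a * d - b * c))%Z by (rewrite HS; ring).
  replace (g * (a * d - b * c))%Z with ((g * a) * d - (g * b) * c)%Z by ring.
  replace (g * a)%Z with (n * N)%Z by lia. replace (g * b)%Z with (m * N)%Z by lia. ring.
Qed.

(** The four integer equations say diag(N, 1) gamma = gamma' (A, B; 0, D), so that N gamma tau =
    gamma' T = w / j. The factors e(c' z^2 / (2 j)) from [theta_modular] merge with the prefactor
    into the exponent (g^2 - h^2) w (1 + c' w) / (2 N^2 j), and 1 + c' w = a' j removes [j]. *)
Lemma thetaq_transform N g h a b c d a' b' c' d' A B D tau :
  (0 < N)%Z -> ~ (N | h)%Z -> SL2Z a b c d -> SL2Z a' b' c' d' -> (0 < A)%Z -> (0 < D)%Z ->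
  (N * a = a' * A)%Z -> (N * b = a' * B + b' * D)%Z -> (c = c' * A)%Z -> (d = c' * B + d' * D)%Z ->
  upper tau ->
  let T := affine A B D tau in let w := zc a' * T + zc b' in
  thetaq N g h (mob a b c d tau) =
  ee ((zc g * zc g - zc h * zc h) * (zc a' * w) / (2 * (zc N * zc N))) *
  (theta (zc g * w / zc N) T / theta (zc h * w / zc N) T).
Proof.
  intros HN Hh HS HS' HA HD E1 E2 E3 E4 Ht T w.
  assert (HT : upper T) by (apply affine_upper; assumption).
  assert (NN : zc N <> 0) by (apply zc_neq_0; lia).
  assert (ND : zc D <> 0) by (apply zc_neq_0; lia).
  assert (Nj := autj_nz a b c d tau HS Ht).
  set (j := autj c' d' T).
  assert (Nj' : j <> 0) by (exact (autj_nz a' b' c' d' T HS' HT)).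
  assert (Ej : autj c d tau = zc D * j).
  { unfold j, autj, T, affine. fold (zc c) (zc d) (zc c') (zc d'). rewrite E3, E4, !zc_plus, !zc_mult. field. exact ND. }
  assert (Ew : zc N * (zc a * tau + zc b) = zc D * w).
  { unfold w, T, affine. rewrite Cmult_plus_distr_l, Cmult_assoc, <- !zc_mult, E1, E2, zc_plus, !zc_mult. field. exact ND. }
  assert (Em : mob a b c d tau = w / (zc N * j)).
  { unfold mob. fold (zc a) (zc b). fold (autj c d tau). rewrite Ej.
    replace (zc a * tau + zc b) with (zc D * w / zc N) by (rewrite <- Ew; field; exact NN).
    field. repeat split; assumption. }
  assert (ES : mob a' b' c' d' T = w / j) by reflexivity.
  destruct (theta_modular a' b' c' d' T HS' HT) as [u [Hu K]]. fold j in K. rewrite ES in K.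
  fold (zc c') in K.
  unfold thetaq. rewrite Em.
  replace (zc N * (w / (zc N * j))) with (w / j) by (field; auto).
  replace (zc g * (w / (zc N * j))) with ((zc g * w / zc N) / j) by (field; auto).
  replace (zc h * (w / (zc N * j))) with ((zc h * w / zc N) / j) by (field; auto).
  rewrite !K.
  assert (Nh : theta (zc h * w / zc N) T <> 0).
  { intros E. apply theta_eq_0 in E; [|exact HT]. revert E. eapply not_lattice; eauto. }
  set (X := theta (zc g * w / zc N) T). set (Y := theta (zc h * w / zc N) T) in *.
  assert (Cw : zc c' * w = zc a' * j - 1).
  { assert (Dt := SL2Z_RtoC _ _ _ _ HS'). fold (zc a') (zc b') (zc c') (zc d') in Dt. rewrite <- Dt.
    unfold w, j, autj. fold (zc c') (zc d'). ring. }
  set (e0 := (zc g * zc g - zc h * zc h) * (w / (zc N * j)) / (2 * zc N)).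
  set (e1 := zc c' * (zc g * w / zc N * (zc g * w / zc N)) / (2 * j)).
  set (e2 := zc c' * (zc h * w / zc N * (zc h * w / zc N)) / (2 * j)).
  replace (ee e0 * (u * ee e1 * X / (u * ee e2 * Y))) with (ee (e0 + e1 - e2) * (X / Y)).
  - f_equal. f_equal. unfold e0, e1, e2.
    match goal with |- ?L = _ => replace L with
      ((zc g * zc g - zc h * zc h) * w * (1 + zc c' * w) / (2 * (zc N * zc N) * j)) by (field; auto) end.
    rewrite Cw. field. auto.
  - rewrite ee_minus, ee_plus. field. repeat split; auto using ee_nz.
Qed.

(** The column (N a, c) divided by its gcd [A] is primitive, and a Bezout relation completes it to
    gamma'. The inverse of gamma' applied to the column (N b, d) yields [B] and [D], with A D =
    N. *)
Lemma hermite_factor N a b c d : (0 < N)%Z -> SL2Z a b c d ->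
  exists a' b' c' d' A B D, SL2Z a' b' c' d' /\ (0 < A)%Z /\ (0 < D)%Z /\
    (N * a = a' * A)%Z /\ (N * b = a' * B + b' * D)%Z /\ (c = c' * A)%Z /\ (d = c' * B + d' * D)%Z.
Proof.
  intros HN HS. unfold SL2Z in *. set (A := Z.gcd (N * a) c).
  assert (HA : (0 < A)%Z).
  { assert (P := Z.gcd_nonneg (N * a) c). fold A in P.
    destruct (Z.eq_dec A 0) as [E|E]; [|lia]. exfalso.
    apply Z.gcd_eq_0 in E. destruct E as [E1 E2]. subst c. apply Z.mul_eq_0 in E1. destruct E1; [lia|]. subst a. lia. }
  destruct (Z.gcd_divide_l (N * a) c) as [a' Ha]. destruct (Z.gcd_divide_r (N * a) c) as [c' Hc].
  fold A in Ha, Hc.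
  destruct (Z.gcd_bezout (N * a) c A eq_refl) as [p [q Hpq]].
  assert (Hpq' : (p * (a' * A) + q * (c' * A) = A)%Z) by (rewrite <- Ha, <- Hc; exact Hpq).
  assert (Det : (a' * p + q * c' = 1)%Z) by (apply (Z.mul_reg_r _ _ A); lia).
  exists a', (- q)%Z, c', p, A, (p * (N * b) + q * d)%Z, (a' * d - c' * (N * b))%Z.
  assert (AD : (A * (a' * d - c' * (N * b)) = N)%Z).
  { replace (A * (a' * d - c' * (N * b)))%Z with ((a' * A) * d - (c' * A) * (N * b))%Z by ring.
    rewrite <- Ha, <- Hc. replace N with (N * (a * d - b * c))%Z at 3 by (rewrite HS; ring). ring. }
  repeat split.
  - lia.
  - exact HA.
  - nia.
  - exact Ha.
  - replace (N * b)%Z with ((a' * p + q * c') * (N * b))%Z at 1 by (rewrite Det; ring). ring.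
  - exact Hc.
  - replace d with ((a' * p + q * c') * d)%Z at 1 by (rewrite Det; ring). ring.
Qed.

(* Behaviour of [f] at [i oo] as a Laurent series in [ee (tau / H)] with nonzero leading coefficient. *)
Definition laurent (H : Z) (f : C -> C) : Prop :=
  exists (K : C) (m : Z) (F : C -> C), K <> 0 /\ F 0 <> 0 /\ analytic0 F /\
    forall tau, upper tau -> f tau = K * ee (zc m * tau / zc H) * F (ee (tau / zc H)).

Lemma analytic0_const_1 : analytic0 (fun _ => 1).
Proof.
  set (c := fun k => match k return C with O => 1 | S _ => 0 end).
  assert (B : pwr_bound c 1 1).
  { intros [|k]; simpl; [rewrite Cmod_1; lra|]. rewrite Cmod_0, pow1. lra. }
  exists c, 1%R, 1%R. split; [lra|]. split; [exact B|].
  intros y Hy. symmetry. apply (cseries_unique (fun k => c k * y ^ k)).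
  - apply (psum_spec c 1 1); auto. lra.
  - intros eps He. exists 1%nat. intros [|n] Hn; [lia|]. rewrite csum_0_from.
    + simpl. replace (1 * 1 - 1) with (RtoC 0) by ring. rewrite Cmod_0. exact He.
    + intros [|k] Hk; [lia|]. simpl. ring.
Qed.

Lemma laurent_exp H m k : laurent H (fun tau => ee (zc m * tau / zc H + k)).
Proof.
  exists (ee k), m, (fun _ => 1). repeat split; [apply ee_nz|apply C1_nz|apply analytic0_const_1|].
  intros tau _. rewrite ee_plus. ring.
Qed.

Lemma laurent_ext H f f' : (forall tau, upper tau -> f tau = f' tau) -> laurent H f -> laurent H f'.
Proof.
  intros E [K [m [F [H1 [H2 [H3 H4]]]]]]. exists K, m, F. repeat split; auto.
  intros tau Ht. rewrite <- E; auto.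
Qed.

Lemma laurent_mult H f f' : laurent H f -> laurent H f' -> laurent H (fun tau => f tau * f' tau).
Proof.
  intros [K [m [F [H1 [H2 [H3 H4]]]]]] [K' [m' [F' [H1' [H2' [H3' H4']]]]]].
  exists (K * K'), (m + m')%Z, (fun y => F y * F' y).
  repeat split; [apply Cmult_neq_0; auto|apply Cmult_neq_0; auto|apply analytic0_mult; auto|].
  intros tau Ht. rewrite H4, H4', zc_plus by exact Ht.
  replace ((zc m + zc m') * tau / zc H) with (zc m * tau / zc H + zc m' * tau / zc H) by (unfold Cdiv; ring).
  rewrite ee_plus. ring.
Qed.

Lemma laurent_inv H (f : C -> C) : (forall tau, upper tau -> f tau <> 0) -> laurent H f -> laurent H (fun tau => / f tau).
Proof.
  intros Hf [K [m [F [H1 [H2 [H3 H4]]]]]].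
  exists (/ K), (- m)%Z, (fun y => / F y).
  repeat split; [apply Cinv_neq_0; auto|apply Cinv_neq_0; auto|apply analytic0_inv; auto|].
  intros tau Ht. specialize (Hf tau Ht). rewrite H4 in Hf |- * by exact Ht.
  assert (NF : F (ee (tau / zc H)) <> 0). { intros E. apply Hf. rewrite E. ring. }
  rewrite zc_opp. replace (- zc m * tau / zc H) with (- (zc m * tau / zc H)) by (unfold Cdiv; ring).
  rewrite ee_opp. field. repeat split; auto using ee_nz.
Qed.

Lemma laurent_pow H f e : laurent H f -> laurent H (fun tau => cpow (f tau) e).
Proof.
  intros Hf. induction e as [|e IH]; cbn [cpow].
  - apply (laurent_ext H (fun tau => ee (zc 0 * tau / zc H + 0))); [|apply laurent_exp].
    intros tau _. replace (zc 0 * tau / zc H + 0) with (RtoC 0) by (unfold zc, Cdiv; ring). apply ee_0.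
  - apply laurent_mult; assumption.
Qed.

Lemma laurent_is_series H f : (0 < H)%Z -> laurent H f ->
  exists (n0 : Z) (coef : nat -> C) (M : R), forall tau, upper tau -> (M < Im tau)%R ->
    @is_series C_AbsRing C_NormedModule
      (fun k => coef k * qpow (IZR (Z.of_nat k + n0) / INR (Z.to_nat H))%R tau) (f tau).
Proof.
  intros HH [K [m [F [_ [_ [[c [B [rho [Hr [Hc E]]]]] Ef]]]]]].
  assert (NH : zc H <> 0) by (apply zc_neq_0; lia).
  assert (PH : (0 < IZR H)%R) by (apply IZR_lt, HH).
  assert (Ppi := PI_RGT_0).
  (* The threshold for Im tau is the height at which |e(tau / H)| = 1 / rho. *)
  exists m, (fun k => K * c k), (IZR H * ln rho / (2 * PI))%R. intros tau Ht HM.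
  rewrite Ef by exact Ht.
  set (y := ee (tau / zc H)).
  assert (Hy : (rho * Cmod y < 1)%R).
  { unfold y. rewrite Cmod_ee. rewrite <- (exp_ln rho Hr) at 1. rewrite <- exp_plus, <- exp_0.
    apply exp_increasing.
    replace (Im (tau / zc H)) with (Im tau / IZR H)%R.
    - assert (L : (ln rho < 2 * PI * (Im tau / IZR H))%R).
      { apply Rmult_lt_reg_r with (IZR H / (2 * PI))%R; [apply Rdiv_lt_0_compat; lra|].
        replace (2 * PI * (Im tau / IZR H) * (IZR H / (2 * PI)))%R with (Im tau) by (field; lra).
        eapply Rle_lt_trans; [|exact HM]. right. field. lra. }
      lra.
    - unfold Cdiv, zc. rewrite <- RtoC_inv by lra. unfold Im, RtoC, Cmult, Rdiv. simpl. ring. }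
  rewrite E by exact Hy. apply cseries_is_series.
  eapply cseries_ext; [|apply (cseries_scal (K * ee (zc m * tau / zc H)) _ _ (psum_spec c B rho y Hc Hr Hy))].
  intros k. cbv beta. unfold y. rewrite ee_pow, qpow_ee.
  replace (RtoC (IZR (Z.of_nat k + m) / INR (Z.to_nat H)) * tau) with
    (zc m * tau / zc H + RtoC (INR k) * (tau / zc H)).
  - rewrite ee_plus. ring.
  - rewrite (INR_IZR_INZ (Z.to_nat H)), Z2Nat.id, RtoC_div by (lia || lra).
    rewrite plus_IZR, RtoC_plus, <- INR_IZR_INZ. fold (zc m) (zc H). field. exact NH.
Qed.

(** Writing g a = N n + r and removing n T by quasi-periodicity leaves the argument z0 = (r T + g b)
    / N. With x = e(T / N) the two products then involve only the powers x^(r + N k) and x^(N - r +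
    N k), of nonnegative exponent. *)
Lemma theta_laurent N g a b c d A B D : SL2Z a b c d -> (0 < N)%Z -> ~ (N | g)%Z -> (0 < A)%Z -> (0 < D)%Z ->
  laurent (2 * N * N * D)
    (fun tau => theta (zc g * (zc a * affine A B D tau + zc b) / zc N) (affine A B D tau)).
Proof.
  intros HS HN Hg HA HD.
  set (n := (g * a / N)%Z). set (r := (g * a mod N)%Z).
  assert (Er : (g * a = N * n + r)%Z) by (apply Z.div_mod; lia).
  assert (Br : (0 <= r < N)%Z) by (apply Z.mod_pos_bound; exact HN).
  assert (NN : zc N <> 0) by (apply zc_neq_0; lia).
  assert (ND : zc D <> 0) by (apply zc_neq_0; lia).
  (* With y = e(tau / (2 N^2 D)) one has e(T / N) = v y^(2 N A). The denominator 2 N^2 D also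
     accommodates the prefactor of [thetaq]. *)
  set (s := Z.to_nat (2 * N * A)).
  set (u := ee (zc (g * b) / zc N)). set (v := ee (zc B / (zc N * zc D))).
  assert (Hu : Cmod u = 1%R) by (apply Cmod_ee_real, Im_zc_div).
  assert (Hv : Cmod v = 1%R) by (unfold v; rewrite <- zc_mult; apply Cmod_ee_real, Im_zc_div).
  assert (Hui : Cmod (/ u) = 1%R) by (rewrite Cmod_inv, Hu by apply ee_nz; lra).
  assert (Hs : (0 < s)%nat) by (unfold s; lia).
  assert (HN' : (0 < Z.to_nat N)%nat) by lia.
  set (P := fun (u : C) (r : Z) (y : C) => qpoch_inf (u * (v * y ^ s) ^ Z.to_nat r) ((v * y ^ s) ^ Z.to_nat N)).
  (* The quasi-period factor and e(- z0 / 2) together contribute T with coefficient - (N n^2 + 2 n r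
     + r) / (2 N); substituting T = (A tau + B) / D separates the constant from the power of [y]. *)
  exists (ee (zc n / 2 - (zc n + / 2) * (zc (g * b) / zc N)
             - zc (N * n * n + 2 * n * r + r) * zc B / (2 * zc N * zc D))),
    (- ((N * n * n + 2 * n * r + r) * A * N))%Z, (fun y => P u r y * P (/ u) (N - r)%Z y).
  split; [apply ee_nz|]. split; [|split].
  (* The value at 0 is 1 unless r = 0, when it is 1 - u; this vanishes only if N divides g b as well
     as g a, and then N divides g. *)
  - unfold P. rewrite !qpoch_inf_value_0 by assumption.
    destruct (Z.to_nat (N - r)) as [|k] eqn:Ek; [lia|].
    destruct (Z.to_nat r) as [|k'] eqn:Ek'.
    2:{ intros E. apply C1_nz. rewrite <- E. ring. }
    intros E. assert (r0 : r = 0%Z) by lia.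
    assert (Eu : u = 1). { symmetry. apply Ceq_minus. rewrite <- E. ring. }
    destruct (ee_eq_1 _ Eu) as [m Hm]. fold (zc m) in Hm.
    assert (Em : (g * b = m * N)%Z).
    { apply zc_inj. rewrite (zc_mult m). rewrite <- Hm. field. exact NN. }
    apply Hg. exists (n * d - m * c)%Z. unfold SL2Z in HS.
    replace g with (g * (a * d - b * c))%Z by (rewrite HS; ring).
    replace (g * (a * d - b * c))%Z with ((g * a) * d - (g * b) * c)%Z by ring.
    rewrite Er, Em, r0. ring.
  - apply analytic0_mult; apply qpoch_inf_analytic0; auto; lra.
  - intros tau Ht. set (T := affine A B D tau).
    assert (HT : upper T) by (apply affine_upper; assumption).
    set (z0 := (zc r * T + zc (g * b)) / zc N).
    replace (zc g * (zc a * T + zc b) / zc N) with (z0 + RtoC (IZR 0) + RtoC (IZR n) * T).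
    2:{ fold (zc n). unfold z0. replace (zc g * (zc a * T + zc b)) with (zc (g * a) * T + zc (g * b))
          by (rewrite !zc_mult; ring). rewrite Er, zc_plus, !zc_mult. field. exact NN. }
    rewrite theta_lattice by exact HT. fold (zc n).
    set (y := ee (tau / zc (2 * N * N * D))).
    assert (N2 : RtoC 2 <> 0) by (intros Z; injection Z; lra).
    assert (Ex : v * y ^ s = ee (T / zc N)).
    { unfold y, s. rewrite ee_pow_zc by lia. unfold v. rewrite <- ee_plus. f_equal.
      unfold T, affine. rewrite !zc_mult. change (zc 2) with (RtoC 2). field. auto. }
    unfold theta, P. rewrite Ex, !ee_pow_zc by lia.
    replace (u * ee (zc r * (T / zc N))) with (ee z0).
    2:{ unfold u. rewrite <- ee_plus. f_equal. unfold z0. field. exact NN. }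
    replace (/ u * ee (zc (N - r) * (T / zc N))) with (ee (T - z0)).
    2:{ unfold u. rewrite <- ee_opp, <- ee_plus. f_equal. unfold z0. rewrite zc_minus. field. exact NN. }
    replace (ee (zc N * (T / zc N))) with (ee T) by (f_equal; field; exact NN).
    match goal with |- ee ?e1 * (ee ?e2 * ?X * ?Y) = ee ?e3 * ee ?e4 * _ =>
      replace (ee e1 * (ee e2 * X * Y)) with (ee (e1 + e2) * (X * Y)) by (rewrite ee_plus; ring);
      rewrite <- (ee_plus e3 e4) end.
    f_equal. f_equal. unfold z0, T, affine.
    rewrite zc_opp, !zc_mult, !zc_plus, !zc_mult. change (zc 2) with (RtoC 2). field. auto.
Qed.

(** * Holomorphy on the upper half-plane and invariance under Gamma_1(N) *)

Lemma sderiv_upper_ext f f' z l : upper z -> (forall w, upper w -> f w = f' w) -> sderiv f z l -> sderiv f' z l.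
Proof.
  intros Hz E. apply (sderiv_ext_loc f f' z l (Im z) Hz). intros w Hw. apply E. unfold upper.
  assert (K := im_le_Cmod (w - z)). change (Im (w - z)) with (Im w - Im z)%R in K.
  assert (K' := Rle_abs (- (Im w - Im z))). rewrite Rabs_Ropp in K'. lra.
Qed.

Lemma theta_nome N g tau : (0 < g < N)%Z ->
  theta (zc g * tau) (zc N * tau) = ee (- zc g / 2 * tau) *
    qpoch_inf (ee tau ^ Z.to_nat g) (ee tau ^ Z.to_nat N) *
    qpoch_inf (ee tau ^ Z.to_nat (N - g)) (ee tau ^ Z.to_nat N).
Proof.
  intros Hg. unfold theta. rewrite !ee_pow_zc, zc_minus by lia.
  replace (- zc g / 2 * tau) with (- (zc g * tau) / 2) by field.
  replace ((zc N - zc g) * tau) with (zc N * tau - zc g * tau) by ring. reflexivity.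
Qed.

Lemma theta_nome_sderiv N g tau : (0 < g < N)%Z -> upper tau ->
  exists l, sderiv (fun w => theta (zc g * w) (zc N * w)) tau l.
Proof.
  intros Hg Ht.
  destruct (qpoch_inf_nome_sderiv (Z.to_nat g) (Z.to_nat N) tau ltac:(lia) Ht) as [l1 H1].
  destruct (qpoch_inf_nome_sderiv (Z.to_nat (N - g)) (Z.to_nat N) tau ltac:(lia) Ht) as [l2 H2].
  eexists. eapply sderiv_ext; [|apply (sderiv_mult (fun w => ee (- zc g / 2 * w + 0) *
     qpoch_inf (ee w ^ Z.to_nat g) (ee w ^ Z.to_nat N))
     (fun w => qpoch_inf (ee w ^ Z.to_nat (N - g)) (ee w ^ Z.to_nat N)))].
  - intros w. rewrite theta_nome by exact Hg. rewrite Cplus_0_r. reflexivity.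
  - apply (sderiv_mult (fun w => ee (- zc g / 2 * w + 0))
      (fun w => qpoch_inf (ee w ^ Z.to_nat g) (ee w ^ Z.to_nat N))); [|exact H1].
    apply (sderiv_comp ee (fun w => - zc g / 2 * w + 0)); [apply sderiv_affine|apply ee_sderiv].
  - exact H2.
Qed.

Lemma theta_nome_neq_0 N g tau : (0 < g < N)%Z -> upper tau -> theta (zc g * tau) (zc N * tau) <> 0.
Proof.
  intros Hg Ht E. assert (HT := upper_zc N tau ltac:(lia) Ht).
  apply theta_eq_0 in E; [|exact HT].
  assert (NN : zc N <> 0) by (apply zc_neq_0; lia).
  apply (not_lattice N g 1 0 0 1 (zc N * tau)); auto; [reflexivity|lia| |].
  - intros D. apply Z.divide_pos_le in D; lia.
  - change (zc 1) with (RtoC 1). change (zc 0) with (RtoC 0).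
    replace (zc g * (1 * (zc N * tau) + 0) / zc N) with (zc g * tau) by (field; exact NN). exact E.
Qed.

Lemma thetaq_sderiv N g h tau : (0 < g < N)%Z -> (0 < h < N)%Z -> upper tau ->
  exists l, sderiv (thetaq N g h) tau l.
Proof.
  intros Hg Hh Ht. assert (NN : zc N <> 0) by (apply zc_neq_0; lia).
  assert (N2 : RtoC 2 <> 0) by (intros Z; injection Z; lra).
  destruct (theta_nome_sderiv N g tau Hg Ht) as [l1 H1]. destruct (theta_nome_sderiv N h tau Hh Ht) as [l2 H2].
  eexists. unfold thetaq.
  apply (sderiv_mult (fun w => ee ((zc g * zc g - zc h * zc h) * w / (2 * zc N)))
    (fun w => theta (zc g * w) (zc N * w) / theta (zc h * w) (zc N * w))).
  - apply (sderiv_comp ee (fun w => (zc g * zc g - zc h * zc h) * w / (2 * zc N))); [|apply ee_sderiv].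
    apply (sderiv_ext (fun w => (zc g * zc g - zc h * zc h) / (2 * zc N) * w + 0)); [|apply sderiv_affine].
    intros w. field. auto.
  - apply (sderiv_mult (fun w => theta (zc g * w) (zc N * w)) (fun w => / theta (zc h * w) (zc N * w))); [exact H1|].
    apply (sderiv_comp Cinv (fun w => theta (zc h * w) (zc N * w))); [exact H2|].
    apply sderiv_inv, theta_nome_neq_0; assumption.
Qed.

Lemma sderiv_cpow f z l e : sderiv f z l -> exists m, sderiv (fun w => cpow (f w) e) z m.
Proof.
  intros Hf. induction e as [|e [m IH]]; cbn [cpow].
  - exists 0. apply sderiv_const.
  - eexists. apply (sderiv_mult (fun w => cpow (f w) e) f); eassumption.
Qed.

(** Here gamma' = (a, N b; c / N, d) and the triangular factor is diag(N, 1). As a = 1 + k N, the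
    new argument g tau + g b + g k T is a lattice translate of g tau, and after the quadratic
    exponents cancel only a root of unity is left. *)
Lemma thetaq_Gamma1 N g h a b c d tau : (0 < g < N)%Z -> (0 < h < N)%Z -> Gamma1 N a b c d -> upper tau ->
  exists k : Z, thetaq N g h (mob a b c d tau) =
    ee (zc ((g - h) * (b + k)) / 2 + zc ((g * g - h * h) * (a * b)) / (2 * zc N)) * thetaq N g h tau.
Proof.
  intros Hg Hh [HS [[k Hk] [_ [c' Hc]]]] Ht. exists k.
  assert (NN : zc N <> 0) by (apply zc_neq_0; lia).
  assert (N2 : RtoC 2 <> 0) by (intros Z; injection Z; lra).
  assert (HT := upper_zc N tau ltac:(lia) Ht).
  assert (Nh : ~ (N | h)%Z) by (intros D; apply Z.divide_pos_le in D; lia).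
  assert (HS' : SL2Z a (N * b) c' d) by (unfold SL2Z in *; rewrite Hc in HS; lia).
  assert (K := thetaq_transform N g h a b c d a (N * b) c' d N 0 1 tau ltac:(lia) Nh HS HS'
    ltac:(lia) ltac:(lia) ltac:(ring) ltac:(ring) ltac:(lia) ltac:(ring) Ht).
  cbv zeta in K. rewrite K. clear K.
  replace (affine N 0 1 tau) with (zc N * tau) by (unfold affine, zc; field).
  set (T := zc N * tau) in *.
  assert (Ea : zc a = 1 + zc k * zc N).
  { replace a with (1 + k * N)%Z by lia. rewrite zc_plus, zc_mult. reflexivity. }
  assert (Z : forall g, zc g * (zc a * T + zc (N * b)) / zc N =
     zc g * tau + RtoC (IZR (g * b)) + RtoC (IZR (g * k)) * T).
  { intros g'. fold (zc (g' * b)) (zc (g' * k)). rewrite Ea, !zc_mult. unfold T. field. exact NN. }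
  rewrite !Z, !theta_lattice by exact HT. unfold thetaq. fold T.
  fold (zc (g * b)) (zc (g * k)) (zc (h * b)) (zc (h * k)).
  assert (Y0 := theta_nome_neq_0 N h tau Hh Ht). fold T in Y0.
  set (X := theta (zc g * tau) T). set (Y := theta (zc h * tau) T) in *.
  match goal with |- ee ?e0 * (ee ?e1 * X / (ee ?e2 * Y)) = ee ?e3 * (ee ?e4 * (X / Y)) =>
    replace (ee e0 * (ee e1 * X / (ee e2 * Y))) with (ee (e0 + e1 - e2) * (X / Y))
      by (rewrite ee_minus, ee_plus; field; split; [exact Y0|apply ee_nz]);
    replace (ee e3 * (ee e4 * (X / Y))) with (ee (e3 + e4) * (X / Y)) by (rewrite ee_plus; ring) end.
  f_equal. f_equal. unfold T.
  rewrite !zc_mult, !zc_minus, !zc_plus, !zc_mult, !Ea. field. auto.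
Qed.

(** The two divisibilities make the [e]-th power of the multiplier in [thetaq_Gamma1] equal to 1 for
    all [a], [b] and [k]. *)
Lemma thetaq_power_modular (N g h : Z) (e : nat) (f : C -> C) :
  (0 < g < N)%Z -> (0 < h < N)%Z ->
  (2 | Z.of_nat e * (g - h))%Z -> (2 * N | Z.of_nat e * (g * g - h * h))%Z ->
  (forall tau, upper tau -> f tau = cpow (thetaq N g h tau) e) ->
  modular_function_Gamma1 N f.
Proof.
  intros Hg Hh [p Hp] [q Hq] Hf.
  assert (NN : zc N <> 0) by (apply zc_neq_0; lia).
  assert (N2 : RtoC 2 <> 0) by (intros Z; injection Z; lra).
  split.
  (* No poles occur in the upper half-plane: the denominator theta (h tau) (N tau) does not vanish
     for 0 < h < N. *)
  - exists (fun _ => False). split; [split; [split; [|split]|]|].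
    + intros p' [].
    + intros z _. exists 1%R. split; [lra|]. intros w [].
    + intros p' [].
    + intros z Hz _. destruct (thetaq_sderiv N g h z Hg Hh Hz) as [l Hl].
      destruct (sderiv_cpow _ _ _ e Hl) as [m Hm]. exists m. apply sderiv_is_derive.
      apply (sderiv_upper_ext (fun w => cpow (thetaq N g h w) e)); auto. intros w Hw. symmetry. auto.
    + intros a b c d HG tau Ht _ _.
      rewrite (Hf tau Ht), (Hf (mob a b c d tau)) by (apply mob_upper; [apply HG|exact Ht]).
      destruct (thetaq_Gamma1 N g h a b c d tau Hg Hh HG Ht) as [k ->].
      rewrite !cpow_Cpow, Cpow_mult_l, ee_pow, INR_IZR_INZ. fold (zc (Z.of_nat e)).
      replace (zc (Z.of_nat e) * (zc ((g - h) * (b + k)) / 2 + zc ((g * g - h * h) * (a * b)) / (2 * zc N)))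
        with (zc (p * (b + k) + q * (a * b))).
      * rewrite ee_zc. ring.
      * replace (zc (Z.of_nat e) * (zc ((g - h) * (b + k)) / 2 + zc ((g * g - h * h) * (a * b)) / (2 * zc N)))
          with (zc (Z.of_nat e * (g - h)) * zc (b + k) / 2 +
                zc (Z.of_nat e * (g * g - h * h)) * zc (a * b) / (2 * zc N)) by (rewrite !zc_mult; field; auto).
        rewrite Hp, Hq, zc_plus, !zc_mult. change (zc 2) with (RtoC 2). field. auto.
  - intros a b c d HS.
    assert (Ng : ~ (N | g)%Z) by (intros D; apply Z.divide_pos_le in D; lia).
    assert (Nh : ~ (N | h)%Z) by (intros D; apply Z.divide_pos_le in D; lia).
    destruct (hermite_factor N a b c d ltac:(lia) HS) as
      [a' [b' [c' [d' [A [B [D [HS' [HA [HD [E1 [E2 [E3 E4]]]]]]]]]]]]].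
    assert (ND : zc D <> 0) by (apply zc_neq_0; lia).
    assert (L : laurent (2 * N * N * D) (fun tau => f (mob a b c d tau))).
    { apply (laurent_ext _ (fun tau => cpow (thetaq N g h (mob a b c d tau)) e)).
      { intros tau Ht. rewrite Hf; [reflexivity|]. apply mob_upper; assumption. }
      apply laurent_pow.
      set (w := fun tau => zc a' * affine A B D tau + zc b').
      (* The first exponent is (g^2 - h^2) a' w / (2 N^2) with w = a' (A tau + B) / D + b', split
         into its linear and constant parts in tau. *)
      apply (laurent_ext _ (fun tau =>
        ee (zc ((g * g - h * h) * a' * a' * A) * tau / zc (2 * N * N * D) +
            (zc g * zc g - zc h * zc h) * (zc a' * (zc a' * zc B / zc D + zc b')) / (2 * (zc N * zc N))) *
        (theta (zc g * w tau / zc N) (affine A B D tau) * / theta (zc h * w tau / zc N) (affine A B D tau)))).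
      - intros tau Ht.
        rewrite (thetaq_transform N g h a b c d a' b' c' d' A B D tau) by (assumption || lia).
        fold (w tau). unfold Cdiv at 5. f_equal. f_equal. unfold w, affine.
        rewrite !zc_mult, !zc_minus, !zc_mult. change (zc 2) with (RtoC 2). field. auto.
      - apply laurent_mult; [apply laurent_exp|]. apply laurent_mult.
        + apply (theta_laurent N g a' b' c' d' A B D); auto; lia.
        + apply (laurent_inv _ (fun tau => theta (zc h * w tau / zc N) (affine A B D tau))).
          * intros tau Ht E. assert (HT := affine_upper A B D tau HA HD Ht).
            apply theta_eq_0 in E; [|exact HT]. revert E. apply (not_lattice N h a' b' c' d'); auto; lia.
          * apply (theta_laurent N h a' b' c' d' A B D); auto; lia. }
    assert (HH : (0 < 2 * N * N * D)%Z) by (repeat apply Z.mul_pos_pos; lia).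
    destruct (laurent_is_series _ _ HH L) as [n0 [coef [M S]]].
    exists (Z.to_nat (2 * N * N * D)), n0, coef, M. split; [lia|exact S].
Qed.

(** The exponent is (N / 2) (B_2(g / N) - B_2(h / N)) with the second Bernoulli polynomial; it is
    3/4 for (N, g, h) = (10, 1, 4) and 1/4 for (10, 2, 3). *)
Lemma thetaq_nome N g h tau : (0 < g < N)%Z -> (0 < h < N)%Z -> upper tau ->
  thetaq N g h tau =
  ee (((zc g * zc g - zc h * zc h) / (2 * zc N) - (zc g - zc h) / 2) * tau) *
    qpoch_inf (ee tau ^ Z.to_nat g) (ee tau ^ Z.to_nat N) *
    qpoch_inf (ee tau ^ Z.to_nat (N - g)) (ee tau ^ Z.to_nat N) /
  (qpoch_inf (ee tau ^ Z.to_nat h) (ee tau ^ Z.to_nat N) *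
    qpoch_inf (ee tau ^ Z.to_nat (N - h)) (ee tau ^ Z.to_nat N)).
Proof.
  intros Hg Hh Ht. assert (NN : zc N <> 0) by (apply zc_neq_0; lia).
  assert (N2 : RtoC 2 <> 0) by (intros Z; injection Z; lra).
  assert (Y := theta_nome_neq_0 N h tau Hh Ht).
  unfold thetaq. rewrite (theta_nome N h) in Y |- * by exact Hh. rewrite (theta_nome N g) by exact Hg.
  set (P1 := qpoch_inf (ee tau ^ Z.to_nat g) _). set (P2 := qpoch_inf (ee tau ^ Z.to_nat (N - g)) _).
  set (P3 := qpoch_inf (ee tau ^ Z.to_nat h) _) in *. set (P4 := qpoch_inf (ee tau ^ Z.to_nat (N - h)) _) in *.
  assert (Y3 : P3 <> 0). { intros E. apply Y. rewrite E. ring. }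
  assert (Y4 : P4 <> 0). { intros E. apply Y. rewrite E. ring. }
  replace (((zc g * zc g - zc h * zc h) / (2 * zc N) - (zc g - zc h) / 2) * tau) with
    ((zc g * zc g - zc h * zc h) * tau / (2 * zc N) + - zc g / 2 * tau - - zc h / 2 * tau) by (field; auto).
  rewrite ee_minus, ee_plus. field. repeat split; auto using ee_nz.
Qed.

(** The arguments of theta and the exponent of the prefactor are homogeneous of degree 1 in (N, g,
    h). *)
Lemma thetaq_scale N g h m tau : (0 < N)%Z -> (0 < m)%Z ->
  thetaq N g h (zc m * tau) = thetaq (N * m) (g * m) (h * m) tau.
Proof.
  intros HN Hm. unfold thetaq. rewrite !zc_mult, <- !Cmult_assoc. f_equal. f_equal.
  assert (NN : zc N <> 0) by (apply zc_neq_0; lia). assert (NM : zc m <> 0) by (apply zc_neq_0; lia).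
  assert (N2 : RtoC 2 <> 0) by (intros Z; injection Z; lra). field. auto.
Qed.

Lemma Ifun_thetaq tau : upper tau -> Ifun tau = thetaq 10 1 4 tau.
Proof.
  intros Ht. rewrite thetaq_nome by (lia || exact Ht). unfold Ifun, qq. cbv zeta.
  rewrite !cpow_Cpow, !qpow_ee, Cmult_1_l.
  change (Z.to_nat 10) with 10%nat. change (Z.to_nat (10 - 1)) with 9%nat. change (Z.to_nat 4) with 4%nat.
  change (Z.to_nat (10 - 4)) with 6%nat. change (Z.to_nat 1) with 1%nat. rewrite Cpow_1_r.
  replace (RtoC (3 / 4)) with ((zc 1 * zc 1 - zc 4 * zc 4) / (2 * zc 10) - (zc 1 - zc 4) / 2); [reflexivity|].
  unfold zc. rewrite <- !RtoC_mult, <- !RtoC_minus, <- !RtoC_div, <- RtoC_minus by lra. f_equal. field.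
Qed.

Lemma Jfun_thetaq tau : upper tau -> Jfun tau = thetaq 10 2 3 tau.
Proof.
  intros Ht. rewrite thetaq_nome by (lia || exact Ht). unfold Jfun, qq. cbv zeta.
  rewrite !cpow_Cpow, !qpow_ee, Cmult_1_l.
  change (Z.to_nat 10) with 10%nat. change (Z.to_nat (10 - 2)) with 8%nat. change (Z.to_nat 3) with 3%nat.
  change (Z.to_nat (10 - 3)) with 7%nat. change (Z.to_nat 2) with 2%nat.
  replace (RtoC (1 / 4)) with ((zc 2 * zc 2 - zc 3 * zc 3) / (2 * zc 10) - (zc 2 - zc 3) / 2); [reflexivity|].
  unfold zc. rewrite <- !RtoC_mult, <- !RtoC_minus, <- !RtoC_div, <- RtoC_minus by lra. f_equal. field.
Qed.

Theorem theorem3p3 :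
  modular_function_Gamma1 10 (fun tau => cpow (Ifun tau) 4) /\
  modular_function_Gamma1 10 (fun tau => cpow (Jfun tau) 4) /\
  modular_function_Gamma1 40 (fun tau => Ifun (RtoC 4 * tau)) /\
  modular_function_Gamma1 40 (fun tau => Jfun (RtoC 4 * tau)).
Proof.
  split; [|split; [|split]].
  (* 4 (1 - 4) = 2 (-6) and 4 (1 - 16) = 20 (-3). *)
  - apply (thetaq_power_modular 10 1 4 4); try lia; [exists (-6)%Z; reflexivity|exists (-3)%Z; reflexivity|].
    intros tau Ht. rewrite Ifun_thetaq by exact Ht. reflexivity.
  - apply (thetaq_power_modular 10 2 3 4); try lia; [exists (-2)%Z; reflexivity|exists (-1)%Z; reflexivity|].
    intros tau Ht. rewrite Jfun_thetaq by exact Ht. reflexivity.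
  (* 4 - 16 = 2 (-6) and 16 - 256 = 80 (-3): the same quotients as for the fourth power. *)
  - apply (thetaq_power_modular 40 4 16 1); try lia; [exists (-6)%Z; reflexivity|exists (-3)%Z; reflexivity|].
    intros tau Ht. cbn [cpow]. rewrite Cmult_1_l, Ifun_thetaq by (apply (upper_zc 4); [lia|exact Ht]).
    exact (thetaq_scale 10 1 4 4 tau ltac:(lia) ltac:(lia)).
  - apply (thetaq_power_modular 40 8 12 1); try lia; [exists (-2)%Z; reflexivity|exists (-1)%Z; reflexivity|].
    intros tau Ht. cbn [cpow]. rewrite Cmult_1_l, Jfun_thetaq by (apply (upper_zc 4); [lia|exact Ht]).
    exact (thetaq_scale 10 2 3 4 tau ltac:(lia) ltac:(lia)).
Qed.
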